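(* For every $r>0$ and every $\xi\in(1,2)$ there exists a constant $C>0$ such that for all $f\in E(S^1)$ with $\operatorname{dist}(f,S^1)\ge r$ one has \[ \bigl|\,\|\tilde\omega_f\|_{\rm ir}-1\,\bigr|\le C\,\operatorname{dist}(f,S^2_+)^{\xi}. \]
   Context: $E(S^1)$ is the set of functions $f:\mathbb{R}\to\mathbb{R}$ (write $f_\alpha=f(\alpha)$) that are $1$-Lipschitz and satisfy $f_{\alpha+\pi}+f_\alpha=\pi$ for all $\alpha\in\mathbb{R}$. Such functions are $2\pi$-periodic with values in $[0,\pi]$. $E(S^1)$ carries the sup norm $\|\cdot\|_\infty$, and $\operatorname{dist}$ denotes distance with respect to this norm. $S^1\subset E(S^1)$ is the set of functions $\alpha\mapsto\arccos(\cos(\alpha-\tau))$ with $\tau\in\mathbb{R}$. $S^2_+\subset E(S^1)$ is the set of functions $\alpha\mapsto\arccos(\cos(d)\cos(\alpha-\tau))$ with $\tau\in\mathbb{R}$ and $d\in[0,\pi/2]$. A function $f\in E(S^1)\setminus S^1$ takes values in $(0,\pi)$. For such $f$ and for $\alpha,\beta$ with $\beta-\alpha\notin\pi\mathbb{Z}$, define \[ p_{\alpha,\beta}(f)=\frac{1-\cos(\beta-\alpha)^2-\cos(f_\alpha)^2-\cos(f_\beta)^2+2\cos(\beta-\alpha)\cos(f_\alpha)\cos(f_\beta)}{\sin(\beta-\alpha)^2\sin(f_\alpha)^2\sin(f_\beta)^2}. \] For $v,w\in L^\infty([0,\pi))$ set \[ \tilde\omega_f(v\wedge w)=\frac1\pi\int_0^\pi\int_\alpha^\pi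 p_{\alpha,\beta}(f)\,(v_\alpha w_\beta-v_\beta w_\alpha)\,d\beta\,d\alpha. \] The inscribed Riemannian area $\mu^{\rm ir}(v\wedge w)$ is defined as follows. If $v,w$ are linearly dependent, it is $0$. Otherwise, let $V=\mathrm{span}(v,w)$ with the norm $\|\cdot\|_\infty$. Then $\mu^{\rm ir}(v\wedge w)$ is the measure of the parallelogram spanned by $v,w$ under the Haar measure on $V$ normalized so that the ellipse of maximal area contained in the unit ball of $V$ (the Löwner–John ellipse) has measure $\pi$. The comass $\|\tilde\omega_f\|_{\rm ir}$ is the infimum of all $M\ge0$ such that $|\tilde\omega_f(v\wedge w)|\le M\mu^{\rm ir}(v\wedge w)$ for all $v,w\in L^\infty([0,\pi))$. *)

(* Defs.v *)
From HB Require Import structures.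
From mathcomp Require Import all_boot all_order all_algebra.
From mathcomp Require Import all_classical all_reals all_analysis.
Set Implicit Arguments. Unset Strict Implicit. Unset Printing Implicit Defensive.
Import Order.TTheory GRing.Theory Num.Theory.
Import numFieldNormedType.Exports.
Local Open Scope classical_set_scope.
Local Open Scope ring_scope.

Section Defs.
Variable R : realType.

Definition ES1 (f : R -> R) : Prop :=
  (forall a b : R, `|f a - f b| <= `|a - b|) /\
  (forall a : R, f (a + pi) + f a = pi).

Definition supnorm (h : R -> R) : R := sup [set `|h a| | a in [set: R]].

Definition dist_sup (f : R -> R) (S : set (R -> R)) : R :=
  inf [set supnorm (fun a => f a - g a) | g in S].

Definition S1 : set (R -> R) :=
  [set g | exists tau : R, g = fun a => acos (cos (a - tau))].

Definition S2plus : set (R -> R) :=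
  [set g | exists (tau d : R), 0 <= d <= pi / 2 /\
           g = fun a => acos (cos d * cos (a - tau))].

Definition Linf (v : R -> R) : Prop :=
  measurable_fun `[0, pi[ v /\
  exists M : R, {ae (@lebesgue_measure R), forall x, `[0, pi[%classic x -> `|v x| <= M}.

Definition linf_norm (v : R -> R) : R :=
  inf [set M : R | 0 <= M /\
         {ae (@lebesgue_measure R), forall x, `[0, pi[%classic x -> `|v x| <= M}].

Definition p_ab (f : R -> R) (a b : R) : R :=
  (1 - cos (b - a) ^+ 2 - cos (f a) ^+ 2 - cos (f b) ^+ 2
     + 2 * cos (b - a) * cos (f a) * cos (f b)) /
  (sin (b - a) ^+ 2 * sin (f a) ^+ 2 * sin (f b) ^+ 2).

Definition omega_t (f v w : R -> R) : R :=
  pi^-1 * Rintegral (@lebesgue_measure R) `[0, pi]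
    (fun a => Rintegral (@lebesgue_measure R) `[a, pi]
       (fun b => p_ab f a b * (v a * w b - v b * w a))).

Definition Linf_dep (v w : R -> R) : Prop :=
  exists s t : R, (s != 0 \/ t != 0) /\ linf_norm (fun x => s * v x + t * w x) = 0.

(* In the coordinates (s,t) |-> s v + t w of V = span(v,w), the parallelogram
   spanned by v, w is [0,1]^2 (Lebesgue area 1), and an ellipse is the image of
   the closed unit disk under x |-> A x + c (A invertible), of area pi |det A|.
   Normalizing the Haar measure so that the maximal-area ellipse contained in the
   unit ball of V has measure pi gives mu_ir(v /\ w) = 1 / max |det A|. *)
Definition ellipse_in_ball (v w : R -> R) (a11 a12 a21 a22 c1 c2 : R) : Prop :=
  a11 * a22 - a12 * a21 != 0 /\
  forall x1 x2 : R, x1 ^+ 2 + x2 ^+ 2 <= 1 ->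
    linf_norm (fun y => (a11 * x1 + a12 * x2 + c1) * v y
                      + (a21 * x1 + a22 * x2 + c2) * w y) <= 1.

Definition max_ellipse_det (v w : R -> R) : R :=
  sup [set r : R | exists a11 a12 a21 a22 c1 c2 : R,
        ellipse_in_ball v w a11 a12 a21 a22 c1 c2 /\
        r = `|a11 * a22 - a12 * a21|].

Definition mu_ir (v w : R -> R) : R :=
  if `[< Linf_dep v w >] then 0 else (max_ellipse_det v w)^-1.

Definition comass_bounds (f : R -> R) : set R :=
  [set M : R | 0 <= M /\
     forall v w : R -> R, Linf v -> Linf w ->
       `|omega_t f v w| <= M * mu_ir v w].

(* comass ||tilde omega_f||_ir, as an extended real (+oo if no M works) *)
Definition comass_ir (f : R -> R) : \bar R :=
  ereal_inf (EFin @` comass_bounds f).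

End Defs.

(* Main.v *)
(* For g in S^2_+ \ S^1 the kernel factors as p_{a,b}(g) = th'(a) th'(b), where th(a) is the angle
   of the direction of the circle point a seen from the hemisphere point g.  In the variable th,
   the form omega is the quadratic form of antiperiodic integration, whose eigenvalues are 1
   and -1 on the first Fourier mode and at most pi/2 - 1 in absolute value on its orthogonal
   complement by a Schur test.  An ellipse in the unit ball of span(v, w) means that, after
   normalization, v^2 + w^2 <= 1 almost everywhere; hence the comass at g is 1, attained at
   (cos th, sin th), and every other pair pays a multiple of the squared L^2 norm of its
   component orthogonal to the first mode.

   If |f - g| <= eps, the Gram determinant in p_{a,b} is a quadratic polynomial in
   h = cos f - cos g, and p(f) - p(g) is of order eps / (eps + sin(b - a)), which has
   integral of order eps log(1/eps).  Multiplied by sin(th(b) - th(a)), it equals a term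
   linear in h plus a remainder of order eps^2 / (eps + sin(b - a)); the integral of the
   linear term is exactly zero.  So (cos th, sin th) gives the value 1 up to
   eps^2 log(1/eps), and the cross terms in the upper bound, of order eps log(1/eps) times
   the orthogonal component, are absorbed by the spectral gap at the cost of
   (eps log(1/eps))^2, which is O(eps^xi) for every xi < 2. *)

Require Import Defs.
From HB Require Import structures.
From mathcomp Require Import all_boot all_order all_algebra.
From mathcomp Require Import all_classical all_reals all_analysis.
From mathcomp Require Import measurable_realfun ring lra.

Set Implicit Arguments. Unset Strict Implicit. Unset Printing Implicit Defensive.
Import Order.TTheory GRing.Theory Num.Theory.
Import numFieldNormedType.Exports.
Local Open Scope classical_set_scope.
Local Open Scope ring_scope.

(** The distance r to S^1 enters the kernel estimates only through M = 1 / sin^2(r/2), which bounds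
    1 / sin^2 both at f and at the comparison point. The obstacle is the factor sin^2(b - a) in the
    denominator, which vanishes at b - a = 0 and at b - a = pi. The values of h at a and at b are
    treated as unrelated, so the expansion in h is useless where sin(b - a) < eps. There it is
    replaced by the bounds 0 and sin^2(b - a) for the Gram determinant, the lower one being the
    spherical triangle inequalities encoded in E(S^1); this is the origin of the weight eps / (eps +
    sin(b - a)). The change of variable th is never carried out: rho stays as a weight, and cos th,
    sin th enter through their derivatives, the identity cos^2 + sin^2 = 1 and antiperiodicity.
    Functions far from S^2_+ need no argument of their own: each lies within pi/2 < 2 of the
    constant pi/2, the pole of the hemisphere, so the same estimate with eps = 2 bounds their
    comass. *)

Section Derivatives.
Variable R : realType.

(* A transparent alias of the class [is_derive], hidden from instance resolution so
   that derivatives can be computed by explicit application of the rules below. *)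
Definition has_deriv (x : R) (F : R -> R) (l : R) : Prop := is_derive x 1 F l.

Lemma deriv_ext (F : R -> R) (x l l' : R) : has_deriv x F l -> l = l' -> has_deriv x F l'.
Proof. by move=> h <-. Qed.

Lemma has_deriv_continuous (F F' : R -> R) : (forall x : R, has_deriv x F (F' x)) -> continuous F.
Proof.
move=> dF x; apply: differentiable_continuous; apply/derivable1_diffP.
by case: (dF x).
Qed.

Lemma deriv_funD (F G : R -> R) (x a b : R) : has_deriv x F a -> has_deriv x G b ->
  has_deriv x (fun z => F z + G z) (a + b).
Proof. by move=> hF hG; exact: is_deriveD. Qed.

Lemma deriv_funM (F G : R -> R) (x a b : R) : has_deriv x F a -> has_deriv x G b ->
  has_deriv x (fun z => F z * G z) (F x * b + G x * a).
Proof. by move=> hF hG; exact: is_deriveM. Qed.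

Lemma deriv_funDl (F : R -> R) (c x a : R) : has_deriv x F a -> has_deriv x (fun z => c + F z) a.
Proof.
move=> hF; apply: deriv_ext (add0r a).
exact: deriv_funD (is_derive_cst c x (1 : R)) hF.
Qed.

Lemma deriv_funZ (F : R -> R) (c x a : R) : has_deriv x F a -> has_deriv x (fun z => c * F z) (c * a).
Proof.
move=> hF; apply: deriv_ext (deriv_funM (is_derive_cst c x (1 : R)) hF) _.
by rewrite mulr0 addr0.
Qed.

Lemma deriv_fun_comp (F G : R -> R) (x a b : R) : has_deriv (G x) F a -> has_deriv x G b ->
  has_deriv x (fun z => F (G z)) (a * b).
Proof. by move=> hF hG; exact: is_derive1_comp. Qed.

Lemma deriv_fun_subr (c x : R) : has_deriv x (fun z => z - c) 1.
Proof.
have := deriv_funD (is_derive_id x (1 : R)) (is_derive_cst (- c) x (1 : R)).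
by rewrite addr0.
Qed.

Lemma deriv_fun_shift (F : R -> R) (c x a : R) : has_deriv (x - c) F a ->
  has_deriv x (fun z => F (z - c)) a.
Proof.
by move=> hF; have := deriv_fun_comp (G := fun z => z - c) hF (deriv_fun_subr c x); rewrite mulr1.
Qed.

End Derivatives.

(** * Integrals over the triangle 0 < a < b < pi *)

Section TriangleIntegral.
Variable R : realType.
Notation mu := (@lebesgue_measure R).
Implicit Types (u v w : R -> R) (K L : R * R -> R).

Definition triangle : set (R * R) := [set z | 0 < z.1 /\ z.1 < z.2 /\ z.2 < pi].

(** Measurability is asked on the whole line, so that sums, products and compositions need no
    domain. The bound is asked on [0, pi], which contains both coordinates of a point of the
    triangle and their difference. *)
Definition bmeas1 u := measurable_fun [set: R] u /\
  exists M : R, forall x, 0 <= x <= pi -> `|u x| <= M.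

Definition bmeas2 K := measurable_fun [set: R * R] K /\
  exists M : R, forall z, triangle z -> `|K z| <= M.

Definition int1 u := Rintegral mu `]0, pi[ u.

Definition int2 K := Rintegral (mu \x mu)%E triangle K.

Lemma measurable_triangle : measurable triangle.
Proof.
pose g1 : R * R -> R := fst; pose g2 : R * R -> R := snd.
have m1 : measurable_fun [set: R * R] g1 by exact: measurable_fst.
have m2 : measurable_fun [set: R * R] g2 by exact: measurable_snd.
have -> : triangle = (g1 @^-1` `]0, +oo[) `&` ((g2 \- g1) @^-1` `]0, +oo[)
   `&` (g2 @^-1` `]-oo, pi[).
  apply/seteqP; split => z /=; rewrite !in_itv/= ?andbT subr_gt0.
    by move=> [? [? ?]].
  by move=> [[? ?] ?].
apply: measurableI; first apply: measurableI.
- by rewrite -[X in measurable X]setTI; exact: m1.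
- by rewrite -[X in measurable X]setTI; apply: measurable_funB.
- by rewrite -[X in measurable X]setTI; exact: m2.
Qed.

Lemma triangle_ltoo : ((mu \x mu)%E triangle < +oo)%E.
Proof.
apply: (@le_lt_trans _ _ ((mu \x mu)%E (`]0, pi[ `*` `]0, pi[))).
  apply: le_measure; rewrite ?inE; [exact: measurable_triangle|exact: measurableX|].
  move=> z [z1 [z12 z2]]; split; rewrite /= in_itv/=.
    by rewrite z1 (lt_trans z12).
  by rewrite z2 (lt_trans z1).
rewrite product_measure1E//= lebesgue_measure_itv/= lte_fin pi_gt0.
by rewrite -EFinB -EFinM ltry.
Qed.

Lemma bmeas2_integrable K : bmeas2 K -> (mu \x mu)%E.-integrable triangle (EFin \o K).
Proof.
move=> [mK [M KM]]; apply: measurable_bounded_integrable.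
- exact: measurable_triangle.
- exact: triangle_ltoo.
- exact: measurable_funS mK.
- exists M; split; first by rewrite num_real.
  by move=> x Mx z /= tz; rewrite (le_trans (KM _ tz))// ltW.
Qed.

Lemma itv_bounded_integrable u (a b : R) : measurable_fun [set: R] u ->
  (exists M : R, forall x, a < x < b -> `|u x| <= M) ->
  mu.-integrable `]a, b[ (EFin \o u).
Proof.
move=> mu_ [M uM]; apply: measurable_bounded_integrable => //.
- rewrite /= lebesgue_measure_itv/= ; case: ifPn => // _.
  by rewrite -EFinB ltry.
- exact: measurable_funS mu_.
- exists M; split; first by rewrite num_real.
  by move=> x Mx z /=; rewrite in_itv/= => tz; rewrite (le_trans (uM _ tz))// ltW.
Qed.

Lemma bmeas1_integrable u : bmeas1 u -> mu.-integrable `]0, pi[ (EFin \o u).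
Proof.
move=> [mu_ [M uM]]; apply: itv_bounded_integrable => //.
by exists M => x /andP[x0 xpi]; rewrite uM// !ltW.
Qed.

Lemma bmeas1_cst (c : R) : bmeas1 (fun=> c).
Proof. by split; [exact: measurable_cst|exists `|c|]. Qed.

Lemma bmeas1D u v : bmeas1 u -> bmeas1 v -> bmeas1 (fun x => u x + v x).
Proof.
move=> [mu_ [M uM]] [mv [N vN]]; split; first exact: measurable_funD.
exists (M + N) => x x0; apply: le_trans (ler_normD _ _) _.
by rewrite lerD ?uM ?vN.
Qed.

Lemma bmeas1M u v : bmeas1 u -> bmeas1 v -> bmeas1 (fun x => u x * v x).
Proof.
move=> [mu_ [M uM]] [mv [N vN]]; split; first exact: measurable_funM.
exists (M * N) => x x0; rewrite normrM.
by rewrite ler_pM ?uM ?vN.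
Qed.

Lemma bmeas1N u : bmeas1 u -> bmeas1 (fun x => - u x).
Proof.
move=> [mu_ [M uM]]; split; first exact: measurableT_comp.
by exists M => x x0; rewrite normrN uM.
Qed.

Lemma bmeas1X u n : bmeas1 u -> bmeas1 (fun x => u x ^+ n).
Proof.
move=> bu; elim: n => [|n ih]; first exact: bmeas1_cst.
by under [X in bmeas1 X]eq_fun do rewrite exprS; exact: bmeas1M.
Qed.

Lemma continuous_bmeas1 u : continuous u -> bmeas1 u.
Proof.
move=> cu; split; first exact: continuous_measurable_fun.
have : compact (u @` `[0, pi]).
  apply: continuous_compact; last exact: segment_compact.
  exact: continuous_subspaceT.
move=> /compact_bounded [M [_ Mb]]; exists (M + 1) => x x0.
apply: (Mb (M + 1)); first by rewrite ltrDl.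
by exists x => //=; rewrite in_itv.
Qed.

Lemma bmeas2_cst (c : R) : bmeas2 (fun=> c).
Proof. by split; [exact: measurable_cst|exists `|c|]. Qed.

Lemma bmeas2D K L : bmeas2 K -> bmeas2 L -> bmeas2 (fun z => K z + L z).
Proof.
move=> [mK [M KM]] [mL [N LN]]; split; first exact: measurable_funD.
exists (M + N) => x x0; apply: le_trans (ler_normD _ _) _.
by rewrite lerD ?KM ?LN.
Qed.

Lemma bmeas2M K L : bmeas2 K -> bmeas2 L -> bmeas2 (fun z => K z * L z).
Proof.
move=> [mK [M KM]] [mL [N LN]]; split; first exact: measurable_funM.
exists (M * N) => x x0; rewrite normrM.
by rewrite ler_pM ?KM ?LN.
Qed.

Lemma bmeas2N K : bmeas2 K -> bmeas2 (fun z => - K z).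
Proof.
move=> [mK [M KM]]; split; first exact: measurableT_comp.
by exists M => x x0; rewrite normrN KM.
Qed.

Lemma bmeas2B K L : bmeas2 K -> bmeas2 L -> bmeas2 (fun z => K z - L z).
Proof. by move=> bK bL; apply: bmeas2D => //; exact: bmeas2N. Qed.

Lemma bmeas2X K n : bmeas2 K -> bmeas2 (fun z => K z ^+ n).
Proof.
move=> bK; elim: n => [|n ih]; first exact: bmeas2_cst.
by under [X in bmeas2 X]eq_fun do rewrite exprS; exact: bmeas2M.
Qed.

Lemma bmeas2_fst u : bmeas1 u -> bmeas2 (fun z => u z.1).
Proof.
move=> [mu_ [M uM]]; split; first exact: (measurableT_comp mu_ measurable_fst).
exists M => z [z1 [z12 z2]]; apply: uM.
by rewrite ltW//= ltW// (lt_trans z12).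
Qed.

Lemma bmeas2_snd u : bmeas1 u -> bmeas2 (fun z => u z.2).
Proof.
move=> [mu_ [M uM]]; split; first exact: (measurableT_comp mu_ measurable_snd).
exists M => z [z1 [z12 z2]]; apply: uM.
by rewrite ltW//= ?ltW// (lt_trans z1).
Qed.

Lemma bmeas2_diff u : bmeas1 u -> bmeas2 (fun z => u (z.2 - z.1)).
Proof.
move=> [mu_ [M uM]]; split.
  apply: (measurableT_comp mu_).
  by apply: measurable_funB; [exact: measurable_snd|exact: measurable_fst].
exists M => z [z1 [z12 z2]]; apply: uM.
by rewrite subr_ge0 ltW//= lerBlDr ltW// (lt_trans z2)// ltrDl.
Qed.

(** The total inverse takes the value 0 at 0, its only discontinuity; that point is split off. *)
Lemma measurable_fun_inv : measurable_fun [set: R] (fun x : R => x^-1).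
Proof.
rewrite -(setvU [set 0 : R]); apply/measurable_funU => //.
  by apply: measurableC; exact: measurable_set1.
split; last exact: measurable_fun_set1.
apply: open_continuous_measurable_fun.
  by apply: closed_openC; exact: closed_eq.
by move=> x; rewrite inE/= => /eqP x0; exact: inv_continuous.
Qed.

Lemma eq_int1 u v : (forall x, 0 < x < pi -> u x = v x) -> int1 u = int1 v.
Proof.
by move=> uv; apply: eq_Rintegral => x; rewrite inE/= in_itv/= => /uv.
Qed.

Lemma int1D u v : bmeas1 u -> bmeas1 v ->
  int1 (fun x => u x + v x) = int1 u + int1 v.
Proof. by move=> bu bv; apply: RintegralD => //; exact: bmeas1_integrable. Qed.

Lemma int1B u v : bmeas1 u -> bmeas1 v ->
  int1 (fun x => u x - v x) = int1 u - int1 v.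
Proof. by move=> bu bv; apply: RintegralB => //; exact: bmeas1_integrable. Qed.

Lemma int1Z c u : bmeas1 u -> int1 (fun x => c * u x) = c * int1 u.
Proof. by move=> bu; apply: RintegralZl => //; exact: bmeas1_integrable. Qed.

Lemma int1_cst c : int1 (fun=> c) = c * pi.
Proof.
rewrite /int1 Rintegral_cst//= lebesgue_measure_itv/= lte_fin pi_gt0/=.
by rewrite subr0.
Qed.

Lemma le_int1 u v : bmeas1 u -> bmeas1 v ->
  (forall x, 0 < x < pi -> u x <= v x) -> int1 u <= int1 v.
Proof.
by move=> bu bv uv; apply: le_Rintegral => //; exact: bmeas1_integrable.
Qed.

Lemma eq_int2 K L : (forall z, triangle z -> K z = L z) -> int2 K = int2 L.
Proof. by move=> KL; apply: eq_Rintegral => z; rewrite inE => /KL. Qed.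

Lemma int2D K L : bmeas2 K -> bmeas2 L ->
  int2 (fun z => K z + L z) = int2 K + int2 L.
Proof.
by move=> bK bL; apply: RintegralD;
  [exact: measurable_triangle|exact: bmeas2_integrable..].
Qed.

Lemma int2B K L : bmeas2 K -> bmeas2 L ->
  int2 (fun z => K z - L z) = int2 K - int2 L.
Proof.
by move=> bK bL; apply: RintegralB;
  [exact: measurable_triangle|exact: bmeas2_integrable..].
Qed.

Lemma int2Z c K : bmeas2 K -> int2 (fun z => c * K z) = c * int2 K.
Proof.
by move=> bK; apply: RintegralZl;
  [exact: measurable_triangle|exact: bmeas2_integrable].
Qed.

Lemma int2N K : bmeas2 K -> int2 (fun z => - K z) = - int2 K.
Proof.
move=> bK; rewrite -mulN1r -int2Z//; apply: eq_int2 => z _.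
by rewrite mulN1r.
Qed.

Lemma le_int2 K L : bmeas2 K -> bmeas2 L ->
  (forall z, triangle z -> K z <= L z) -> int2 K <= int2 L.
Proof.
move=> bK bL KL; apply: le_Rintegral => //.
  exact: measurable_triangle.
all: exact: bmeas2_integrable.
Qed.

Lemma integral_derivative (F f : R -> R) (a b : R) : a <= b ->
  (forall x, a <= x <= b -> has_deriv x F (f x)) ->
  (forall x, a <= x <= b -> {for x, continuous f}) ->
  Rintegral mu `]a, b[ f = F b - F a.
Proof.
rewrite le_eqVlt => /predU1P[<- _ _|ab dF cf].
  by rewrite set_itvoo0 Rintegral_set0 subrr.
have wcf : {within `[a, b], continuous f}.
  by apply: continuous_in_subspaceT => x; rewrite inE/= in_itv/= => /cf.
have /(integrableS) if_ : mu.-integrable `[a, b] (EFin \o f).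
  by apply: continuous_compact_integrable => //; exact: segment_compact.
have sub : `]a, b[ `<=` (`[a, b]%classic : set R) by exact: subset_itv_oo_cc.
rewrite Rintegral_itv_bndo_bndc; last exact: if_.
rewrite Rintegral_itv_obnd_cbnd; last first.
  by apply: if_ => //; apply: subset_itvr; rewrite bnd_simp.
rewrite /Rintegral (continuous_FTC2 ab wcf (F := F))//.
- have cF x : a <= x <= b -> {for x, continuous F}.
    by move=> xab; apply: differentiable_continuous; apply/derivable1_diffP; case: (dF x xab).
  split.
  + by move=> x; rewrite in_itv/= => /andP[ax xb]; case: (dF x); rewrite ?ltW.
  + by apply/cvg_at_right_filter/cF; rewrite lexx ltW.
  + by apply/cvg_at_left_filter/cF; rewrite lexx ltW.
- move=> x; rewrite in_itv/= => /andP[ax xb]; rewrite derive1E.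
  by case: (dF x); rewrite ?ltW.
Qed.

Lemma measurable_section1 K a : measurable_fun [set: R * R] K ->
  measurable_fun [set: R] (fun b => K (a, b)).
Proof.
move=> mK; apply: (measurableT_comp mK).
by apply: measurable_fun_pair => //; exact: measurable_cst.
Qed.

Lemma measurable_section2 K b : measurable_fun [set: R * R] K ->
  measurable_fun [set: R] (fun a => K (a, b)).
Proof.
move=> mK; apply: (measurableT_comp mK).
by apply: measurable_fun_pair => //; exact: measurable_cst.
Qed.

Lemma bmeas2_section1 K a : bmeas2 K -> 0 < a < pi ->
  mu.-integrable `]a, pi[ (EFin \o (fun b => K (a, b))).
Proof.
move=> [mK [M KM]] /andP[a0 api]; apply: itv_bounded_integrable.
  exact: measurable_section1.
by exists M => x /andP[ax xpi]; apply: KM.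
Qed.

Lemma bmeas2_section2 K b : bmeas2 K -> 0 < b < pi ->
  mu.-integrable `]0, b[ (EFin \o (fun a => K (a, b))).
Proof.
move=> [mK [M KM]] /andP[b0 bpi]; apply: itv_bounded_integrable.
  exact: measurable_section2.
by exists M => x /andP[ax xpi]; apply: KM.
Qed.

Let inner1 K a := Rintegral mu `]a, pi[ (fun b => K (a, b)).
Let inner2 K b := Rintegral mu `]0, b[ (fun a => K (a, b)).

(** Fubini is applied to the kernel extended by zero to the plane: the slice of the triangle over a
    is ]a, pi[ for a in ]0, pi[ and empty otherwise. *)
Let fubini_F_triangle K : bmeas2 K ->
  (fun a => (\int[mu]_b ((EFin \o K) \_ triangle) (a, b))%E) = (EFin \o inner1 K) \_ `]0, pi[.
Proof.
move=> bK; apply/funext => a.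
rewrite patchE; case: ifPn => [|]; rewrite ?notin_setE ?inE/= in_itv/=.
  move=> a0pi; rewrite /inner1 /Rintegral fineK; last by apply: integrable_fin_num => //; exact: bmeas2_section1.
  rewrite [RHS]integral_mkcond; apply: eq_integral => b _.
  rewrite !patchE; congr (if _ then _ else _); case/andP: (a0pi) => a0 _.
  apply/idP/idP; rewrite !inE /triangle/= in_itv/=.
    by move=> [_ [-> ->]].
  by move=> /andP[-> ->].
move=> na; rewrite integral0_eq// => b _; rewrite patchE ifF//.
apply/negP; rewrite inE /triangle/= => -[a0 [ab bpi]]; apply: na.
by rewrite a0 (lt_trans ab).
Qed.

Let fubini_G_triangle K : bmeas2 K ->
  (fun b => (\int[mu]_a ((EFin \o K) \_ triangle) (a, b))%E) = (EFin \o inner2 K) \_ `]0, pi[.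
Proof.
move=> bK; apply/funext => b.
rewrite patchE; case: ifPn => [|]; rewrite ?notin_setE ?inE/= in_itv/=.
  move=> b0pi; rewrite /inner2 /Rintegral fineK; last by apply: integrable_fin_num => //; exact: bmeas2_section2.
  rewrite [RHS]integral_mkcond; apply: eq_integral => a _.
  rewrite !patchE; congr (if _ then _ else _); case/andP: (b0pi) => _ bpi.
  apply/idP/idP; rewrite !inE /triangle/= in_itv/=.
    by move=> [-> [-> _]].
  by move=> /andP[-> ->].
move=> nb; rewrite integral0_eq// => a _; rewrite patchE ifF//.
apply/negP; rewrite inE /triangle/= => -[a0 [ab bpi]]; apply: nb.
by rewrite bpi (lt_trans a0).
Qed.

Let integrable_triangle K : bmeas2 K ->
  (mu \x mu)%E.-integrable setT ((EFin \o K) \_ triangle).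
Proof.
move=> bK; have := bmeas2_integrable bK.
by move/(iffLR (integrable_mkcond _ _)); apply; exact: measurable_triangle.
Qed.

Lemma integrable_inner1 K : bmeas2 K ->
  mu.-integrable `]0, pi[ (EFin \o (fun a => Rintegral mu `]a, pi[ (fun b => K (a, b)))).
Proof.
move=> bK; apply/integrable_mkcond => //.
have := integrable_fubini_F (integrable_triangle bK).
by rewrite /fubini_F (fubini_F_triangle bK).
Qed.

Lemma integrable_inner2 K : bmeas2 K ->
  mu.-integrable `]0, pi[ (EFin \o (fun b => Rintegral mu `]0, b[ (fun a => K (a, b)))).
Proof.
move=> bK; have iK := integrable_triangle bK; apply/integrable_mkcond => //.
have mK := measurable_int _ iK.
(* Integrability of the inner integral in the other variable is obtained by exchanging the
   coordinates. *)
pose K' (z : R * R) := ((EFin \o K) \_ triangle) (z.2, z.1).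
have mK' : measurable_fun [set: R * R] K'.
  apply: (measurableT_comp mK); apply: measurable_fun_pair.
    exact: measurable_snd.
  exact: measurable_fst.
have iK' : (mu \x mu)%E.-integrable setT K'.
  by apply: (iffRL (integrable12ltyP _ _ _)) => //; apply: (iffLR (integrable21ltyP _ _ _) iK).
have := integrable_fubini_F iK'.
by rewrite /fubini_F /K'/= (fubini_G_triangle bK).
Qed.

Lemma int2_iterated1 K : bmeas2 K ->
  int2 K = int1 (fun a => Rintegral mu `]a, pi[ (fun b => K (a, b))).
Proof.
move=> bK; rewrite /int2 /int1 /Rintegral integral_mkcond.
rewrite -integral12_prod_meas1; last exact: integrable_triangle.
by rewrite [in RHS]integral_mkcond /fubini_F (fubini_F_triangle bK).
Qed.

Lemma int2_iterated2 K : bmeas2 K ->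
  int2 K = int1 (fun b => Rintegral mu `]0, b[ (fun a => K (a, b))).
Proof.
move=> bK; rewrite /int2 /int1 /Rintegral integral_mkcond.
rewrite -integral21_prod_meas1; last exact: integrable_triangle.
by rewrite [in RHS]integral_mkcond /fubini_G (fubini_G_triangle bK).
Qed.

Lemma int2_fstM u K : bmeas1 u -> bmeas2 K ->
  int2 (fun z => u z.1 * K z) =
  int1 (fun a => u a * Rintegral mu `]a, pi[ (fun b => K (a, b))).
Proof.
move=> bu bK; rewrite int2_iterated1; last by apply: bmeas2M => //; exact: bmeas2_fst.
apply: eq_int1 => a a0pi; rewrite /= RintegralZl//; exact: bmeas2_section1.
Qed.

Lemma int2_sndM u K : bmeas1 u -> bmeas2 K ->
  int2 (fun z => u z.2 * K z) =
  int1 (fun b => u b * Rintegral mu `]0, b[ (fun a => K (a, b))).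
Proof.
move=> bu bK; rewrite int2_iterated2; last by apply: bmeas2M => //; exact: bmeas2_snd.
apply: eq_int1 => a a0pi; rewrite /= RintegralZl//; exact: bmeas2_section2.
Qed.

(** The triangle and its mirror image fill the square up to the diagonal. Iterating the two
    integrals in opposite orders makes u depend on the outer variable in both, and the inner
    integrals of v over ]0, a[ and ]a, pi[ add up. *)
Lemma int2_symmetrized u v : bmeas1 u -> bmeas1 v ->
  int2 (fun z => u z.1 * v z.2) + int2 (fun z => v z.1 * u z.2) = int1 u * int1 v.
Proof.
move=> bu bv.
have b12 u' v' : bmeas1 u' -> bmeas1 v' -> bmeas2 (fun z => u' z.1 * v' z.2).
  by move=> bu' bv'; apply: bmeas2M; [exact: bmeas2_fst|exact: bmeas2_snd].
rewrite int2_iterated1; last exact: b12.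
rewrite int2_iterated2; last exact: b12.
apply/eqP; rewrite addrC -subr_eq0 -addrA addr_eq0 opprB mulrC -int1Z//.
apply/eqP; rewrite /int1 -RintegralB//; first last.
- exact: (integrable_inner1 (b12 _ _ bu bv)).
- by apply/bmeas1_integrable/bmeas1M => //; exact: bmeas1_cst.
apply: eq_int1 => a /andP[a0 api].
have iv := bmeas1_integrable bv.
have iva : mu.-integrable `]a, pi[ (EFin \o v).
  by apply: integrableS iv => //; apply: subset_itvr; rewrite bnd_simp ltW.
have iv0 : mu.-integrable `]0, a[ (EFin \o v).
  by apply: integrableS iv => //; apply: subset_itvl; rewrite bnd_simp ltW.
rewrite /= RintegralZl// RintegralZr// [_ * u a]mulrC -mulrBr [RHS]mulrC; congr (_ * _).
rewrite -(Rintegral_itvB iv (x := a)) ?bnd_simp ?ltW//.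
by rewrite opprB addrC subrK Rintegral_itv_bndo_bndc.
Qed.

End TriangleIntegral.

(** * Pointwise estimates of the kernel and geometry of E(S^1) *)

Section KernelEstimates.
Variable R : realType.

Lemma norm_le_mul (x y a b : R) : `|x| <= a -> `|y| <= b -> `|x * y| <= a * b.
Proof. by move=> xa yb; rewrite normrM ler_pM. Qed.

Lemma norm_le_add (x y a b : R) : `|x| <= a -> `|y| <= b -> `|x + y| <= a + b.
Proof. by move=> xa yb; rewrite (le_trans (ler_normD _ _))// lerD. Qed.

Let two : `|2 : R| <= 2. Proof. by rewrite ger0_norm. Qed.

(* With X = x0 + h, the quotients 1/(1 - X^2) and 1/(1 - x0^2) agree up to second
   order after subtracting the linear term. *)
Lemma inv_perturbation (M x0 h A A0 eps : R) : 1 <= M -> `|x0| <= 1 -> `|x0 + h| <= 1 ->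
  `|h| <= eps -> `|A| <= M -> `|A0| <= M ->
  A * (1 - (x0 + h) ^+ 2) = 1 -> A0 * (1 - x0 ^+ 2) = 1 ->
  `|A - A0| <= 2 * M ^+ 2 * eps /\
  `|A - A0 - 2 * x0 * h * A0 ^+ 2| <= 5 * M ^+ 3 * eps ^+ 2.
Proof.
move=> M1 x01 X1 he AM A0M AE A0E.
have e0 : 0 <= eps by apply: le_trans he.
have dA : A - A0 = A * A0 * (h * (x0 + h + x0)).
  transitivity (A * (A0 * (1 - x0 ^+ 2)) - A0 * (A * (1 - (x0 + h) ^+ 2))).
    by rewrite AE A0E !mulr1.
  ring.
have AA0 := norm_le_mul AM A0M.
have d1 : `|A - A0| <= 2 * M ^+ 2 * eps.
  rewrite dA; have := norm_le_mul AA0 (norm_le_mul he (norm_le_add X1 x01)).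
  by move/le_trans; apply; clear; lra.
split => //.
have -> : A - A0 - 2 * x0 * h * A0 ^+ 2 =
    2 * x0 * h * (A0 * (A - A0)) + A * A0 * (h * h).
  by rewrite {1}dA; ring.
have x2 : `|2 * x0 * h| <= 2 * eps.
  by have := norm_le_mul (norm_le_mul two x01) he; rewrite mulr1.
have := norm_le_add (norm_le_mul x2 (norm_le_mul A0M d1)) (norm_le_mul AA0 (norm_le_mul he he)).
move/le_trans; apply.
have MM : M ^+ 2 <= M ^+ 3 by exact: ler_weXn2l.
have := ler_wpM2r (sqr_ge0 eps) MM; clear; lra.
Qed.

(* The hypothesis [nE] is the expansion of the Gram determinant, divided by the square of
   s = sin (b - a): the quadratic remainder q is divided by s^2 and must be
   traded against 0 <= n <= 1 when s < eps. *)
Lemma gram_quotient_estimates (D2 k l q n s eps : R) :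
  0 <= D2 <= 1 -> `|k| <= 1 -> `|l| <= 2 * eps -> `|q| <= 4 * eps ^+ 2 ->
  0 < s -> 0 < eps -> 0 <= n <= 1 ->
  n * s ^+ 2 = D2 * s ^+ 2 - 2 * k * s * l - q ->
  [/\ `|s * (n - D2) + 2 * k * l| <= 10 * eps * (eps / (eps + s)),
      `|n - D2| <= 16 * (eps / (eps + s)) & `|s * (n - D2)| <= 14 * eps].
Proof.
move=> /andP[D0 D1] k1 l2 q4 s0 e0 /andP[n0 n1] nE.
set w := eps / (eps + s).
have es0 : 0 < eps + s by exact: addr_gt0.
have w0 : 0 < w by rewrite divr_gt0.
have w1 : w <= 1 by rewrite ler_pdivrMr// mul1r lerDl ltW.
have wE : w * (eps + s) = eps by rewrite /w divfK// gt_eqF.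
clearbody w.
have kl : `|2 * k * l| <= 4 * eps.
  have := norm_le_mul (norm_le_mul two k1) l2; clear; lra.
have nD : `|n - D2| <= 1 by rewrite ler_norml; clear - n0 n1 D0 D1; lra.
suff [r1 nDw] : `|s * (n - D2) + 2 * k * l| <= 10 * eps * w /\ `|n - D2| <= 16 * w.
  split => //.
  have -> : s * (n - D2) = (s * (n - D2) + 2 * k * l) + - (2 * k * l) by ring.
  have kl' : `|- (2 * k * l)| <= 4 * eps by rewrite normrN.
  by rewrite (le_trans (norm_le_add r1 kl'))//; clear - e0 w1; nra.
have [se|es] := lerP s eps.
  have w2 : 1 <= 2 * w by clear - wE es0 se w0; nra.
  split; last by apply: (le_trans nD); clear - w2; lra.
  have ss : `|s| <= eps by rewrite gtr0_norm.
  have := norm_le_add (norm_le_mul ss nD) kl; move/le_trans; apply.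
  by clear - w2 e0; nra.
have snE : s * (n - D2) * s = - (2 * k * l) * s - q.
  transitivity (n * s ^+ 2 - D2 * s ^+ 2); first by ring.
  by rewrite nE; ring.
have sV0 : 0 <= s^-1 by rewrite invr_ge0 ltW.
have es1 : eps / s <= 1 by rewrite ler_pdivrMr// mul1r ltW.
have es00 : 0 < eps / s by rewrite divr_gt0.
have w2 : eps / s <= 2 * w by rewrite ler_pdivrMr//; clear - wE es w0; nra.
have qs4 : `|q / s| <= 4 * eps * (eps / s).
  rewrite normrM normfV (gtr0_norm s0) mulrA -[4 * eps * eps]mulrA -expr2.
  exact: ler_wpM2r.
have qs : s * (n - D2) + 2 * k * l = - (q / s).
  apply: (@mulIf _ s); first by rewrite gt_eqF.
  by rewrite mulrDl snE [RHS]mulNr divfK ?gt_eqF//; ring.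
split.
  by rewrite qs normrN (le_trans qs4)//; clear - e0 w2 es00 w0; nra.
have nDE : n - D2 = - (2 * k * l) / s - q / s / s.
  apply: (@mulIf _ s); first by rewrite gt_eqF.
  by rewrite -mulrBl divfK ?gt_eqF//; move: qs; rewrite [s * _]mulrC; clear; lra.
have i1 : `|- (2 * k * l) / s| <= 4 * (eps / s).
  rewrite normrM normrN normfV (gtr0_norm s0) mulrA.
  exact: ler_wpM2r.
have i2 : `|- (q / s / s)| <= 4 * (eps / s) * (eps / s).
  rewrite normrN normrM normfV (gtr0_norm s0).
  have -> : 4 * (eps / s) * (eps / s) = 4 * eps * (eps / s) / s by ring.
  exact: ler_wpM2r.
rewrite nDE (le_trans (norm_le_add i1 i2))//; clear - es1 es00 w2; nra.
Qed.

(** The kernel estimates in free real variables, so that the arithmetic tactics meet no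
    trigonometric functions. Here k = cos d, D = sin d, s = sin(b - a); A, B stand for 1 / sin^2 of
    f at a and b, A0, B0 for their values at the hemisphere point; h, g are the perturbations of the
    cosines and n is the Gram determinant divided by s^2. *)
Lemma kernel_estimates (M k D ca sa cb sb h g eps s n A B A0 B0 : R) :
  1 <= M -> `|k| <= 1 -> `|ca| <= 1 -> `|cb| <= 1 -> `|sa| <= 1 -> `|sb| <= 1 ->
  `|ca * cb + sa * sb| <= 1 -> D ^+ 2 <= 1 ->
  0 < s <= 1 -> 0 < eps <= 2 -> `|h| <= eps -> `|g| <= eps ->
  `|k * ca + h| <= 1 -> `|k * cb + g| <= 1 ->
  `|A| <= M -> `|A0| <= M -> `|B| <= M -> `|B0| <= M ->
  A * (1 - (k * ca + h) ^+ 2) = 1 -> A0 * (1 - (k * ca) ^+ 2) = 1 ->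
  B * (1 - (k * cb + g) ^+ 2) = 1 -> B0 * (1 - (k * cb) ^+ 2) = 1 ->
  0 <= n <= 1 ->
  n * s ^+ 2 = D ^+ 2 * s ^+ 2 - 2 * k * s * (h * sb - g * sa)
     - (h ^+ 2 + g ^+ 2 - 2 * (ca * cb + sa * sb) * h * g) ->
  `|n * A * B - D ^+ 2 * A0 * B0| <= 220 * M ^+ 4 * (eps / (eps + s)) /\
  `|s * (n * A * B - D ^+ 2 * A0 * B0) -
    (- 2 * k * (h * sb - g * sa) * (A0 * B0) +
     s * D ^+ 2 * (2 * (k * ca) * h * A0 ^+ 2 * B0 + 2 * (k * cb) * g * A0 * B0 ^+ 2))|
   <= 220 * M ^+ 4 * eps * (eps / (eps + s)).
Proof.
move=> M1 k1 ca1 cb1 sa1 sb1 c1 D1 /andP[s0 s1] /andP[e0 e2] he ge X1 Y1.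
move=> AM A0M BM B0M AE A0E BE B0E n01 nE.
have X01 : `|k * ca| <= 1 by have := norm_le_mul k1 ca1; rewrite mulr1.
have Y01 : `|k * cb| <= 1 by have := norm_le_mul k1 cb1; rewrite mulr1.
have [dA1 dA2] := inv_perturbation M1 X01 X1 he AM A0M AE A0E.
have [dB1 dB2] := inv_perturbation M1 Y01 Y1 ge BM B0M BE B0E.
have l2 : `|h * sb - g * sa| <= 2 * eps.
  have := norm_le_mul ge sa1; rewrite -normrN => H.
  by have := norm_le_add (norm_le_mul he sb1) H; clear; lra.
have q4 : `|h ^+ 2 + g ^+ 2 - 2 * (ca * cb + sa * sb) * h * g| <= 4 * eps ^+ 2.
  have h2 := norm_le_mul he he; have g2 := norm_le_mul ge ge.
  have := norm_le_mul (norm_le_mul (norm_le_mul two c1) he) ge; rewrite -normrN => H.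
  have := norm_le_add (norm_le_add h2 g2) H; rewrite -!expr2.
  by move/le_trans; apply; clear; lra.
have D01 : 0 <= D ^+ 2 <= 1 by rewrite sqr_ge0.
have [r1 nDw snD] := gram_quotient_estimates D01 k1 l2 q4 s0 e0 n01 nE.
have n1' : `|n| <= 1 by case/andP: n01 => n0 n1; rewrite ger0_norm.
set w := eps / (eps + s) in r1 nDw *.
set l := h * sb - g * sa in r1 *.
have w0 : 0 < w by rewrite divr_gt0// addr_gt0.
(* Since [eps + s <= 3]. *)
have ew : eps <= 3 * w.
  by rewrite mulrA ler_pdivlMr ?addr_gt0//; clear - e0 e2 s0 s1; nra.
clearbody w l; clear nE q4 l2 AE A0E BE B0E X1 Y1 X01 Y01 n01.
have dAB : A * B - A0 * B0 = (A - A0) * B + A0 * (B - B0) by ring.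
have dAB1 : `|A * B - A0 * B0| <= 4 * M ^+ 3 * eps.
  rewrite dAB; have := norm_le_add (norm_le_mul dA1 BM) (norm_le_mul A0M dB1).
  by move/le_trans; apply; clear; lra.
have M23 : M ^+ 2 <= M ^+ 3 by apply: ler_weXn2l.
have M34 : M ^+ 3 <= M ^+ 4 by apply: ler_weXn2l.
have M20 : 0 <= M ^+ 2 by exact: sqr_ge0.
have M24 := le_trans M23 M34; have M30 := le_trans M20 M23.
have M40 := le_trans M30 M34.
split.
  have -> : n * A * B - D ^+ 2 * A0 * B0 = (n - D ^+ 2) * (A0 * B0) + n * (A * B - A0 * B0) by ring.
  have := norm_le_add (norm_le_mul nDw (norm_le_mul A0M B0M)) (norm_le_mul n1' dAB1).
  move/le_trans; apply; rewrite mul1r -expr2.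
  have H1 := ler_wpM2l M30 ew.
  have H2 := ler_wpM2r (ltW w0) M24.
  have H3 := ler_wpM2r (ltW w0) M34.
  have H4 := mulr_ge0 M40 (ltW w0).
  clear - H1 H2 H3 H4; lra.
set A1 := 2 * (k * ca) * h * A0 ^+ 2 in dA2 *.
set B1 := 2 * (k * cb) * g * B0 ^+ 2 in dB2 *.
have -> : s * (n * A * B - D ^+ 2 * A0 * B0) - (- 2 * k * l * (A0 * B0) +
     s * D ^+ 2 * (A1 * B0 + 2 * (k * cb) * g * A0 * B0 ^+ 2)) =
   (s * (n - D ^+ 2) + 2 * k * l) * (A0 * B0) + s * (n - D ^+ 2) * (A * B - A0 * B0)
   + s * D ^+ 2 * ((A - A0 - A1) * B0 + A0 * (B - B0 - B1) + (A - A0) * (B - B0)).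
  by rewrite /B1; ring.
have sD1 : `|s * D ^+ 2| <= 1.
  rewrite -(mulr1 1); apply: norm_le_mul; first by rewrite gtr0_norm.
  by rewrite ger0_norm// sqr_ge0.
have t1 := norm_le_mul r1 (norm_le_mul A0M B0M).
have t2 := norm_le_mul snD dAB1.
have t3 := norm_le_mul sD1 (norm_le_add (norm_le_add (norm_le_mul dA2 B0M) (norm_le_mul A0M dB2))
   (norm_le_mul dA1 dB1)).
have := norm_le_add (norm_le_add t1 t2) t3; move/le_trans; apply.
(* Bounding [eps ^+ 2] by three times [eps * w] makes the coefficients add up to 10 + 3 * 56 + 3 *
   14 = 220. *)
have -> : 10 * eps * w * (M * M) + 14 * eps * (4 * M ^+ 3 * eps) +
  1 * (5 * M ^+ 3 * eps ^+ 2 * M + M * (5 * M ^+ 3 * eps ^+ 2) +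
      2 * M ^+ 2 * eps * (2 * M ^+ 2 * eps)) =
  10 * (M ^+ 2 * (eps * w)) + 56 * (M ^+ 3 * eps ^+ 2) + 14 * (M ^+ 4 * eps ^+ 2) by ring.
have -> : 220 * M ^+ 4 * eps * w = 220 * (M ^+ 4 * (eps * w)) by ring.
have ew0 : 0 <= eps * w by rewrite mulr_ge0// ltW.
have e2w : eps ^+ 2 <= 3 * (eps * w) by clear - ew e0; nra.
have H1 := ler_wpM2r ew0 M24.
have H2 := ler_wpM2r (sqr_ge0 eps) M34.
have H3 := ler_wpM2l M40 e2w.
have H4 := mulr_ge0 M40 ew0.
clear - H1 H2 H3 H4; lra.
Qed.

End KernelEstimates.

(** * Functions in E(S^1): spherical triangle inequalities and distances *)

Section CircleGeometry.
Variable R : realType.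
Implicit Types (f h : R -> R) (a b t u v x y r tau d : R).

Lemma le_cos x y : 0 <= x -> x <= y -> y <= pi -> cos y <= cos x.
Proof.
move=> x0; rewrite le_eqVlt => /predU1P[->//|xy] ypi; apply: ltW.
by rewrite ltr_cos// in_itv/= ?x0 ?ypi ?andbT//=;
  [exact: le_trans (ltW xy) ypi|exact: le_trans (ltW xy)].
Qed.

Lemma cos_lipschitz x y : `|cos x - cos y| <= `|x - y|.
Proof.
wlog xy : x y / y <= x => [hw|].
  have [/hw//|/ltW/hw] := leP y x.
  by rewrite distrC [X in _ <= X]distrC.
have [|c _ ->] := @MVT_segment R cos (fun z => - sin z) y x xy.
- by apply: continuous_subspaceT; exact: continuous_cos.
- by rewrite normrM normrN ler_piMl// sin_max.
Qed.

(** With u = t / 2, the mean value theorem gives sin u >= u cos u, hence sin t = 2 sin u cos u >= 2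
    u cos^2 u = u (1 + cos t) >= u. *)
Lemma half_le_sin t : 0 <= t -> t <= pi / 2 -> t / 2 <= sin t.
Proof.
move=> t0 tpi; pose u := t / 2.
have pi0 := @pi_gt0 R.
have u0 : 0 <= u by rewrite /u; lra.
have upi : u <= pi by rewrite /u; lra.
have tu : t = u + u by rewrite /u; lra.
have [|c] := @MVT_segment R sin cos 0 u u0.
- by apply: continuous_subspaceT; exact: continuous_sin.
rewrite in_itv/= => /andP[c0 cu]; rewrite sin0 !subr0 => su.
have cc : cos u <= cos c by exact: le_cos.
have cu0 : 0 <= cos u by apply: cos_ge0_pihalf; apply/andP; split; lra.
have ct0 : 0 <= cos t by apply: cos_ge0_pihalf; apply/andP; split; lra.
have su0 : u * cos u <= sin u by rewrite su [_ * u]mulrC ler_wpM2l.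
have st : sin t = 2 * (sin u * cos u) by rewrite tu sinD; ring.
have ct : cos t = 2 * cos u ^+ 2 - 1 by rewrite tu cosD -!expr2 sin2cos2; ring.
have h1 : u * cos u * cos u <= sin u * cos u by apply: ler_wpM2r.
have h2 : 2 * (u * cos u * cos u) = u * cos t + u by rewrite ct; ring.
have h3 : 0 <= u * cos t by apply: mulr_ge0.
by rewrite st -/u; lra.
Qed.

(** The representative y does not depend on h, so that the cosine and a function of E(S^1) can be
    reduced simultaneously. *)
Lemma reduce_mod_2pi x : exists y, - pi <= y <= pi /\
  forall h, (forall z, h (z + 2 * pi) = h z) -> h x = h y.
Proof.
have pi0 := @pi_gt0 R.
pose n := Num.floor ((x + pi) / (2 * pi)).
exists (x - n%:~R * (2 * pi)); split.
  have := floor_itv ((x + pi) / (2 * pi)); rewrite -/n => /andP[].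
  rewrite ler_pdivlMr ?ltr_pdivrMr ?mulr_gt0// intrD => n1 n2.
  by apply/andP; split; lra.
move=> h hp.
have hn (m : nat) z : h (z + m%:R * (2 * pi)) = h z.
  elim: m z => [|m ih] z; first by rewrite mul0r addr0.
  by rewrite -natr1 mulrDl mul1r addrA hp ih.
case: n => m.
  by rewrite -[in LHS](subrK (m%:R * (2 * pi)) x) hn.
by rewrite NegzE mulrNz mulNr opprK hn.
Qed.

Lemma ES1_shift f : ES1 f -> forall x, f (x - pi) = pi - f x.
Proof. by move=> [_ fp] x; have := fp (x - pi); rewrite subrK; lra. Qed.

Lemma ES1_periodic f : ES1 f -> forall x, f (x + 2 * pi) = f x.
Proof.
move=> ff x; have := ES1_shift ff (x + 2 * pi); case: ff => _ fp; have := fp x.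
have -> : x + 2 * pi - pi = x + pi by ring.
by lra.
Qed.

Lemma ES1_range f : ES1 f -> forall x, 0 <= f x <= pi.
Proof.
move=> [fl fp] x; have := fl (x + pi) x; have := fp x.
rewrite addrAC subrr add0r (ger0_norm (pi_ge0 R)) ler_norml => e /andP[e1 e2].
by apply/andP; split; lra.
Qed.

Lemma ES1_continuous f : ES1 f -> continuous f.
Proof.
move=> [fl _] x; apply/cvgrPdist_lt => e e0; near=> y.
by rewrite (le_lt_trans (fl _ _)).
Unshelve. all: by end_near. Qed.

(* The spherical triangle with sides b - a, f a, f b exists: its Gram determinant is
   nonnegative. *)
Lemma ES1_gram f a b : ES1 f -> 0 < b - a < pi ->
  (cos (f b) - cos (b - a) * cos (f a)) ^+ 2 <= (sin (b - a) * sin (f a)) ^+ 2.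
Proof.
move=> ff /andP[t0 tpi].
have /andP[u0 upi] := ES1_range ff a; have /andP[v0 vpi] := ES1_range ff b.
(* Comparing a with the antipode of b gives t <= u + v <= 2 pi - t, the two triangle inequalities
   that the comparison of a with b does not contain. *)
have := ff.1 a (b - pi); rewrite (ES1_shift ff).
have -> : a - (b - pi) = pi - (b - a) by ring.
have pit : 0 <= pi - (b - a) by rewrite subr_ge0 ltW.
rewrite (ger0_norm pit) ler_norml => /andP[h1 h2].
have := ff.1 a b; rewrite distrC [X in _ <= X]distrC (ger0_norm (ltW t0)) ler_norml => /andP[h3 h4].
set t := b - a in t0 tpi h1 h2 h3 h4 *.
set u := f a in u0 upi h1 h2 h3 h4 *; set v := f b in v0 vpi h1 h2 h3 h4 *.
have c1 : cos v <= cos u * cos t + sin u * sin t.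
  rewrite -cosB -(cos_norm (u - t)); apply: le_cos => //.
  by rewrite ler_norml; apply/andP; split; lra.
have c2 : cos u * cos t - sin u * sin t <= cos v.
  rewrite -cosD; have [ut|ut] := leP (u + t) pi.
    by apply: le_cos => //; lra.
  have -> : cos (u + t) = cos (2 * pi - (u + t)).
    by rewrite mulr_natl cosB cos2pi sin2pi; ring.
  by apply: le_cos; lra.
have s0 : 0 <= sin t * sin u.
  by apply: mulr_ge0; apply: sin_ge0_pi; apply/andP; split; lra.
rewrite -[X in X <= _]real_normK ?num_real// ler_pXn2r ?nnegrE//.
by rewrite ler_norml; apply/andP; split; lra.
Qed.

Lemma supnorm_ge (h : R -> R) (M : R) : (forall x, `|h x| <= M) -> forall x, `|h x| <= supnorm h.
Proof.
move=> hM x; apply: ub_le_sup; last by exists x.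
by exists M => _ [y _ <-].
Qed.

Lemma supnorm_le (h : R -> R) (M : R) : (forall x, `|h x| <= M) -> supnorm h <= M.
Proof.
move=> hM; apply: ge_sup; first by exists `|h 0|; exists 0.
by move=> _ [y _ <-].
Qed.

Lemma supnorm_ge0 (h : R -> R) : 0 <= supnorm h.
Proof.
have [H|H] := pselect (has_sup [set `|h a| | a in [set: R]]); last by rewrite /supnorm sup_out.
by apply: le_trans (ub_le_sup H.2 _); last by exists 0.
Qed.

Lemma dist_sup_le f (S : set (R -> R)) g : S g -> dist_sup f S <= supnorm (fun a => f a - g a).
Proof.
move=> Sg; apply: ge_inf; last by exists g.
by exists 0 => _ [h _ <-]; exact: supnorm_ge0.
Qed.

Lemma dist_sup_lt f (S : set (R -> R)) e : S !=set0 -> dist_sup f S < e ->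
  exists2 g, S g & supnorm (fun a => f a - g a) < e.
Proof.
move=> [g0 Sg0] /inf_lt[|_ [g Sg <-] ge]; last by exists g.
by exists (supnorm (fun a => f a - g0 a)), g0.
Qed.

Lemma dist_sup_ge0 f (S : set (R -> R)) : S !=set0 -> 0 <= dist_sup f S.
Proof.
move=> [g Sg]; apply: lb_le_inf; first by exists (supnorm (fun a => f a - g a)), g.
by move=> _ [h _ <-]; exact: supnorm_ge0.
Qed.

(** [acos (cos t)] is the distance from t to the multiples of 2 pi, and f is 1-Lipschitz and
    periodic. *)
Lemma acos_cos_le f x y : ES1 f -> f y <= f x + acos (cos (y - x)).
Proof.
move=> ff; have [z [/andP[z1 z2] zE]] := reduce_mod_2pi (y - x).
have -> : acos (cos (y - x)) = `|z|.
  have -> : cos (y - x) = cos z by apply: zE => w; rewrite mulr_natl cosD2pi.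
  rewrite -(cos_norm z) cosK// in_itv/= normr_ge0/= ler_norml z1//.
have -> : f y = f (z + x).
  rewrite -[in LHS](subrK x y); apply: (zE (fun w => f (w + x))) => w.
  by rewrite addrAC (ES1_periodic ff).
have := ff.1 (z + x) x; rewrite addrK ler_norml => /andP[_]; lra.
Qed.

(* Compare f with the distance function of the boundary point x itself. *)
Lemma dist_S1_le f : ES1 f -> forall x, dist_sup f (@S1 R) <= f x <= pi - dist_sup f (@S1 R).
Proof.
move=> ff.
have le x : dist_sup f (@S1 R) <= f x.
  have S1g : @S1 R (fun a => acos (cos (a - x))) by exists x.
  apply: (le_trans (dist_sup_le f S1g)); apply: supnorm_le => y.
  (* The same inequality at the antipode y + pi is the lower bound for f y. *)
  have h1 := acos_cos_le x y ff; have := acos_cos_le x (y + pi) ff.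
  have -> : y + pi - x = y - x + pi by ring.
  have c1 : -1 <= cos (y - x) <= 1 by rewrite cos_geN1 cos_le1.
  rewrite cosDpi acosN//; have := ff.2 y.
  by rewrite ler_norml => h2 h3; apply/andP; split; lra.
move=> x; rewrite le/=; have := le (x - pi); rewrite (ES1_shift ff); lra.
Qed.

End CircleGeometry.

(** * The distance functions of the points of the hemisphere *)

Section Hemisphere.
Variable R : realType.
Variables (tau d : R).
Hypothesis d0 : 0 < sin d.
Let k := cos d.
Let D := sin d.
Implicit Types (a b x : R).

(* Let x be the hemisphere point with cos (dist (x, a)) = cos d * cos (a - tau).  The
   direction of the circle point a as seen from x is (cos_th a, sin_th a), theta a is
   its angle, rho the derivative of theta, and sinsq_dist a = sin^2 (dist (x, a)).
   The correction by atan makes theta smooth on the whole line. *)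
Definition sinsq_dist a := 1 - cos d ^+ 2 * cos (a - tau) ^+ 2.
Definition isin_dist a := (Num.sqrt (sinsq_dist a))^-1.
Definition rho a := sin d * isin_dist a ^+ 2.
Definition cos_th a := sin d * cos (a - tau) * isin_dist a.
Definition sin_th a := sin (a - tau) * isin_dist a.
Definition theta a := a - tau + atan ((1 - sin d) * (sin (a - tau) * cos (a - tau)) /
   (sin d * cos (a - tau) ^+ 2 + sin (a - tau) ^+ 2)).

Local Notation m := sinsq_dist.
Local Notation y := isin_dist.

Let kD : k ^+ 2 = 1 - D ^+ 2. Proof. by rewrite /k /D cos2sin2. Qed.

Lemma sinsq_dist_ge a : sin d ^+ 2 <= m a.
Proof.
rewrite /m -/k -/D kD; have := cos2Dsin2 (a - tau).
have := sqr_ge0 (sin (a - tau)); have := sqr_ge0 (cos (a - tau)); have := sqr_ge0 D.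
have : D ^+ 2 <= 1 by have := sqr_ge0 k; rewrite kD; lra.
by nra.
Qed.

Lemma sinsq_dist_gt0 a : 0 < m a.
Proof. by rewrite (lt_le_trans _ (sinsq_dist_ge a))// exprn_gt0. Qed.

Lemma isin_dist_gt0 a : 0 < y a.
Proof. by rewrite invr_gt0 sqrtr_gt0 sinsq_dist_gt0. Qed.

Lemma isin_distE a : y a ^+ 2 * m a = 1.
Proof.
by rewrite /y exprVn (sqr_sqrtr (ltW (sinsq_dist_gt0 a))) mulVf// gt_eqF// sinsq_dist_gt0.
Qed.

Lemma isin_dist_sqr_le a : y a ^+ 2 <= (sin d ^+ 2)^-1.
Proof.
rewrite exprVn (sqr_sqrtr (ltW (sinsq_dist_gt0 a))) lef_pV2 ?posrE ?sinsq_dist_gt0 ?exprn_gt0//.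
exact: sinsq_dist_ge.
Qed.

Let dcos a : has_deriv a (fun z => cos (z - tau)) (- sin (a - tau)).
Proof. by apply: deriv_fun_shift; exact: is_derive_cos. Qed.

Let dsin a : has_deriv a (fun z => sin (z - tau)) (cos (a - tau)).
Proof. by apply: deriv_fun_shift; exact: is_derive_sin. Qed.

Let dm a : has_deriv a m (2 * k ^+ 2 * cos (a - tau) * sin (a - tau)).
Proof.
have -> : m = fun z => 1 + - k ^+ 2 * (cos (z - tau) * cos (z - tau)).
  by apply/funext => z; rewrite /m -/k; ring.
apply: deriv_ext.
  by apply: deriv_funDl; apply: deriv_funZ; apply: deriv_funM; exact: dcos.
rewrite /=; ring.
Qed.

Let dy a : has_deriv a y (- k ^+ 2 * cos (a - tau) * sin (a - tau) * y a ^+ 3).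
Proof.
have m0 := sinsq_dist_gt0 a.
have s0 : Num.sqrt (m a) != 0 by rewrite gt_eqF// sqrtr_gt0.
apply: deriv_ext.
  apply: is_deriveV => //.
  by apply: (deriv_fun_comp (F := Num.sqrt)); [exact: is_derive1_sqrt|exact: dm].
rewrite /y; change (- Num.sqrt (m a) ^- 2 * ((2 * Num.sqrt (m a))^-1 * (2 * k ^+ 2 * cos (a - tau) * sin (a - tau))) = - k ^+ 2 * cos (a - tau) * sin (a - tau) * (Num.sqrt (m a))^-1 ^+ 3).
by field.
Qed.

Lemma continuous_isin_dist : continuous y.
Proof. exact: has_deriv_continuous dy. Qed.

Lemma cos_sin_th a : cos_th a ^+ 2 + sin_th a ^+ 2 = 1.
Proof.
rewrite -(isin_distE a) /cos_th /sin_th /m -/k -/D kD !exprMn (sin2cos2 (a - tau)).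
by ring.
Qed.

Lemma deriv_cos_th a : has_deriv a cos_th (- (rho a * sin_th a)).
Proof.
apply: deriv_ext.
  apply: deriv_funM; last exact: dy.
  by apply: deriv_funZ; exact: dcos.
rewrite /rho /sin_th -/D /=.
transitivity (- (D * sin (a - tau) * (y a * (y a ^+ 2 * m a) + y a ^+ 3 * k ^+ 2 * cos (a - tau) ^+ 2))).
  by rewrite isin_distE; ring.
by rewrite /m -/k; ring.
Qed.

Lemma deriv_sin_th a : has_deriv a sin_th (rho a * cos_th a).
Proof.
apply: deriv_ext.
  by apply: deriv_funM; [exact: dsin|exact: dy].
rewrite /rho /cos_th -/D.
transitivity (cos (a - tau) * (y a * (y a ^+ 2 * m a) - y a ^+ 3 * k ^+ 2 * sin (a - tau) ^+ 2)).
  by rewrite isin_distE; ring.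
by rewrite /m -/k (sin2cos2 (a - tau)) kD; ring.
Qed.

(** With phi = a - tau one has tan theta = tan phi / sin d, and the argument N / W of [atan] is tan
    (theta - phi) by the addition formula. The derivative simplifies because W^2 + N^2 equals
    [sinsq_dist]. *)
Lemma deriv_theta a : has_deriv a theta (rho a).
Proof.
pose c := cos (a - tau); pose s := sin (a - tau).
have cs : s ^+ 2 = 1 - c ^+ 2 by exact: sin2cos2.
have m0 := sinsq_dist_gt0 a.
pose W x := sin d * (cos (x - tau) * cos (x - tau)) + sin (x - tau) * sin (x - tau).
have W0 : W a != 0.
  rewrite gt_eqF// /W -!expr2 sin2cos2 -/c -/D.
  have c21 : c ^+ 2 <= 1 by have := sqr_ge0 s; rewrite cs; lra.
  have D1 : D <= 1 by exact: sin_le1.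
  have := sqr_ge0 c; have := d0; rewrite -/D; nra.
have dW : has_deriv a W (2 * (1 - D) * (s * c)).
  apply: deriv_ext.
    apply: deriv_funD; first by apply: deriv_funZ; apply: deriv_funM; exact: dcos.
    by apply: deriv_funM; exact: dsin.
  by rewrite /= -/c -/s -/D; ring.
have dV : has_deriv a (fun x => (W x)^-1) (- (W a) ^- 2 * (2 * (1 - D) * (s * c))).
  exact: is_deriveV.
have dN : has_deriv a (fun x => (1 - D) * (sin (x - tau) * cos (x - tau))) ((1 - D) * (c ^+ 2 - s ^+ 2)).
  apply: deriv_ext.
    by apply: deriv_funZ; apply: deriv_funM; [exact: dsin|exact: dcos].
  by rewrite /= -/c -/s; ring.
have -> : theta = fun x => x - tau + atan ((1 - D) * (sin (x - tau) * cos (x - tau)) * (W x)^-1).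
  by apply/funext => x; rewrite /theta /W -!expr2.
apply: deriv_ext.
  apply: deriv_funD; first exact: deriv_fun_subr.
  apply: (deriv_fun_comp (F := atan)); first exact: is_derive1_atan.
  by apply: deriv_funM; [exact: dN|exact: dV].
rewrite /rho /y exprVn (sqr_sqrtr (ltW m0)) -/c -/s -/D.
have WE : W a = D * c ^+ 2 + (1 - c ^+ 2) by rewrite -cs /W -!expr2.
set N := (1 - D) * (s * c).
have N2 : N ^+ 2 = (1 - D) ^+ 2 * ((1 - c ^+ 2) * c ^+ 2) by rewrite /N -cs; ring.
have mE : m a = W a ^+ 2 + N ^+ 2 by rewrite N2 WE /m -/k -/c kD; ring.
(* Since W' = 2 N, the left side is the numerator of 1 + (N / W)' / (1 + (N / W)^2). *)
have key : W a ^+ 2 + N ^+ 2 - N * (2 * N) + (1 - D) * (c ^+ 2 - s ^+ 2) * W a = D.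
  by rewrite cs -[N * (2 * N)]mulrCA -expr2 N2 WE; ring.
have -> : 2 * (1 - D) * (s * c) = 2 * N by rewrite /N; ring.
rewrite mE -[X in _ = X / _]key.
have mn0 : W a ^+ 2 + N ^+ 2 != 0 by rewrite -mE gt_eqF.
field; rewrite ?W0 ?mn0//.
Qed.

Lemma continuous_cos_th : continuous cos_th.
Proof. exact: has_deriv_continuous deriv_cos_th. Qed.

Lemma continuous_sin_th : continuous sin_th.
Proof. exact: has_deriv_continuous deriv_sin_th. Qed.

Lemma continuous_rho : continuous rho.
Proof.
apply: (@has_deriv_continuous _ _ (fun a => sin d * (y a * (- k ^+ 2 * cos (a - tau) * sin (a - tau) * y a ^+ 3) *+ 2))) => a.
have -> : rho = fun z => sin d * (y z * y z) by apply/funext => z; rewrite /rho expr2.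
apply: deriv_ext; first by apply: deriv_funZ; apply: deriv_funM; exact: dy.
by rewrite /=; ring.
Qed.

Lemma rho_gt0 a : 0 < rho a.
Proof. by rewrite mulr_gt0// exprn_gt0// isin_dist_gt0. Qed.

Lemma rho_ge a : sin d <= rho a.
Proof.
rewrite /rho -[X in X <= _]mulr1; apply: ler_wpM2l; first exact: ltW.
rewrite -(isin_distE a); apply: ler_piMr; first exact: sqr_ge0.
by rewrite /m lerBlDr lerDl mulr_ge0// sqr_ge0.
Qed.

Let shift_cos : cos (pi - tau) = - cos (0 - tau).
Proof. by rewrite add0r addrC cosDpi. Qed.

Let shift_sin : sin (pi - tau) = - sin (0 - tau).
Proof. by rewrite add0r addrC sinDpi. Qed.

Let isin_dist_pi : y pi = y 0.
Proof. by rewrite /y /m shift_cos sqrrN. Qed.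

Lemma cos_th_pi : cos_th pi = - cos_th 0.
Proof. by rewrite /cos_th shift_cos isin_dist_pi mulrN mulNr. Qed.

Lemma sin_th_pi : sin_th pi = - sin_th 0.
Proof. by rewrite /sin_th shift_sin isin_dist_pi mulNr. Qed.

Lemma theta_pi : theta pi = theta 0 + pi.
Proof.
rewrite /theta shift_sin shift_cos !sqrrN mulrNN.
set t := atan _; ring.
Qed.

(** The left side is sin (theta b - theta a). Its factor sin (b - a) compensates one power of the
    singularity of the kernel when the form is evaluated on the first Fourier mode. *)
Lemma angle_sineE a b : cos_th a * sin_th b - sin_th a * cos_th b =
  sin d * sin (b - a) * (y a * y b).
Proof.
have -> : b - a = (b - tau) - (a - tau) by ring.
by rewrite [sin (b - tau - _)]sinB /cos_th /sin_th; ring.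
Qed.

End Hemisphere.

Ltac bmeas := repeat (first [ assumption
  | apply: bmeas2_fst; assumption | apply: bmeas2_snd; assumption
  | exact: bmeas1_cst | apply: bmeas1D | apply: bmeas1N | apply: bmeas1M
  | apply: bmeas1X
  | exact: bmeas2_cst | apply: bmeas2D | apply: bmeas2N | apply: bmeas2M
  | apply: bmeas2X | apply: bmeas2_fst | apply: bmeas2_snd ]).

(** * The area form at a point of the hemisphere *)

Section SpectralGap.
Variable R : realType.
Notation mu := (@lebesgue_measure R).
Variables rho c s th : R -> R.
Hypothesis rho_cont : continuous rho.
Hypothesis rho_ge0 : forall x, 0 <= rho x.
Hypothesis dc : forall x, has_deriv x c (- (rho x * s x)).
Hypothesis ds : forall x, has_deriv x s (rho x * c x).
Hypothesis dth : forall x, has_deriv x th (rho x).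
Hypothesis cs1 : forall x, c x ^+ 2 + s x ^+ 2 = 1.
Hypothesis c_pi : c pi = - c 0.
Hypothesis s_pi : s pi = - s 0.
Hypothesis th_pi : th pi = th 0 + pi.
Implicit Types (u v w x y : R -> R) (a b t : R).

Let c_cont : continuous c. Proof. exact: has_deriv_continuous dc. Qed.
Let s_cont : continuous s. Proof. exact: has_deriv_continuous ds. Qed.
Let brho : bmeas1 rho. Proof. exact: continuous_bmeas1. Qed.
Let bc : bmeas1 c. Proof. exact: continuous_bmeas1. Qed.
Let bth : bmeas1 th. Proof. exact/continuous_bmeas1/(has_deriv_continuous dth). Qed.
Let bs : bmeas1 s. Proof. exact: continuous_bmeas1. Qed.

Lemma integral_has_deriv (F f : R -> R) a b : a <= b -> continuous f ->
  (forall t, has_deriv t F (f t)) -> Rintegral mu `]a, b[ f = F b - F a.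
Proof. by move=> ab cf dF; apply: integral_derivative => // t _; exact: cf. Qed.

Lemma continuousMfun (f g : R -> R) : continuous f -> continuous g -> continuous (fun t => f t * g t).
Proof. by move=> cf cg t; apply: cvgM; [exact: cf|exact: cg]. Qed.

Lemma continuousDfun (f g : R -> R) : continuous f -> continuous g -> continuous (fun t => f t + g t).
Proof. by move=> cf cg t; apply: cvgD; [exact: cf|exact: cg]. Qed.

Lemma continuousZfun k (f : R -> R) : continuous f -> continuous (fun t => k * f t).
Proof. by move=> cf; apply: continuousMfun => //; exact: cst_continuous. Qed.

Lemma int_rho_cos a b : a <= b -> Rintegral mu `]a, b[ (fun t => rho t * c t) = s b - s a.
Proof. by move=> ab; apply: integral_has_deriv => //; exact: continuousMfun. Qed.

Lemma int_rho_sin a b : a <= b -> Rintegral mu `]a, b[ (fun t => rho t * s t) = c a - c b.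
Proof.
move=> ab; rewrite (integral_has_deriv (F := fun t => (- 1) * c t))//.
- by rewrite !mulN1r opprK addrC.
- exact: continuousMfun.
- by move=> t; apply: deriv_ext; [exact/deriv_funZ/dc|rewrite mulN1r opprK].
Qed.

Lemma int1_has_deriv (F f : R -> R) : continuous f ->
  (forall t, has_deriv t F (f t)) -> int1 f = F pi - F 0.
Proof. by move=> cf dF; apply: integral_has_deriv; rewrite ?pi_ge0. Qed.

Lemma int1_rho : int1 rho = pi.
Proof. by rewrite (int1_has_deriv rho_cont dth) th_pi addrAC subrr add0r. Qed.

Let s2 t : s t ^+ 2 = 1 - c t ^+ 2.
Proof. by rewrite -(cs1 t) [X in X - _]addrC addrK. Qed.

Lemma int1_cos2 : int1 (fun t => rho t * c t ^+ 2) = pi / 2.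
Proof.
rewrite (int1_has_deriv (F := fun t => 2^-1 * (th t + s t * c t))).
- by rewrite th_pi c_pi s_pi; ring.
- by apply: continuousMfun => //; apply: continuousMfun.
- move=> t; apply: deriv_ext.
    by apply: deriv_funZ; apply: deriv_funD; [exact: dth|apply: deriv_funM].
  transitivity (2^-1 * (rho t - rho t * s t ^+ 2 + rho t * c t ^+ 2)); first by ring.
  by rewrite s2; field.
Qed.

Lemma int1_sin2 : int1 (fun t => rho t * s t ^+ 2) = pi / 2.
Proof.
rewrite (int1_has_deriv (F := fun t => 2^-1 * (th t + (- 1) * (s t * c t)))).
- by rewrite th_pi c_pi s_pi; ring.
- by apply: continuousMfun => //; apply: continuousMfun.
- move=> t; apply: deriv_ext.
    by apply: deriv_funZ; apply: deriv_funD; [exact: dth|apply: deriv_funZ; apply: deriv_funM].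
  transitivity (2^-1 * (rho t + rho t * s t ^+ 2 - rho t * c t ^+ 2)); first by ring.
  by rewrite -[c t ^+ 2](addrK (s t ^+ 2)) cs1; field.
Qed.

Lemma int1_cos_sin : int1 (fun t => rho t * (c t * s t)) = 0.
Proof.
rewrite (int1_has_deriv (F := fun t => 2^-1 * (s t * s t))).
- by rewrite s_pi; ring.
- by apply: continuousMfun => //; apply: continuousMfun.
- move=> t; apply: deriv_ext.
    by apply: deriv_funZ; apply: deriv_funM.
  by field.
Qed.

Definition wedge u v (z : R * R) := u z.1 * v z.2 - u z.2 * v z.1.

Lemma bmeas2_wedge u v : bmeas1 u -> bmeas1 v -> bmeas2 (wedge u v).
Proof. by move=> bu bv; rewrite /wedge; bmeas. Qed.

(** This is pi times the form at a point of the hemisphere, where the kernel factors. *)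
Definition area_form u v := int2 (fun z => rho z.1 * rho z.2 * wedge u v z).

(** Since [s] is a primitive of [rho * c], integrating out the variable that carries [c] leaves (s t
    - s 0) - (s pi - s t) as the factor of [rho t * u t], and the boundary terms cancel by
    antiperiodicity. Thus the form preserves the first mode. *)
Lemma area_form_cos u : bmeas1 u -> area_form c u = 2 * int1 (fun t => rho t * (s t * u t)).
Proof.
move=> bu; rewrite /area_form.
rewrite (@eq_int2 _ _ (fun z => rho z.2 * u z.2 * (rho z.1 * c z.1) -
   rho z.1 * u z.1 * (rho z.2 * c z.2))); last by move=> z _; rewrite /wedge; ring.
rewrite int2B; [|bmeas|bmeas].
rewrite (@int2_sndM _ (fun t => rho t * u t) (fun z => rho z.1 * c z.1)); [|bmeas|bmeas].
rewrite (@int2_fstM _ (fun t => rho t * u t) (fun z => rho z.2 * c z.2)); [|bmeas|bmeas].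
rewrite (@eq_int1 _ _ (fun t => rho t * u t * (s t - s 0))); last first.
  by move=> t /andP[t0 tpi]; rewrite /= int_rho_cos// ltW.
rewrite [X in _ - X](@eq_int1 _ _ (fun t => rho t * u t * (s pi - s t))); last first.
  by move=> t /andP[t0 tpi]; rewrite /= int_rho_cos// ltW.
rewrite -int1B; [|bmeas|bmeas]; rewrite -int1Z; last by bmeas.
by apply: eq_int1 => t _; rewrite s_pi; ring.
Qed.

Lemma area_form_sin u : bmeas1 u -> area_form s u = - 2 * int1 (fun t => rho t * (c t * u t)).
Proof.
move=> bu; rewrite /area_form.
rewrite (@eq_int2 _ _ (fun z => rho z.2 * u z.2 * (rho z.1 * s z.1) -
   rho z.1 * u z.1 * (rho z.2 * s z.2))); last by move=> z _; rewrite /wedge; ring.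
rewrite int2B; [|bmeas|bmeas].
rewrite (@int2_sndM _ (fun t => rho t * u t) (fun z => rho z.1 * s z.1)); [|bmeas|bmeas].
rewrite (@int2_fstM _ (fun t => rho t * u t) (fun z => rho z.2 * s z.2)); [|bmeas|bmeas].
rewrite (@eq_int1 _ _ (fun t => rho t * u t * (c 0 - c t))); last first.
  by move=> t /andP[t0 tpi]; rewrite /= int_rho_sin// ltW.
rewrite [X in _ - X](@eq_int1 _ _ (fun t => rho t * u t * (c t - c pi))); last first.
  by move=> t /andP[t0 tpi]; rewrite /= int_rho_sin// ltW.
rewrite -int1B; [|bmeas|bmeas]; rewrite -int1Z; last by bmeas.
by apply: eq_int1 => t _; rewrite c_pi; ring.
Qed.

Lemma area_form_cos_sin : area_form c s = pi.
Proof.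
rewrite area_form_cos// -(@eq_int1 _ (fun t => rho t * s t ^+ 2)) ?int1_sin2; first by field.
by move=> t _; rewrite expr2.
Qed.

(* Schur test for the kernel 1 - sin (th b - th a) >= 0, which is the kernel of the
   area form up to the first Fourier mode: its row integrals are pi - 2. *)
Lemma area_form_orthogonal x y : bmeas1 x -> bmeas1 y ->
  int1 (fun t => rho t * (c t * x t)) = 0 -> int1 (fun t => rho t * (s t * x t)) = 0 ->
  int1 (fun t => rho t * (c t * y t)) = 0 -> int1 (fun t => rho t * (s t * y t)) = 0 ->
  area_form x y <= (pi / 2 - 1) * int1 (fun t => rho t * (x t ^+ 2 + y t ^+ 2)).
Proof.
move=> bx by_ cx0 sx0 cy0 sy0.
have bw := bmeas2_wedge.
pose e t := x t ^+ 2 + y t ^+ 2.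
have be : bmeas1 e by rewrite /e; bmeas.
have bk : bmeas2 (fun z => 1 - wedge c s z) by apply: bmeas2B; [bmeas|exact: bw].
have sym (p q u v : R -> R) : bmeas1 p -> bmeas1 q -> bmeas1 u -> bmeas1 v ->
    int2 (fun z => rho z.1 * (p z.1 * u z.1) * (rho z.2 * (q z.2 * v z.2)) +
      rho z.1 * (q z.1 * v z.1) * (rho z.2 * (p z.2 * u z.2))) =
    int1 (fun t => rho t * (p t * u t)) * int1 (fun t => rho t * (q t * v t)).
  move=> bp bq bu bv; rewrite int2D; [|bmeas|bmeas].
  by rewrite (@int2_symmetrized _ (fun t => rho t * (p t * u t)) (fun t => rho t * (q t * v t)));
    [|bmeas|bmeas].
(* Replacing the kernel 1 by 1 - sin (th b - th a) costs nothing: the integral of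
   [wedge c s * wedge x y] splits into products of first-mode coefficients of x and y, which
   vanish. *)
have -> : area_form x y = int2 (fun z => rho z.1 * rho z.2 * ((1 - wedge c s z) * wedge x y z)).
  rewrite /area_form (@eq_int2 _ _ (fun z => rho z.1 * rho z.2 * ((1 - wedge c s z) * wedge x y z)
    + ((rho z.1 * (c z.1 * x z.1) * (rho z.2 * (s z.2 * y z.2)) +
        rho z.1 * (s z.1 * y z.1) * (rho z.2 * (c z.2 * x z.2)))
      - (rho z.1 * (c z.1 * y z.1) * (rho z.2 * (s z.2 * x z.2)) +
        rho z.1 * (s z.1 * x z.1) * (rho z.2 * (c z.2 * y z.2)))))); last first.
    by move=> z _; rewrite /wedge; ring.
  rewrite int2D; [|by apply: bmeas2M; [bmeas|apply: bmeas2M; [|exact: bw]]|bmeas].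
  rewrite int2B; [|bmeas|bmeas].
  by rewrite (sym c s x y)// (sym c s y x)// cx0 cy0 !mul0r subrr addr0.
apply: (@le_trans _ _ (int2 (fun z => rho z.1 * e z.1 * (2^-1 * (rho z.2 * (1 - wedge c s z)))
    + rho z.2 * e z.2 * (2^-1 * (rho z.1 * (1 - wedge c s z)))))).
  apply: le_int2.
  - by apply: bmeas2M; [bmeas|apply: bmeas2M; [|exact: bw]].
  - by bmeas.
  - move=> z _.
    have -> : rho z.1 * e z.1 * (2^-1 * (rho z.2 * (1 - wedge c s z)))
      + rho z.2 * e z.2 * (2^-1 * (rho z.1 * (1 - wedge c s z))) =
      rho z.1 * rho z.2 * ((1 - wedge c s z) * (2^-1 * (e z.1 + e z.2))) by ring.
    apply: ler_wpM2l; first exact: mulr_ge0.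
    apply: ler_wpM2l.
      rewrite subr_ge0 /wedge; have := cs1 z.1; have := cs1 z.2.
      move: (c z.1) (s z.1) (c z.2) (s z.2) => p1 q1 p2 q2 h2 h1.
      by have := sqr_ge0 (p1 - q2); have := sqr_ge0 (q1 + p2); nra.
    rewrite /wedge /e; move: (x z.1) (x z.2) (y z.1) (y z.2) => x1 x2 y1 y2.
    by have := sqr_ge0 (x1 - y2); have := sqr_ge0 (x2 + y1); nra.
rewrite int2D; [|bmeas|bmeas].
rewrite (@int2_sndM _ (fun t => rho t * e t) (fun z => 2^-1 * (rho z.1 * (1 - wedge c s z)))); [|bmeas|bmeas].
rewrite (@int2_fstM _ (fun t => rho t * e t) (fun z => 2^-1 * (rho z.2 * (1 - wedge c s z)))); [|bmeas|bmeas].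
rewrite (@eq_int1 _ _ (fun t => rho t * e t * (2^-1 * (th pi - th t + (c pi * c t + s pi * s t) - 1)))); last first.
  move=> t /andP[t0 tpi]; congr (_ * _).
  rewrite (@integral_has_deriv (fun b => 2^-1 * (th b + (c t * c b + s t * s b))))//; first 1 last.
  - exact: ltW.
  - apply: continuousZfun; apply: continuousMfun => //.
    rewrite (_ : (fun b => _) = fun b => 1 + (s t * c b + - c t * s b)).
      apply: continuousDfun; first exact: cst_continuous.
      by apply: continuousDfun; exact: continuousZfun.
    by apply/funext => b; rewrite /wedge/=; ring.
  - move=> b; apply: deriv_ext.
      apply: deriv_funZ; apply: deriv_funD; first exact: dth.
      by apply: deriv_funD; apply: deriv_funZ.
    by rewrite /wedge /=; ring.
  by have := cs1 t => h; rewrite -h; ring.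
rewrite [X in _ + X](@eq_int1 _ _ (fun t => rho t * e t * (2^-1 * (th t - th 0 + (c 0 * c t + s 0 * s t) - 1)))); last first.
  move=> t /andP[t0 tpi]; congr (_ * _).
  rewrite (@integral_has_deriv (fun b => 2^-1 * (th b + (- c t * c b + - s t * s b))))//; first 1 last.
  - exact: ltW.
  - apply: continuousZfun; apply: continuousMfun => //.
    rewrite (_ : (fun b => _) = fun b => 1 + (- s t * c b + c t * s b)).
      apply: continuousDfun; first exact: cst_continuous.
      by apply: continuousDfun; exact: continuousZfun.
    by apply/funext => b; rewrite /wedge/=; ring.
  - move=> b; apply: deriv_ext.
      apply: deriv_funZ; apply: deriv_funD; first exact: dth.
      by apply: deriv_funD; apply: deriv_funZ.
    by rewrite /wedge /=; ring.
  by have := cs1 t => h; rewrite -h; ring.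
rewrite -int1D; [|bmeas|bmeas].
rewrite -int1Z; last by bmeas.
rewrite le_eqVlt; apply/orP; left; apply/eqP; apply: eq_int1 => t _.
by rewrite -/(e t) th_pi c_pi s_pi; field.
Qed.

Lemma cos_norm_le1 t : `|c t| <= 1.
Proof.
have c1 : c t ^+ 2 <= 1 by rewrite -(cs1 t) lerDl sqr_ge0.
by rewrite ler_norml; apply/andP; split; nra.
Qed.

Lemma sin_norm_le1 t : `|s t| <= 1.
Proof.
have s1 : s t ^+ 2 <= 1 by rewrite -(cs1 t) lerDr sqr_ge0.
by rewrite ler_norml; apply/andP; split; nra.
Qed.

(** The a's and b's are the coefficients of the orthogonal projections of v and w to the first mode
    in L^2(rho); each is 2 / pi times an integral bounded by that of rho, which is pi, hence the
    bound 2. Mixed terms vanish because the form preserves the mode and x, y are orthogonal to it.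
    The last identity is the theorem of Pythagoras. *)
Lemma spectral_gap v w : bmeas1 v -> bmeas1 w ->
  (forall t, `|v t| <= 1) -> (forall t, `|w t| <= 1) ->
  exists a1 a2 b1 b2 : R,
    let x t := v t - a1 * c t - a2 * s t in
    let y t := w t - b1 * c t - b2 * s t in
    let E := int1 (fun t => rho t * (x t ^+ 2 + y t ^+ 2)) in
    [/\ [/\ `|a1| <= 2, `|a2| <= 2, `|b1| <= 2 & `|b2| <= 2],
      area_form v w <= pi * (a1 * b2 - a2 * b1) + (pi / 2 - 1) * E &
      int1 (fun t => rho t * (v t ^+ 2 + w t ^+ 2)) =
        pi / 2 * (a1 ^+ 2 + a2 ^+ 2 + b1 ^+ 2 + b2 ^+ 2) + E].
Proof.
move=> bv bw v1 w1; have pi0 := @pi_gt0 R.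
pose coef p u := 2 / pi * int1 (fun t => rho t * (p t * u t)).
have coef2 p u : bmeas1 p -> bmeas1 u -> (forall t, `|p t| <= 1) ->
    (forall t, `|u t| <= 1) -> `|coef p u| <= 2.
  move=> bp bu p1 u1.
  have pu t : `|rho t * (p t * u t)| <= rho t.
    rewrite normrM (ger0_norm (rho_ge0 t)) -[X in _ <= X]mulr1.
    by apply: ler_wpM2l => //; rewrite normrM -(mulr1 1); apply: ler_pM.
  have I1 : int1 (fun t => rho t * (p t * u t)) <= pi.
    rewrite -int1_rho; apply: le_int1; [bmeas|bmeas|] => t _.
    by have := pu t; rewrite ler_norml => /andP[].
  have I2 : - pi <= int1 (fun t => rho t * (p t * u t)).
    rewrite -int1_rho -mulN1r -int1Z//; apply: le_int1; [bmeas|bmeas|] => t _.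
    by have := pu t; rewrite ler_norml mulN1r => /andP[].
  have I3 : `|int1 (fun t => rho t * (p t * u t))| <= pi by rewrite ler_norml I1 I2.
  have p2 : 0 <= 2 / pi :> R by rewrite divr_ge0// ltW.
  rewrite /coef normrM (ger0_norm p2).
  by rewrite mulrAC ler_pdivrMr// ler_pM2l.
exists (coef c v), (coef s v), (coef c w), (coef s w) => x y E.
have coefE p u : int1 (fun t => rho t * (p t * u t)) = pi / 2 * coef p u.
  rewrite /coef mulrA (_ : pi / 2 * (2 / pi) = 1) ?mul1r//.
  by move: (lt0r_neq0 pi0); move: (pi : R) => q q0; field.
move: (coefE c v) (coefE s v) (coefE c w) (coefE s w).
move: (coef2 c v bc bv cos_norm_le1 v1) (coef2 s v bs bv sin_norm_le1 v1).
move: (coef2 c w bc bw cos_norm_le1 w1) (coef2 s w bs bw sin_norm_le1 w1).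
rewrite /E /x /y {coefE coef2 E x y}.
move: (coef c v) (coef s v) (coef c w) (coef s w) => a1 a2 b1 b2 nb1 nb2 na1 na2 ea1 ea2 eb1 eb2.
pose x t := v t - a1 * c t - a2 * s t.
pose y t := w t - b1 * c t - b2 * s t.
rewrite -/(x _) -/(y _).
have bx : bmeas1 x by rewrite /x; bmeas.
have by_ : bmeas1 y by rewrite /y; bmeas.
have cc : int1 (fun t => rho t * (c t * c t)) = pi / 2.
  by rewrite -int1_cos2; apply: eq_int1 => t _; rewrite expr2.
have ss : int1 (fun t => rho t * (s t * s t)) = pi / 2.
  by rewrite -int1_sin2; apply: eq_int1 => t _; rewrite expr2.
have cs := int1_cos_sin.
have sc : int1 (fun t => rho t * (s t * c t)) = 0.
  by rewrite -int1_cos_sin; apply: eq_int1 => t _; rewrite mulrCA [s t * _]mulrC; ring.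
have lin p u k l : bmeas1 p -> bmeas1 u ->
    int1 (fun t => rho t * (p t * (u t - k * c t - l * s t))) =
    int1 (fun t => rho t * (p t * u t)) - k * int1 (fun t => rho t * (p t * c t))
    - l * int1 (fun t => rho t * (p t * s t)).
  move=> bp bu; rewrite -!int1Z; [|bmeas..].
  rewrite -!int1B; [|bmeas..].
  by apply: eq_int1 => t _; ring.
have cx : int1 (fun t => rho t * (c t * x t)) = 0.
  by rewrite lin// ea1 cc cs; ring.
have sx : int1 (fun t => rho t * (s t * x t)) = 0.
  by rewrite lin// ea2 ss sc; ring.
have cy : int1 (fun t => rho t * (c t * y t)) = 0.
  by rewrite lin// eb1 cc cs; ring.
have sy : int1 (fun t => rho t * (s t * y t)) = 0.
  by rewrite lin// eb2 ss sc; ring.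
have bW u u' : bmeas1 u -> bmeas1 u' -> bmeas2 (fun z => rho z.1 * rho z.2 * wedge u u' z).
  by move=> bu bu'; apply: bmeas2M; [bmeas|exact: bmeas2_wedge].
split => //.
- have -> : area_form v w = area_form x y + (a1 * b2 - a2 * b1) * area_form c s
      + (a1 * area_form c y + a2 * area_form s y)
      - (b1 * area_form c x + b2 * area_form s x).
    rewrite /area_form -!int2Z; [|exact: bW..].
    rewrite -int2D; [|exact: bW|by apply: bmeas2M; [bmeas|exact: bW]].
    rewrite -!int2D; try by repeat (first [exact: bW|exact: bmeas2_cst|apply: bmeas2D|apply: bmeas2M]).
    rewrite -int2B; try by repeat (first [exact: bW|exact: bmeas2_cst|apply: bmeas2D|apply: bmeas2M]).
    by apply: eq_int2 => z _; rewrite /wedge /x /y; ring.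
  rewrite !(area_form_cos bx, area_form_cos by_, area_form_sin bx, area_form_sin by_).
  rewrite area_form_cos_sin cx sx cy sy.
  have := area_form_orthogonal bx by_ cx sx cy sy.
  by move: (area_form x y) (int1 _) => A B; lra.
- have -> : pi / 2 * (a1 ^+ 2 + a2 ^+ 2 + b1 ^+ 2 + b2 ^+ 2) +
      int1 (fun t => rho t * (x t ^+ 2 + y t ^+ 2)) =
      int1 (fun t => rho t * (x t ^+ 2 + y t ^+ 2)) + (
      ((a1 ^+ 2 + b1 ^+ 2) * int1 (fun t => rho t * (c t * c t)) +
       (a2 ^+ 2 + b2 ^+ 2) * int1 (fun t => rho t * (s t * s t))) +
      ((2 * a1) * int1 (fun t => rho t * (c t * x t)) +
       (2 * a2) * int1 (fun t => rho t * (s t * x t)) +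
       ((2 * b1) * int1 (fun t => rho t * (c t * y t)) +
       (2 * b2) * int1 (fun t => rho t * (s t * y t))) +
       (2 * (a1 * a2 + b1 * b2)) * int1 (fun t => rho t * (c t * s t)))).
    by rewrite cx sx cy sy cc ss cs; ring.
  rewrite -!int1Z; [|bmeas..].
  rewrite -!int1D; [|bmeas..].
  by apply: eq_int1 => t _; rewrite /x /y; ring.
Qed.

End SpectralGap.

(** * The logarithmic weight eps / (eps + sin t) and its mass *)

Section LogKernel.
Variable R : realType.
Notation mu := (@lebesgue_measure R).
Implicit Types (a b t eps xi : R).

(* A majorant of eps / (eps + sin t) on (0, pi) whose integral is explicit. *)
Definition psi eps t : R := eps / (eps + t / 2) + eps / (eps + (pi - t) / 2).

(** The integral of [psi eps] over (0, pi), of order eps log(1/eps). *)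
Definition psi_mass eps : R := 4 * eps * (ln (eps + pi / 2) - ln eps).

Let Psi eps t : R := 2 * eps * (ln (eps + t / 2) + (- 1) * ln (eps + (pi - t) / 2)).

Lemma psi_ge0 eps t : 0 < eps -> 0 <= t <= pi -> 0 <= psi eps t.
Proof.
move=> e0 /andP[t0 tpi].
have h1 : 0 <= t / 2 by lra.
have h2 : 0 <= (pi - t) / 2 by lra.
by apply: addr_ge0; apply: divr_ge0; [exact: ltW|lra|exact: ltW|lra].
Qed.

Lemma psi_le2 eps t : 0 < eps -> 0 <= t <= pi -> psi eps t <= 2.
Proof.
move=> e0 /andP[t0 tpi].
have h1 : 0 <= t / 2 by lra.
have h2 : 0 <= (pi - t) / 2 by lra.
rewrite -[2]/(1 + 1); apply: lerD; rewrite ler_pdivrMr ?mul1r; lra.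
Qed.

Lemma psi_ge eps t : 0 < eps -> 0 < t < pi -> eps / (eps + sin t) <= psi eps t.
Proof.
move=> e0 /andP[t0 tpi].
have h1 : 0 <= t / 2 by lra.
have h2 : 0 <= (pi - t) / 2 by lra.
have i1 : 0 <= eps / (eps + t / 2) by apply: divr_ge0; lra.
have i2 : 0 <= eps / (eps + (pi - t) / 2) by apply: divr_ge0; lra.
have st : 0 < sin t by apply: sin_gt0_pi; rewrite t0.
have [tp|tp] := leP t (pi / 2).
  apply: (@le_trans _ _ (eps / (eps + t / 2))); last by rewrite /psi lerDl.
  apply: ler_wpM2l; first exact: ltW.
  have := half_le_sin (ltW t0) tp => h3.
  by rewrite lef_pV2 ?posrE; lra.
apply: (@le_trans _ _ (eps / (eps + (pi - t) / 2))); last by rewrite /psi lerDr.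
apply: ler_wpM2l; first exact: ltW.
have sE : sin t = sin (pi - t) by rewrite sinB sinpi cospi; ring.
have h3 : (pi - t) / 2 <= sin t by rewrite sE; apply: half_le_sin; lra.
by rewrite lef_pV2 ?posrE; lra.
Qed.

Lemma bmeas1_psi eps : 0 < eps -> bmeas1 (psi eps).
Proof.
move=> e0; split.
  have mi (F : R -> R) : continuous F -> measurable_fun [set: R] (fun x => eps / F x).
    move=> cF; apply: measurable_funM; first exact: measurable_cst.
    apply: (measurableT_comp (@measurable_fun_inv R)).
    exact: continuous_measurable_fun.
  apply: measurable_funD; apply: mi.
    apply: (@has_deriv_continuous _ _ (fun=> 2^-1 * 1)) => x.
    have -> : (fun t : R => eps + t / 2) = (fun t => eps + 2^-1 * (t - 0)).
      by apply/funext => t; rewrite subr0 mulrC.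
    by apply: deriv_funDl; apply: deriv_funZ; exact: deriv_fun_subr.
  apply: (@has_deriv_continuous _ _ (fun=> - 2^-1 * 1)) => x.
  have -> : (fun t : R => eps + (pi - t) / 2) = (fun t => eps + - 2^-1 * (t - pi)).
    by apply/funext => t; ring.
  by apply: deriv_funDl; apply: deriv_funZ; exact: deriv_fun_subr.
exists 2 => t t0pi; rewrite ger0_norm ?psi_le2//; exact: psi_ge0.
Qed.

Let deriv_ln_affine (k l x : R) : 0 < l + k * x ->
  has_deriv x (fun t => ln (l + k * t)) ((l + k * x)^-1 * k).
Proof.
move=> h; apply: (deriv_fun_comp (F := @ln R)); first exact: is_derive1_ln.
have -> : (fun t => l + k * t) = (fun t => l + k * (t - 0)).
  by apply/funext => t; rewrite subr0.
by rewrite -[X in has_deriv _ _ X]mulr1; apply: deriv_funDl; apply: deriv_funZ; exact: deriv_fun_subr.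
Qed.

Let deriv_Psi eps t : 0 < eps -> 0 <= t <= pi -> has_deriv t (Psi eps) (psi eps t).
Proof.
move=> e0 /andP[t0 tpi].
have -> : Psi eps = fun t => 2 * eps * (ln (eps + 2^-1 * t) + (- 1) * ln (eps + pi / 2 + - 2^-1 * t)).
  apply/funext => x; rewrite /Psi; congr (_ * (ln _ + _ * ln _)); first by rewrite mulrC.
  by ring.
apply: deriv_ext.
  apply: deriv_funZ; apply: deriv_funD; last apply: deriv_funZ; apply: deriv_ln_affine; lra.
have d1 : eps + t / 2 != 0 by apply: lt0r_neq0; lra.
have d2 : eps + (pi - t) / 2 != 0 by apply: lt0r_neq0; lra.
rewrite /psi [2^-1 * t]mulrC.
have -> : eps + pi / 2 + - 2^-1 * t = eps + (pi - t) / 2 by ring.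
move: (eps + t / 2) (eps + (pi - t) / 2) d1 d2 => p q p0 q0.
by field; rewrite p0 q0.
Qed.

Let continuous_psi eps t : 0 < eps -> 0 <= t <= pi -> {for t, continuous (psi eps)}.
Proof.
move=> e0 /andP[t0 tpi]; rewrite /psi.
apply: cvgD; (apply: cvgM; first exact: cvg_cst);
  (apply: cvgV; first by apply: lt0r_neq0; lra); (apply: cvgD; first exact: cvg_cst);
  (apply: cvgM; last exact: cvg_cst).
  exact: cvg_id.
by apply: cvgB; [exact: cvg_cst|exact: cvg_id].
Qed.

Lemma int_psi_le eps t : 0 < eps -> 0 <= t <= pi -> Psi eps t - Psi eps 0 <= psi_mass eps.
Proof.
move=> e0 /andP[t0 tpi]; have pi0 := @pi_gt0 R.
have -> : psi_mass eps = Psi eps pi - Psi eps 0.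
  by rewrite /psi_mass /Psi subr0 subrr mul0r addr0; ring.
rewrite lerD2r /Psi; apply: ler_wpM2l; first by apply: mulr_ge0 => //; exact: ltW.
rewrite !mulN1r; apply: lerB; rewrite ler_ln ?posrE; lra.
Qed.

Lemma int_psi_right eps a : 0 < eps -> 0 < a < pi ->
  Rintegral mu `]a, pi[ (fun b => psi eps (b - a)) <= psi_mass eps.
Proof.
move=> e0 /andP[a0 api].
rewrite (@integral_derivative _ (fun b => Psi eps (b - a))).
- by rewrite subrr; apply: int_psi_le => //; apply/andP; split; lra.
- exact: ltW.
- move=> x /andP[ax xpi]; apply: deriv_fun_shift; apply: deriv_Psi => //.
  by apply/andP; split; lra.
- move=> x /andP[ax xpi]; apply: (@continuous_comp _ _ _ (fun b => b - a) (psi eps)).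
    by apply: cvgB; [exact: cvg_id|exact: cvg_cst].
  by apply: continuous_psi => //; apply/andP; split; lra.
Qed.

Lemma int_psi_left eps b : 0 < eps -> 0 < b < pi ->
  Rintegral mu `]0, b[ (fun a => psi eps (b - a)) <= psi_mass eps.
Proof.
move=> e0 /andP[b0 bpi].
rewrite (@integral_derivative _ (fun a => (- 1) * Psi eps (b - a))).
- rewrite subrr subr0 !mulN1r opprK addrC.
  by apply: int_psi_le => //; apply/andP; split; lra.
- exact: ltW.
- move=> x /andP[ax xpi]; apply: deriv_ext.
    apply: deriv_funZ; apply: (deriv_fun_comp (G := fun a => b - a)).
      by apply: deriv_Psi => //; apply/andP; split; lra.
    have -> : (fun a => b - a) = fun a => (- 1) * (a - b) by apply/funext => t; ring.
    by apply: deriv_funZ; exact: deriv_fun_subr.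
  by rewrite /=; ring.
- move=> x /andP[ax xpi]; apply: (@continuous_comp _ _ _ (fun a => b - a) (psi eps)).
    by apply: cvgB; [exact: cvg_cst|exact: cvg_id].
  by apply: continuous_psi => //; apply/andP; split; lra.
Qed.

Lemma psi_mass_gt0 eps : 0 < eps -> 0 < psi_mass eps.
Proof.
move=> e0; have pi0 := @pi_gt0 R; apply: mulr_gt0; first exact: mulr_gt0.
by rewrite subr_gt0 ltr_ln ?posrE; lra.
Qed.

(** The logarithm is traded for a power by ln x <= x^del / del with del = 1 - xi / 2. The exponent
    xi / 2 is chosen so that the square of the mass is of order eps^xi. *)
Lemma psi_mass_le eps xi : 0 < eps <= 2 -> 1 < xi < 2 ->
  psi_mass eps <= 16 / (1 - xi / 2) * eps `^ (xi / 2).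
Proof.
move=> /andP[e0 e2] /andP[xi1 xi2]; have pi0 := @pi_gt0 R; have := @pihalf_lt2 R => pi2.
set del := 1 - xi / 2; have del0 : 0 < del by rewrite /del; lra.
have q0 : 0 < eps + pi / 2 by lra.
have x0 : 0 < (eps + pi / 2) / eps by rewrite divr_gt0.
have -> : psi_mass eps = 4 * eps * ln ((eps + pi / 2) / eps).
  by rewrite /psi_mass ln_div ?posrE.
have h1 : ln ((eps + pi / 2) / eps) <= ((eps + pi / 2) / eps) `^ del / del.
  rewrite ler_pdivlMr// mulrC -ln_powR; apply: ltW; apply: ln_sublinear.
  exact: powR_gt0.
have h2 : eps * ((eps + pi / 2) / eps) `^ del <= 4 * eps `^ (xi / 2).
  rewrite powRM ?invr_ge0; [|exact: ltW|exact: ltW].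
  rewrite mulrCA; apply: ler_pM.
  - exact: powR_ge0.
  - by rewrite mulr_ge0 ?powR_ge0// ltW.
  (* Here eps + pi / 2 <= 4 and del <= 1; this 4 and the factor 4 of [psi_mass] make the constant
     16. *)
  - have h3 : (eps + pi / 2) `^ del <= 4 `^ del.
      by apply: ge0_ler_powR; rewrite ?nnegrE; lra.
    by apply: (le_trans h3); rewrite -[X in _ <= X]powRr1//; apply: ler_powR; rewrite /del; lra.
  - rewrite -(powR_inv1 (ltW e0)) -powRrM -{1}(powRr1 (ltW e0)) -powRD.
      by rewrite (_ : 1 + -1 * del = xi / 2)// /del; ring.
    by rewrite (gt_eqF e0) implybT.
apply: (@le_trans _ _ (4 * eps * (((eps + pi / 2) / eps) `^ del / del))).
  by apply: ler_wpM2l => //; rewrite mulr_ge0// ltW.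
rewrite -mulrA [eps * _]mulrA.
rewrite [X in _ <= X](_ : _ = 4 * (4 * eps `^ (xi / 2) / del)); last by ring.
apply: ler_wpM2l => //; apply: ler_wpM2r => //; by rewrite invr_ge0 ltW.
Qed.

End LogKernel.

(** * Perturbation of the kernel p_ab away from the hemisphere *)

Section GramExpansion.
Variable R : realType.

(** For c = cos (b - a) and s = sin (b - a), the coefficients of h and g are multiples of ca - c cb
    = s sb and cb - c ca = - s sa. Hence the linear part carries a factor s, and only the quadratic
    part feels the full singularity 1 / s^2. *)
Lemma gram_expansion (k D ca sa cb sb h g : R) :
  sa ^+ 2 = 1 - ca ^+ 2 -> sb ^+ 2 = 1 - cb ^+ 2 -> k ^+ 2 = 1 - D ^+ 2 ->
  1 - (ca * cb + sa * sb) ^+ 2 - (k * ca + h) ^+ 2 - (k * cb + g) ^+ 2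
    + 2 * (ca * cb + sa * sb) * (k * ca + h) * (k * cb + g) =
  D ^+ 2 * (sb * ca - cb * sa) ^+ 2
    - 2 * k * (sb * ca - cb * sa) * (h * sb - g * sa)
    - (h ^+ 2 + g ^+ 2 - 2 * (ca * cb + sa * sb) * h * g).
Proof.
move=> sa2 sb2 k2; set c := ca * cb + sa * sb; set s := sb * ca - cb * sa.
have i1 : ca - c * cb = sb * s.
  transitivity (ca * (1 - cb ^+ 2) - sa * sb * cb); first by rewrite /c; ring.
  by rewrite -sb2 /s; ring.
have i2 : cb - c * ca = - (sa * s).
  transitivity (cb * (1 - ca ^+ 2) - sa * sb * ca); first by rewrite /c; ring.
  by rewrite -sa2 /s; ring.
have i3 : 1 - c ^+ 2 = s ^+ 2.
  transitivity ((ca ^+ 2 + (1 - ca ^+ 2)) * (cb ^+ 2 + (1 - cb ^+ 2)) - c ^+ 2); first by ring.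
  by rewrite -sa2 -sb2 /c /s; ring.
have i4 : ca ^+ 2 + cb ^+ 2 - 2 * c * ca * cb = s ^+ 2.
  transitivity (ca * (ca - c * cb) + cb * (cb - c * ca)); first by ring.
  by rewrite i1 i2 /s; ring.
transitivity ((1 - c ^+ 2) - (k ^+ 2 * (ca ^+ 2 + cb ^+ 2 - 2 * c * ca * cb)
   + 2 * k * (h * (ca - c * cb) + g * (cb - c * ca)) + (h ^+ 2 + g ^+ 2 - 2 * c * h * g))).
  by ring.
by rewrite i4 i1 i2 i3 k2; ring.
Qed.

Lemma measurable_p_ab (f : R -> R) : continuous f ->
  measurable_fun [set: R * R] (fun z => p_ab f z.1 z.2).
Proof.
move=> cf; have mf := continuous_measurable_fun cf.
have m1 : measurable_fun [set: R * R] (fun z => f z.1) by exact: (measurableT_comp mf measurable_fst).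
have m2 : measurable_fun [set: R * R] (fun z => f z.2) by exact: (measurableT_comp mf measurable_snd).
have m12 : measurable_fun [set: R * R] (fun z => z.2 - z.1).
  by apply: measurable_funB; [exact: measurable_snd|exact: measurable_fst].
have mcos (g : R * R -> R) : measurable_fun setT g -> measurable_fun setT (fun z => cos (g z)).
  exact: (measurableT_comp (continuous_measurable_fun (@continuous_cos R))).
have msin (g : R * R -> R) : measurable_fun setT g -> measurable_fun setT (fun z => sin (g z)).
  exact: (measurableT_comp (continuous_measurable_fun (@continuous_sin R))).
have mX (g : R * R -> R) n : measurable_fun setT g -> measurable_fun setT (fun z => g z ^+ n).
  by move=> mg; exact: measurable_funX.
have mM (g g' : R * R -> R) : measurable_fun setT g -> measurable_fun setT g' ->
   measurable_fun setT (fun z => g z * g' z) by exact: measurable_funM.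
have mD (g g' : R * R -> R) : measurable_fun setT g -> measurable_fun setT g' ->
   measurable_fun setT (fun z => g z + g' z) by exact: measurable_funD.
have mB (g g' : R * R -> R) : measurable_fun setT g -> measurable_fun setT g' ->
   measurable_fun setT (fun z => g z - g' z) by exact: measurable_funB.
have mc (r : R) : measurable_fun [set: R * R] (fun=> r) by exact: measurable_cst.
apply: (mM _ _); last first.
  apply: (measurableT_comp (@measurable_fun_inv R)).
  by apply: (mM _ _); [apply: (mM _ _)|]; apply: (mX _ _); exact: (msin _).
apply: (mD _ _).
  by apply: (mB _ _); [apply: (mB _ _); [apply: (mB _ _)|]|]; rewrite //; apply: (mX _ _); exact: (mcos _).
by apply: (mM _ _); [apply: (mM _ _); [apply: (mM _ _)|]|]; rewrite //; exact: (mcos _).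
Qed.

End GramExpansion.

(** * First-order expansion of the kernel and cancellation of its linear part *)

Section Perturbation.
Variable R : realType.
Notation mu := (@lebesgue_measure R).
Variables (f : R -> R) (tau d M eps : R).
Hypothesis ff : ES1 f.
Hypothesis d0 : 0 < sin d.
Hypothesis M1 : 1 <= M.
Hypothesis MD : (sin d ^+ 2)^-1 <= M.
Hypothesis fM : forall x, 1 <= M * (1 - cos (f x) ^+ 2).
Hypothesis e02 : 0 < eps <= 2.
Hypothesis fe : forall x, `|cos (f x) - cos d * cos (x - tau)| <= eps.

Let h x : R := cos (f x) - cos d * cos (x - tau).
Let y := isin_dist tau d.
Let c := cos_th tau d.
Let s := sin_th tau d.
Let rh := rho tau d.
Let K (z : R * R) := p_ab f z.1 z.2.
Let e z := K z - rh z.1 * rh z.2.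
(** [u1] and [u2] come from the linear part of the kernel times [wedge c s]: after expanding sin (b
    - a), the coefficient of h a is sorted into multiples of [rh * s] and of [rh * c] at b. *)
Let u1 a : R := 2 * cos d * y a ^+ 3 * (sin d ^+ 2 * cos (a - tau) ^+ 2 * y a ^+ 2 - 1).
Let u2 a : R := - 2 * cos d * sin d * cos (a - tau) * sin (a - tau) * y a ^+ 5.
(* The part of e * wedge c s that is linear in h.  The coefficients of h at the two
   endpoints are exchanged, up to sign, by swapping the endpoints, so that int2 F reduces
   to a single integral, whose integrand vanishes identically. *)
Let F (z : R * R) := h z.1 * (u1 z.1 * (rh z.2 * s z.2) + u2 z.1 * (rh z.2 * c z.2))
  - h z.2 * (u1 z.2 * (rh z.1 * s z.1) + u2 z.2 * (rh z.1 * c z.1)).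
Let C := 220 * M ^+ 4.
Let L := psi_mass eps.

Let e0 : 0 < eps. Proof. by case/andP: e02. Qed.
Let M0 : 0 < M. Proof. exact: lt_le_trans M1. Qed.
Let C0 : 0 < C. Proof. by rewrite /C mulr_gt0// exprn_gt0. Qed.

Let kernel_pointwise z : triangle z ->
  `|e z| <= C * psi eps (z.2 - z.1) /\
  `|e z * wedge c s z - F z| <= M * C * eps * psi eps (z.2 - z.1).
Proof.
case: z => a b [/= a0 [ab bpi]].
have t0 : 0 < b - a by rewrite subr_gt0.
have tpi : b - a < pi by rewrite ltrBlDr (lt_trans bpi)// ltrDl.
have tp : 0 < b - a < pi by rewrite t0 tpi.
have S0 : 0 < sin (b - a) by exact: sin_gt0_pi.
set X := cos (f a); set Y := cos (f b).
pose N := 1 - cos (b - a) ^+ 2 - X ^+ 2 - Y ^+ 2 + 2 * cos (b - a) * X * Y.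
pose n := N / sin (b - a) ^+ 2.
have nsE : n * sin (b - a) ^+ 2 = N by rewrite /n divfK// expf_neq0// gt_eqF.
have S2 : 0 < sin (b - a) ^+ 2 by rewrite exprn_gt0.
have NE : N = sin (b - a) ^+ 2 * (1 - X ^+ 2) - (Y - cos (b - a) * X) ^+ 2.
  by rewrite /N sin2cos2; ring.
(* By [NE] the Gram determinant is sin^2(b - a) sin^2(f a) minus a square: the spherical triangle
   inequalities make it nonnegative, and it is at most sin^2(b - a). *)
have n01 : 0 <= n <= 1.
  have := ES1_gram ff tp; rewrite exprMn (sin2cos2 (f a)) -/X -/Y => g.
  rewrite /n ler_pdivlMr// ler_pdivrMr// mul0r mul1r NE subr_ge0 g/=.
  rewrite lerBlDr -[X in X <= _]addr0; apply: lerD; last exact: sqr_ge0.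
  by rewrite ler_piMr ?sqr_ge0// lerBlDr lerDl sqr_ge0.
pose A := (1 - X ^+ 2)^-1; pose B := (1 - Y ^+ 2)^-1.
have pos x : 0 < 1 - cos (f x) ^+ 2.
  by rewrite -(pmulr_rgt0 _ M0) (lt_le_trans _ (fM x)).
have bnd x : `|(1 - cos (f x) ^+ 2)^-1| <= M.
  have p := pos x; rewrite ger0_norm; last by rewrite invr_ge0 ltW.
  rewrite -[X in X <= _]mul1r ler_pdivrMr//; exact: fM.
have KE : K (a, b) = n * A * B.
  rewrite /K /p_ab /= -/X -/Y -/N (sin2cos2 (f a)) (sin2cos2 (f b)) -/X -/Y /n /A /B.
  by rewrite !invfM !mulrA.
have ybnd x : `|y x ^+ 2| <= M.
  by rewrite ger0_norm ?sqr_ge0//; apply: le_trans MD; exact: isin_dist_sqr_le.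
have yE x : y x ^+ 2 * (1 - (cos d * cos (x - tau)) ^+ 2) = 1.
  by rewrite exprMn; exact: isin_distE.
have cE : cos (b - a) = cos (a - tau) * cos (b - tau) + sin (a - tau) * sin (b - tau).
  by have -> : b - a = (b - tau) - (a - tau) by [ring]; rewrite [cos (_ - (a - tau))]cosB; ring.
have sE : sin (b - a) = sin (b - tau) * cos (a - tau) - cos (b - tau) * sin (a - tau).
  by have -> : b - a = (b - tau) - (a - tau) by [ring]; rewrite [sin (_ - (a - tau))]sinB; ring.
have hE x : cos d * cos (x - tau) + h x = cos (f x) by rewrite /h; ring.
have D1 : sin d ^+ 2 <= 1 by have := sin_le1 d; have := d0; nra.
have S01 : 0 < sin (b - a) <= 1 by rewrite S0 sin_le1.
have AE : A * (1 - X ^+ 2) = 1 by rewrite /A mulVf// gt_eqF//; exact: pos.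
have BE : B * (1 - Y ^+ 2) = 1 by rewrite /B mulVf// gt_eqF//; exact: pos.
have nE : n * sin (b - a) ^+ 2 = sin d ^+ 2 * sin (b - a) ^+ 2 -
    2 * cos d * sin (b - a) * (h a * sin (b - tau) - h b * sin (a - tau))
    - (h a ^+ 2 + h b ^+ 2 - 2 * cos (b - a) * h a * h b).
  rewrite nsE /N /X /Y -(hE a) -(hE b) cE sE.
  by apply: gram_expansion; [exact: sin2cos2|exact: sin2cos2|exact: cos2sin2].
have := @kernel_estimates R M (cos d) (sin d) (cos (a - tau)) (sin (a - tau))
  (cos (b - tau)) (sin (b - tau)) (h a) (h b) eps (sin (b - a)) n A B (y a ^+ 2) (y b ^+ 2).
rewrite !hE -cE => /(_ M1 (cos_max _) (cos_max _) (cos_max _) (sin_max _) (sin_max _)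
  (cos_max _) D1 S01 e02 (fe a) (fe b) (cos_max _) (cos_max _) (bnd a) (ybnd a)
  (bnd b) (ybnd b) AE (yE a) BE (yE b) n01 nE) [].
rewrite -KE => E1 E2.
have eE : e (a, b) = K (a, b) - sin d ^+ 2 * y a ^+ 2 * y b ^+ 2.
  by rewrite /e /rh /rho -/y /=; ring.
have ps := psi_ge e0 tp.
split.
  rewrite eE (le_trans E1)//; apply: ler_wpM2l ps; exact: ltW.
(* [q] is the quotient of [wedge c s] by sin (b - a); the bound M follows from y a y b <= (y a^2 + y
   b^2) / 2. *)
pose q := sin d * (y a * y b).
have qM : `|q| <= M.
  have ya := isin_dist_gt0 tau d0 a; have yb := isin_dist_gt0 tau d0 b.
  rewrite /q normrM -[M]mul1r; apply: ler_pM => //; first exact: sin_max.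
  have := ybnd a; have := ybnd b; rewrite !(ger0_norm (sqr_ge0 _)) (ger0_norm (mulr_ge0 (ltW ya) (ltW yb))).
  have := sqr_ge0 (y a - y b); rewrite -/(y a) -/(y b); move: (y a) (y b) => p r.
  rewrite sqrrB; lra.
have wE : wedge c s (a, b) = q * sin (b - a).
  transitivity (sin d * sin (b - a) * (y a * y b)); last by rewrite /q; ring.
  by rewrite -angle_sineE /wedge /c /s /=; ring.
have -> : e (a, b) * wedge c s (a, b) - F (a, b) =
   q * (sin (b - a) * (K (a, b) - sin d ^+ 2 * y a ^+ 2 * y b ^+ 2) -
    (- 2 * cos d * (h a * sin (b - tau) - h b * sin (a - tau)) * (y a ^+ 2 * y b ^+ 2) +
     sin (b - a) * sin d ^+ 2 *
     (2 * (cos d * cos (a - tau)) * h a * (y a ^+ 2) ^+ 2 * y b ^+ 2 +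
      2 * (cos d * cos (b - tau)) * h b * y a ^+ 2 * (y b ^+ 2) ^+ 2))).
  rewrite wE eE /F /u1 /u2 /rh /rho /s /c /sin_th /cos_th /q -/y /= sE.
  by ring.
apply: (le_trans (norm_le_mul qM E2)).
rewrite -[M * C * eps]mulrA -[M * (C * eps) * _]mulrA; apply: ler_wpM2l; first exact: ltW.
by apply: (ler_wpM2l _ ps); apply: mulr_ge0; exact: ltW.
Qed.

Let cont_cos : continuous (fun x => cos (x - tau)).
Proof.
apply: (@has_deriv_continuous _ _ (fun x => - sin (x - tau))) => x.
by apply: deriv_fun_shift; exact: is_derive_cos.
Qed.

Let cont_sin : continuous (fun x => sin (x - tau)).
Proof.
apply: (@has_deriv_continuous _ _ (fun x => cos (x - tau))) => x.
by apply: deriv_fun_shift; exact: is_derive_sin.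
Qed.

Let bcos : bmeas1 (fun x => cos (x - tau)). Proof. exact: continuous_bmeas1. Qed.
Let bsin : bmeas1 (fun x => sin (x - tau)). Proof. exact: continuous_bmeas1. Qed.
Let by_ : bmeas1 y. Proof. exact/continuous_bmeas1/continuous_isin_dist. Qed.
Let bc : bmeas1 c. Proof. exact/continuous_bmeas1/continuous_cos_th. Qed.
Let bs : bmeas1 s. Proof. exact/continuous_bmeas1/continuous_sin_th. Qed.
Let brh : bmeas1 rh. Proof. exact/continuous_bmeas1/continuous_rho. Qed.

Let bcf : bmeas1 (fun x => cos (f x)).
Proof.
apply: continuous_bmeas1 => x; apply: (@continuous_comp _ _ _ f cos).
  exact: ES1_continuous ff x.
exact: continuous_cos.
Qed.

Let bh : bmeas1 h. Proof. by rewrite /h; bmeas. Qed.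
Let bu1 : bmeas1 u1. Proof. by rewrite /u1; bmeas. Qed.
Let bu2 : bmeas1 u2. Proof. by rewrite /u2; bmeas. Qed.
Let bF : bmeas2 F. Proof. by rewrite /F; bmeas. Qed.
Let bw : bmeas2 (wedge c s). Proof. exact: bmeas2_wedge. Qed.
Let bpsi : bmeas2 (fun z => psi eps (z.2 - z.1)).
Proof. by apply: bmeas2_diff; exact: bmeas1_psi. Qed.

Lemma bmeas2_p_ab : bmeas2 (fun z => p_ab f z.1 z.2).
Proof.
split; first by apply: measurable_p_ab; exact: ES1_continuous.
have [_ [N NP]] : bmeas2 (fun z => rh z.1 * rh z.2) by bmeas.
exists (C * 2 + N) => z tz; have [ez _] := kernel_pointwise tz.
rewrite -/(K z) -[K z](subrK (rh z.1 * rh z.2)) -/(e z).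
apply: norm_le_add; last exact: NP.
apply: (le_trans ez); apply: ler_wpM2l; first exact: ltW.
case: tz => z1 [z12 z2]; apply: psi_le2 => //; apply/andP; split; lra.
Qed.

Let be : bmeas2 e.
Proof. by rewrite /e; apply: bmeas2B; [exact: bmeas2_p_ab|bmeas]. Qed.

Let int_first_order : int2 F = 0.
Proof.
rewrite /F int2B; [|bmeas|bmeas].
rewrite (@int2_fstM _ h (fun z => u1 z.1 * (rh z.2 * s z.2) + u2 z.1 * (rh z.2 * c z.2))); [|bmeas|bmeas].
rewrite (@int2_sndM _ h (fun z => u1 z.2 * (rh z.1 * s z.1) + u2 z.2 * (rh z.1 * c z.1))); [|bmeas|bmeas].
have intg (u : R -> R) a b : bmeas1 u -> 0 <= a -> b <= pi -> mu.-integrable `]a, b[ (EFin \o u).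
  move=> [mu_ [N uN]] a0 bpi; apply: itv_bounded_integrable => //.
  by exists N => x /andP[ax xb]; apply: uN; apply/andP; split; lra.
have inner a b k l : 0 <= a -> a <= b -> b <= pi ->
    Rintegral mu `]a, b[ (fun t => k * (rh t * s t) + l * (rh t * c t)) =
    k * (c a - c b) + l * (s b - s a).
  move=> a0 ab bpi; rewrite RintegralD//; [|by apply: intg => //; bmeas|by apply: intg => //; bmeas].
  rewrite !RintegralZl//; [|by apply: intg => //; bmeas|by apply: intg => //; bmeas].
  congr (_ * _ + _ * _).
    by apply: int_rho_sin => //; solve [exact: continuous_rho | exact: deriv_cos_th | exact: deriv_sin_th].
  by apply: int_rho_cos => //; solve [exact: continuous_rho | exact: deriv_cos_th | exact: deriv_sin_th].
rewrite (@eq_int1 _ _ (fun t => h t * (u1 t * (c t - c pi) + u2 t * (s pi - s t)))); last first.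
  by move=> t /andP[t0 tpi]; rewrite /= inner// ltW.
rewrite [X in _ - X](@eq_int1 _ _ (fun t => h t * (u1 t * (c 0 - c t) + u2 t * (s t - s 0)))); last first.
  by move=> t /andP[t0 tpi]; rewrite /= inner// ltW.
rewrite -int1B; [|bmeas|bmeas].
rewrite (@eq_int1 _ _ (fun=> 0)) ?int1_cst ?mul0r// => t _.
have -> : c pi = - c 0 by exact: cos_th_pi.
have -> : s pi = - s 0 by exact: sin_th_pi.
transitivity (2 * h t * (u1 t * c t - u2 t * s t)); first by ring.
(* The bracket vanishes: sin^2 d cos^2 + sin^2 equals [sinsq_dist], whose inverse is [y t ^+ 2]. *)
have -> : u1 t * c t - u2 t * s t = 2 * cos d * sin d * cos (t - tau) * y t ^+ 4 *
   (y t ^+ 2 * (sin d ^+ 2 * cos (t - tau) ^+ 2 + sin (t - tau) ^+ 2) - 1).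
  by rewrite /u1 /u2 /c /s /cos_th /sin_th -/y; ring.
have -> : sin d ^+ 2 * cos (t - tau) ^+ 2 + sin (t - tau) ^+ 2 = sinsq_dist tau d t.
  by rewrite /sinsq_dist (sin2cos2 d) (sin2cos2 (t - tau)); ring.
by rewrite isin_distE// subrr !mulr0.
Qed.

Let int_psi_total : int2 (fun z => psi eps (z.2 - z.1)) <= L * pi.
Proof.
rewrite int2_iterated1// -int1_cst; apply: le_Rintegral => //.
- exact: (integrable_inner1 bpsi).
- exact/bmeas1_integrable/bmeas1_cst.
- by move=> t /=; rewrite in_itv/= => t0pi; exact: int_psi_right.
Qed.

(** Subtracting [F] leaves the integral unchanged and gains a factor eps in the pointwise bound. *)
Let int_e_wedge : `|int2 (fun z => e z * wedge c s z)| <= M * C * eps * (L * pi).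
Proof.
have -> : int2 (fun z => e z * wedge c s z) = int2 (fun z => e z * wedge c s z - F z).
  by rewrite int2B ?int_first_order ?subr0//; exact: bmeas2M.
have k0 : 0 <= M * C * eps by rewrite !mulr_ge0// ltW.
have bd : bmeas2 (fun z => e z * wedge c s z - F z) by apply: bmeas2B => //; exact: bmeas2M.
have bp : bmeas2 (fun z => M * C * eps * psi eps (z.2 - z.1)) by bmeas.
have up : int2 (fun z => M * C * eps * psi eps (z.2 - z.1)) <= M * C * eps * (L * pi).
  by rewrite int2Z//; exact: ler_wpM2l.
rewrite ler_norml; apply/andP; split.
  rewrite lerNl; apply: le_trans up; rewrite -int2N//.
  apply: le_int2 => //; first exact: bmeas2N.
  by move=> z /kernel_pointwise[_]; rewrite ler_norml lerNl => /andP[].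
apply: le_trans up; apply: le_int2 => //.
by move=> z /kernel_pointwise[_]; rewrite ler_norml => /andP[].
Qed.

Lemma kernel_perturbation :
  [/\ bmeas2 (fun z => p_ab f z.1 z.2 - rho tau d z.1 * rho tau d z.2),
    forall z, triangle z -> `|p_ab f z.1 z.2 - rho tau d z.1 * rho tau d z.2|
      <= 220 * M ^+ 4 * psi eps (z.2 - z.1) &
    `|int2 (fun z => (p_ab f z.1 z.2 - rho tau d z.1 * rho tau d z.2) *
        wedge (cos_th tau d) (sin_th tau d) z)|
      <= M * (220 * M ^+ 4) * eps * (psi_mass eps * pi)].
Proof. by split; [exact: be|move=> z /kernel_pointwise[]|exact: int_e_wedge]. Qed.

End Perturbation.

(** * The form on pairs with values in the unit disc *)

Section UpperBound.
Variable R : realType.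
Notation mu := (@lebesgue_measure R).
Variables rho c s th : R -> R.
Hypothesis rho_cont : continuous rho.
Hypothesis rho_ge0 : forall x, 0 <= rho x.
Hypothesis dc : forall x, has_deriv x c (- (rho x * s x)).
Hypothesis ds : forall x, has_deriv x s (rho x * c x).
Hypothesis dth : forall x, has_deriv x th (rho x).
Hypothesis cs1 : forall x, c x ^+ 2 + s x ^+ 2 = 1.
Hypothesis c_pi : c pi = - c 0.
Hypothesis s_pi : s pi = - s 0.
Hypothesis th_pi : th pi = th 0 + pi.
Variables (e : R * R -> R) (eps C M T : R).
Hypothesis be : bmeas2 e.
Hypothesis e0 : 0 < eps.
Hypothesis C0 : 0 < C.
Hypothesis M0 : 0 < M.
Hypothesis rhoM : forall x, 1 <= M * rho x.
Hypothesis e_psi : forall z, triangle z -> `|e z| <= C * psi eps (z.2 - z.1).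
Hypothesis e_wedge : `|int2 (fun z => e z * wedge c s z)| <= T.
Let L := psi_mass eps.

Let c_cont : continuous c. Proof. exact: has_deriv_continuous dc. Qed.
Let s_cont : continuous s. Proof. exact: has_deriv_continuous ds. Qed.
Let brho : bmeas1 rho. Proof. exact: continuous_bmeas1. Qed.
Let bc : bmeas1 c. Proof. exact: continuous_bmeas1. Qed.
Let bs : bmeas1 s. Proof. exact: continuous_bmeas1. Qed.
Let bpsi : bmeas2 (fun z => psi eps (z.2 - z.1)).
Proof. by apply: bmeas2_diff; exact: bmeas1_psi. Qed.
Let L0 : 0 < L. Proof. exact: psi_mass_gt0. Qed.

Lemma psi_triangle_ge0 z : triangle z -> 0 <= psi eps (z.2 - z.1).
Proof.
by move=> [z1 [z12 z2]]; apply: psi_ge0 => //; apply/andP; split; lra.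
Qed.

Lemma int2_psi_fst u : bmeas1 u -> (forall x, 0 <= u x) ->
  int2 (fun z => u z.1 * psi eps (z.2 - z.1)) <= L * int1 u.
Proof.
move=> bu u0; rewrite int2_iterated1; last by bmeas.
rewrite -int1Z//; apply: le_Rintegral => //.
- by apply: (integrable_inner1 (K := fun z => u z.1 * psi eps (z.2 - z.1))); bmeas.
- by apply: bmeas1_integrable; bmeas.
move=> a /=; rewrite in_itv/= => a0pi.
rewrite RintegralZl//; last exact: (bmeas2_section1 bpsi).
by rewrite [L * _]mulrC; apply: ler_wpM2l => //; exact: int_psi_right.
Qed.

Lemma int2_psi_snd u : bmeas1 u -> (forall x, 0 <= u x) ->
  int2 (fun z => u z.2 * psi eps (z.2 - z.1)) <= L * int1 u.
Proof.
move=> bu u0; rewrite int2_iterated2; last by bmeas.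
rewrite -int1Z//; apply: le_Rintegral => //.
- by apply: (integrable_inner2 (K := fun z => u z.2 * psi eps (z.2 - z.1))); bmeas.
- by apply: bmeas1_integrable; bmeas.
move=> a /=; rewrite in_itv/= => a0pi.
rewrite RintegralZl//; last exact: (bmeas2_section2 bpsi).
by rewrite [L * _]mulrC; apply: ler_wpM2l => //; exact: int_psi_left.
Qed.

(** Each of the four products has one factor among x0, x1, y0, y1 and another of absolute value at
    most 4. The weighted inequality C |p r| <= del p^2 + 4 C^2 / del is applied to each; del is
    chosen later to fit the spectral gap. *)
Let cross_bound (del a1 a2 b1 b2 v0 w0 x0 x1 y0 y1 cc ss : R) : 0 < del ->
  `|a1| <= 2 -> `|a2| <= 2 -> `|b1| <= 2 -> `|b2| <= 2 -> `|cc| <= 1 -> `|ss| <= 1 ->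
  `|v0| <= 1 -> `|w0| <= 1 ->
  C * `|v0 * y1 + x0 * (b1 * cc + b2 * ss) - (a1 * cc + a2 * ss) * y0 - x1 * w0| <=
  del * (x0 ^+ 2 + y0 ^+ 2) + del * (x1 ^+ 2 + y1 ^+ 2) + 16 * C ^+ 2 / del.
Proof.
move=> del0 na1 na2 nb1 nb2 nc ns nv nw.
have am (p r : R) : `|r| <= 4 -> C * `|p * r| <= del * p ^+ 2 + 4 * C ^+ 2 / del.
  move=> r4; rewrite normrM.
  have : C * (`|p| * `|r|) <= C * (`|p| * 4).
    by apply: ler_wpM2l; [exact: ltW|apply: ler_wpM2l].
  move/le_trans; apply; rewrite -[p ^+ 2]real_normK ?num_real//.
  have : 0 <= del * (`|p| - 2 * C / del) ^+ 2 by apply: mulr_ge0; [exact: ltW|exact: sqr_ge0].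
  have -> : del * (`|p| - 2 * C / del) ^+ 2 = del * `|p| ^+ 2 + 4 * C ^+ 2 / del - C * (`|p| * 4).
    by field; exact: lt0r_neq0.
  by rewrite subr_ge0.
have lin p q : `|p| <= 2 -> `|q| <= 2 -> `|p * cc + q * ss| <= 4.
  move=> hp hq; have := norm_le_add (norm_le_mul hp nc) (norm_le_mul hq ns).
  by move/le_trans; apply; rewrite !mulr1 -natrD.
have le14 (r : R) : `|r| <= 1 -> `|r| <= 4 by move=> r1; apply: (le_trans r1); rewrite ler1n.
have t1 := am y1 v0 (le14 _ nv).
have t2 := am x0 _ (lin _ _ nb1 nb2).
have t3 := am y0 _ (lin _ _ na1 na2).
have t4 := am x1 w0 (le14 _ nw).
have N4 : `|v0 * y1 + x0 * (b1 * cc + b2 * ss) - (a1 * cc + a2 * ss) * y0 - x1 * w0| <=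
  `|y1 * v0| + `|x0 * (b1 * cc + b2 * ss)| + `|y0 * (a1 * cc + a2 * ss)| + `|x1 * w0|.
  rewrite (le_trans (ler_normB _ _))// lerD2r (le_trans (ler_normB _ _))//.
  rewrite [y0 * _]mulrC lerD2r (le_trans (ler_normD _ _))//.
  by rewrite [y1 * _]mulrC.
have := ler_wpM2l (ltW C0) N4; move/le_trans; apply.
have -> : 16 * C ^+ 2 / del = 4 * (4 * C ^+ 2 / del) by ring.
move: t1 t2 t3 t4; move: (4 * C ^+ 2 / del) => p5.
move: (`|y1 * v0|) (`|x0 * _|) (`|y0 * _|) (`|x1 * _|) => n1 n2 n3 n4.
rewrite !mulrDr; move: (C * n1) (C * n2) (C * n3) (C * n4) => p1 p2 p3 p4.
by move: (del * x0 ^+ 2) (del * y0 ^+ 2) (del * x1 ^+ 2) (del * y1 ^+ 2) => q1 q2 q3 q4; lra.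
Qed.

(** The choice del = kp / (2 l m) makes the two quadratic contributions add up to exactly
    [kp * E']. *)
Let balance (q kp l m E' C' : R) : kp != 0 -> l != 0 -> m != 0 ->
  kp * E' + 32 * q * C' ^+ 2 * m / kp * l ^+ 2 =
  l * (kp / (2 * l * m) * (m * E')) + (l * (kp / (2 * l * m) * (m * E')) +
    16 * C' ^+ 2 / (kp / (2 * l * m)) * (l * q)).
Proof. by move=> k0 l0 m0; field; rewrite k0 l0 m0. Qed.

(* The defect (2 - pi/2) E of the spectral gap absorbs the terms that are linear in the
   components x, y of v, w orthogonal to the extremal pair (c, s). *)
Lemma area_upper v w : bmeas1 v -> bmeas1 w -> (forall t, v t ^+ 2 + w t ^+ 2 <= 1) ->
  int2 (fun z => (rho z.1 * rho z.2 + e z) * wedge v w z) <=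
  pi + 8 * T + 32 * pi * C ^+ 2 * M / (2 - pi / 2) * L ^+ 2.
Proof.
move=> bv bw vw1; have pi0 := @pi_gt0 R; have pi2 := @pihalf_lt2 R.
have v1 t : `|v t| <= 1.
  by have := vw1 t; have := sqr_ge0 (w t); rewrite ler_norml => ? ?; apply/andP; split; nra.
have w1 t : `|w t| <= 1.
  by have := vw1 t; have := sqr_ge0 (v t); rewrite ler_norml => ? ?; apply/andP; split; nra.
have [a1 [a2 [b1 [b2]]]] := spectral_gap rho_cont rho_ge0 dc ds dth cs1 c_pi s_pi th_pi bv bw v1 w1.
pose x t := v t - a1 * c t - a2 * s t.
pose y t := w t - b1 * c t - b2 * s t.
rewrite /= -/(x _) -/(y _).
set E := int1 _ => -[[na1 na2 nb1 nb2] gap total].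
have bx : bmeas1 x by rewrite /x; bmeas.
have by_ : bmeas1 y by rewrite /y; bmeas.
have bwed : bmeas2 (wedge v w) by exact: bmeas2_wedge.
have bcs : bmeas2 (wedge c s) by exact: bmeas2_wedge.
pose kap : R := 2 - pi / 2; have kap0 : 0 < kap by rewrite subr_gt0.
(* Each endpoint contributes at most L del M E, which is now half of kap E. *)
pose del := kap / (2 * L * M); have del0 : 0 < del.
  by rewrite /del divr_gt0//; apply: mulr_gt0 => //; exact: mulr_gt0.
pose det := a1 * b2 - a2 * b1.
pose cross z := wedge v w z - det * wedge c s z.
have bcross : bmeas2 cross by rewrite /cross; bmeas.
have -> : int2 (fun z => (rho z.1 * rho z.2 + e z) * wedge v w z) =
    area_form rho v w + det * int2 (fun z => e z * wedge c s z) + int2 (fun z => e z * cross z).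
  rewrite /area_form -int2Z; last by bmeas.
  rewrite -int2D; [|by bmeas|by bmeas]; rewrite -int2D; [|by bmeas|by bmeas].
  by apply: eq_int2 => z _; rewrite /cross; ring.
have total1 : int1 (fun t => rho t * (v t ^+ 2 + w t ^+ 2)) <= pi.
  rewrite -(int1_rho rho_cont dth th_pi); apply: le_int1; [bmeas|bmeas|] => t _.
  by rewrite -[X in _ <= X]mulr1; apply: ler_wpM2l.
have E0 : 0 <= E.
  apply: Rintegral_ge0 => t _; apply: mulr_ge0 => //.
  by apply: addr_ge0; exact: sqr_ge0.
(* The determinant is at most half the sum of the squared coefficients, so by [total] its
   contribution is at most pi - E; adding (pi / 2 - 1) E leaves pi - kap E. *)
have main : area_form rho v w <= pi - kap * E.
  apply: (le_trans gap).
  have h1 : a1 * b2 - a2 * b1 <= 2^-1 * (a1 ^+ 2 + a2 ^+ 2 + b1 ^+ 2 + b2 ^+ 2).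
    have := sqr_ge0 (a1 - b2); have := sqr_ge0 (a2 + b1); nra.
  have h2 := ler_wpM2l (ltW pi0) h1.
  rewrite /kap; move: total1 h2; rewrite total; lra.
have det8 : `|det| <= 8.
  rewrite /det (le_trans (ler_normB _ _))//.
  have := norm_le_mul na1 nb2; have := norm_le_mul na2 nb1; lra.
have dete : det * int2 (fun z => e z * wedge c s z) <= 8 * T.
  exact: le_trans (ler_norm _) (norm_le_mul det8 e_wedge).
pose eta t := x t ^+ 2 + y t ^+ 2.
have beta : bmeas1 eta by rewrite /eta; bmeas.
have eta0 t : 0 <= eta t by apply: addr_ge0; exact: sqr_ge0.
have crossI : int2 (fun z => e z * cross z) <=
    int2 (fun z => (fun t => del * eta t) z.1 * psi eps (z.2 - z.1) +
      ((fun t => del * eta t) z.2 * psi eps (z.2 - z.1) + (16 * C ^+ 2 / del) * psi eps (z.2 - z.1))).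
  apply: le_int2; [by bmeas|by bmeas|] => -[a b] tz.
  have psi0 : 0 <= psi eps (b - a) by exact: psi_triangle_ge0 tz.
  apply: (le_trans (ler_norm _)); rewrite normrM.
  have h1 : `|e (a, b)| * `|cross (a, b)| <= C * psi eps (b - a) * `|cross (a, b)|.
    by apply: ler_wpM2r => //; exact: e_psi tz.
  apply: (le_trans h1) => /=.
  (* Keeping v a and w a unexpanded, with absolute value at most 1, leaves no product of two
     orthogonal components. *)
  have -> : cross (a, b) = v a * y b + x a * (b1 * c b + b2 * s b) - (a1 * c b + a2 * s b) * y a - x b * w a.
    by rewrite /cross /wedge /det /x /y /=; ring.
  have := cross_bound (x a) (x b) (y a) (y b) del0 na1 na2 nb1 nb2
    (cos_norm_le1 cs1 b) (sin_norm_le1 cs1 b) (v1 a) (w1 a).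
  move/(ler_wpM2r psi0); rewrite mulrAC => /le_trans; apply.
  by rewrite le_eqVlt; apply/orP; left; apply/eqP; rewrite /eta; ring.
have crossL : int2 (fun z => e z * cross z) <= kap * E + 32 * pi * C ^+ 2 * M / kap * L ^+ 2.
  apply: (le_trans crossI).
  rewrite int2D; [|by bmeas|by bmeas]; rewrite int2D; [|by bmeas|by bmeas].
  have deleta0 t : 0 <= (fun t => del * eta t) t by apply: mulr_ge0 => //; exact: ltW.
  have bde : bmeas1 (fun t => del * eta t) by bmeas.
  have k1 := int2_psi_fst bde deleta0.
  have k2 := int2_psi_snd bde deleta0.
  have k3 : int2 (fun z => 16 * C ^+ 2 / del * psi eps (z.2 - z.1)) <= 16 * C ^+ 2 / del * (L * pi).
    have q0 : 0 <= 16 * C ^+ 2 / del :> R.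
      by apply: divr_ge0; [apply: mulr_ge0 => //; exact: sqr_ge0|exact: ltW].
    have := @int2_psi_fst (fun=> 16 * C ^+ 2 / del) (bmeas1_cst _) (fun=> q0).
    rewrite int1_cst => /le_trans; apply.
    by rewrite le_eqVlt; apply/orP; left; apply/eqP; ring.
  have etaE : int1 (fun t => del * eta t) <= del * (M * E).
    rewrite int1Z//; apply: ler_wpM2l; first exact: ltW.
    rewrite /E -int1Z; last by bmeas.
    apply: le_int1; [by []|by bmeas|] => t _.
    rewrite mulrA -[X in X <= _]mul1r; apply: ler_wpM2r; [exact: eta0|exact: rhoM].
  have k4 := ler_wpM2l (ltW L0) etaE.
  have -> : kap * E + 32 * pi * C ^+ 2 * M / kap * L ^+ 2 =
     L * (del * (M * E)) + (L * (del * (M * E)) + 16 * C ^+ 2 / del * (L * pi)).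
    by rewrite /del; apply: balance; exact: lt0r_neq0.
  by apply: lerD; [exact: le_trans k1 k4|apply: lerD; [exact: le_trans k2 k4|exact: k3]].
have := lerD (lerD main dete) crossL; move/le_trans; apply.
by rewrite -/kap le_eqVlt; apply/orP; left; apply/eqP; ring.
Qed.

End UpperBound.

(** * The comass *)

Section Representatives.
Variable R : realType.
Notation mu := (@lebesgue_measure R).
Implicit Types (u v w : R -> R).

Definition ae0pi (P : R -> Prop) : Prop :=
  {ae mu, forall x, `[0, pi[%classic x -> P x}.

Lemma ae0pi_imp (P Q : R -> Prop) : (forall x, P x -> Q x) -> ae0pi P -> ae0pi Q.
Proof.
rewrite /ae0pi => PQ hP; apply: (negligibleS _ hP) => x /= nQ Px.
by apply: nQ => x0; exact/PQ/Px.
Qed.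

Lemma ae0pi_and (P Q : R -> Prop) : ae0pi P -> ae0pi Q -> ae0pi (fun x => P x /\ Q x).
Proof.
rewrite /ae0pi => hP hQ; apply: (negligibleS _ (negligibleU hP hQ)) => x /= nPQ.
by apply: contrapT => /not_orP[/contrapT hp /contrapT hq]; apply: nPQ => x0;
  split; [exact: hp|exact: hq].
Qed.

Lemma ae0pi_true (P : R -> Prop) : (forall x, P x) -> ae0pi P.
Proof. by rewrite /ae0pi => h; apply: aeW => x _. Qed.

Lemma ae0pi_forall (T : countType) (P : T -> R -> Prop) :
  (forall i, ae0pi (P i)) -> ae0pi (fun x => forall i, P i x).
Proof.
rewrite /ae0pi => h.
have : {ae mu, forall x, forall n : nat, `[0, pi[%classic x ->
    if unpickle n is Some i then P i x else True}.
  apply: ae_foralln => n; case: (unpickle n) => [i|]; first exact: h.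
  exact: aeW.
move=> hn; apply: (negligibleS _ hn) => x /= nP hx; apply: nP => x0 i.
by have := hx (pickle i) x0; rewrite pickleK.
Qed.

Lemma restrict_bmeas1 (A : set R) u M : measurable A -> measurable_fun A u ->
  (forall x, A x -> `|u x| <= M) -> 0 <= M ->
  bmeas1 (u \_ A) /\ forall x, `|(u \_ A) x| <= M.
Proof.
move=> mA mu_ uM M0.
have b x : `|(u \_ A) x| <= M.
  by rewrite patchE; case: ifPn => [|_]; [rewrite inE => /uM|rewrite normr0].
split=> //; split; last by exists M => x _.
by apply/(measurable_restrictT _ mA).
Qed.

(** The representative is zero outside [0, pi[ and where v exceeds its essential bound, which turns
    an almost everywhere bound into one that holds at every point. *)
Lemma Linf_representative v : Linf v ->
  exists v', bmeas1 v' /\ ae0pi (fun x => v x = v' x).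
Proof.
move=> [mv [M vM]].
pose A := `[0, pi[%classic `&` (v @^-1` `[- M, M]).
have mA : measurable A by apply: mv => //; exact: measurable_itv.
have bA x : A x -> `|v x| <= `|M|.
  move=> [_ /=]; rewrite in_itv/= => h.
  by apply: (@le_trans _ _ M); [rewrite ler_norml|exact: ler_norm].
have [b1 b2] := restrict_bmeas1 mA (measurable_funS (measurable_itv _) (@subIsetl _ _ _) mv) bA (normr_ge0 M).
exists (v \_ A); split => //.
rewrite /ae0pi; apply: (negligibleS _ vM) => x /= nx vx; apply: nx => x0.
rewrite patchE mem_set//.
by split => //=; rewrite in_itv/= -ler_norml vx.
Qed.

Lemma disc_representative v w : bmeas1 v -> bmeas1 w -> ae0pi (fun x => v x ^+ 2 + w x ^+ 2 <= 1) ->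
  exists v' w', [/\ bmeas1 v', bmeas1 w', (forall t, v' t ^+ 2 + w' t ^+ 2 <= 1) &
    ae0pi (fun x => v x = v' x /\ w x = w' x)].
Proof.
move=> [mv _] [mw _] vw1.
pose A := (fun x => v x ^+ 2 + w x ^+ 2) @^-1` `]-oo, 1].
have mA : measurable A.
  rewrite -[X in measurable X]setTI; apply: measurable_funD; [exact: measurable_funX|exact: measurable_funX|by []|exact: measurable_itv].
have Ax x : A x -> v x ^+ 2 + w x ^+ 2 <= 1 by rewrite /A /= in_itv.
have v1 x : A x -> `|v x| <= 1.
  by move=> /Ax h; have := sqr_ge0 (w x) => ?; rewrite ler_norml; apply/andP; split; nra.
have w1 x : A x -> `|w x| <= 1.
  by move=> /Ax h; have := sqr_ge0 (v x) => ?; rewrite ler_norml; apply/andP; split; nra.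
have [bv _] := restrict_bmeas1 mA (measurable_funS measurableT (@subsetT _ _) mv) v1 ler01.
have [bw _] := restrict_bmeas1 mA (measurable_funS measurableT (@subsetT _ _) mw) w1 ler01.
exists (v \_ A), (w \_ A); split => //.
  move=> t; rewrite !patchE; case: ifPn => [|_]; first by rewrite inE => /Ax.
  by rewrite !expr0n/= addr0 ler01.
by apply: ae0pi_imp vw1 => x hx; rewrite !patchE mem_set.
Qed.

(** For every a in ]0, pi[ the inner integral ignores a null set of b and equals a combination of
    integrals of v' and w' with coefficients v a, w a. A second null set is then discarded in the
    outer integral. This passes from iterated integrals over closed intervals to an integral over
    the open triangle. *)
Lemma omega_t_int2 (f v w v' w' : R -> R) : continuous f ->
  bmeas2 (fun z => p_ab f z.1 z.2) ->
  measurable_fun `[0, pi[ v -> measurable_fun `[0, pi[ w -> bmeas1 v' -> bmeas1 w' ->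
  ae0pi (fun x => v x = v' x) -> ae0pi (fun x => w x = w' x) ->
  omega_t f v w = pi^-1 * int2 (fun z => p_ab f z.1 z.2 * wedge v' w' z).
Proof.
move=> cf bK mv mw bv bw vv ww; congr (_ * _).
have mK := measurable_p_ab cf.
pose P u a := Rintegral mu `]a, pi[ (fun b => p_ab f a b * u b).
have bKu u : bmeas1 u -> bmeas2 (fun z => p_ab f z.1 z.2 * u z.2).
  by move=> bu; apply: bmeas2M => //; exact: bmeas2_snd.
have mP u : bmeas1 u -> measurable_fun `]0, pi[ (P u).
  by move=> bu; apply/measurable_EFinP; exact: (measurable_int _ (integrable_inner1 (bKu _ bu))).
have sub0 : `]0, pi[ `<=` (`[0, pi[%classic : set R) by apply: subset_itvr; rewrite bnd_simp.
have suba a : 0 < a < pi -> `[a, pi[ `<=` (`[0, pi[%classic : set R).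
  by move=> /andP[a0 _]; apply: subset_itvr; rewrite bnd_simp ltW.
have inner a : 0 < a < pi ->
    Rintegral mu `[a, pi] (fun b => p_ab f a b * (v a * w b - v b * w a)) =
    v a * P w' a - w a * P v' a.
  move=> a0pi; have /andP[a0 api] := a0pi.
  have mKa : measurable_fun `[a, pi[ (fun b => p_ab f a b).
    exact: measurable_funS (measurable_section1 a mK).
  have mva := measurable_funS (measurable_itv _) (suba _ a0pi) mv.
  have mwa := measurable_funS (measurable_itv _) (suba _ a0pi) mw.
  have mI : measurable_fun `[a, pi[ (fun b => p_ab f a b * (v a * w b - v b * w a)).
    by apply: measurable_funM => //; apply: measurable_funB; apply: measurable_funM => //; exact: measurable_cst.
  have sa : `]a, pi[ `<=` (`[a, pi[%classic : set R) by apply: subset_itvr; rewrite bnd_simp.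
  have mIo := measurable_funS (measurable_itv _) sa mI.
  transitivity (Rintegral mu `]a, pi[ (fun b => p_ab f a b * (v a * w b - v b * w a))).
    rewrite /Rintegral -integral_itv_bndo_bndc; last exact/measurable_EFinP.
    by rewrite -integral_itv_obnd_cbnd//; exact/measurable_EFinP.
  transitivity (Rintegral mu `]a, pi[ (fun b => v a * (p_ab f a b * w' b) - w a * (p_ab f a b * v' b))).
    congr fine; apply: ae_eq_integral => //.
    - exact/measurable_EFinP.
    - apply/measurable_EFinP; have m0 u : bmeas1 u -> measurable_fun `]a, pi[ (fun b => p_ab f a b * u b).
        move=> [mu_ _]; apply: measurable_funM; last exact: measurable_funS mu_.
        exact: measurable_funS (measurable_section1 a mK).
      by apply: measurable_funB; apply: measurable_funM; rewrite //; solve [exact: measurable_cst|exact: m0].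
    - apply: (negligibleS _ (ae0pi_and vv ww)) => b /= nb h; apply: nb => bab.
      have [-> ->] := h (suba _ a0pi _ (sa _ bab)); congr EFin; ring.
  have iK u : bmeas1 u -> mu.-integrable `]a, pi[ (EFin \o (fun b => p_ab f a b * u b)).
    by move=> bu; exact: (bmeas2_section1 (bKu _ bu)).
  rewrite RintegralB//; last 2 first.
  - by apply: (integrableZl _ (v a) (iK _ bw)).
  - by apply: (integrableZl _ (w a) (iK _ bv)).
  by rewrite !RintegralZl//; exact: iK.
pose g a := Rintegral mu `[a, pi] (fun b => p_ab f a b * (v a * w b - v b * w a)).
(* Measurability of the outer integrand is read off from its closed form; it is required to discard
   endpoints and null sets. *)
have mPo : measurable_fun `]0, pi[ (fun a => v a * P w' a - w a * P v' a).
  apply: measurable_funB; apply: measurable_funM; try exact: mP.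
    exact: measurable_funS mv.
  exact: measurable_funS mw.
have mg : measurable_fun `]0, pi[ g.
  apply: eq_measurable_fun mPo => a; rewrite inE/= in_itv/= => a0pi.
  by rewrite -inner.
have pi0 := @pi_gt0 R.
have mg0 : measurable_fun `[0, pi[ g.
  rewrite -(setU1itv (x := 0) false) ?bnd_simp//.
  by apply/measurable_funU => //; split => //; exact: measurable_fun_set1.
have -> : Rintegral mu `[0, pi] g = Rintegral mu `]0, pi[ g.
  rewrite /Rintegral -integral_itv_bndo_bndc; last exact/measurable_EFinP.
  by rewrite -integral_itv_obnd_cbnd//; exact/measurable_EFinP.
transitivity (Rintegral mu `]0, pi[ (fun a => v' a * P w' a - w' a * P v' a)).
  congr fine; apply: ae_eq_integral => //.
  - exact/measurable_EFinP.
  - apply/measurable_EFinP.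
    by apply: measurable_funB; apply: measurable_funM; try exact: mP;
      [exact: measurable_funS bv.1|exact: measurable_funS bw.1].
  - apply: (negligibleS _ (ae0pi_and vv ww)) => a /= na h; apply: na => a0pi.
    have a0 : 0 < a < pi by move: (a0pi); rewrite /= in_itv.
    by have [<- <-] := h (sub0 _ a0pi); rewrite /= -(inner _ a0).
rewrite int2_iterated1; last by apply: bmeas2M => //; exact: bmeas2_wedge.
apply: eq_int1 => a a0pi.
have iK u : bmeas1 u -> mu.-integrable `]a, pi[ (EFin \o (fun b => p_ab f a b * u b)).
  by move=> bu; exact: (bmeas2_section1 (bKu _ bu)).
rewrite /P -!RintegralZl//; try exact: iK.
rewrite -RintegralB//; last 2 first.
- by apply: (integrableZl _ (v' a) (iK _ bw)).
- by apply: (integrableZl _ (w' a) (iK _ bv)).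
by apply: eq_Rintegral => b _; rewrite /wedge /=; ring.
Qed.

End Representatives.

(** * Ellipses in the unit ball and bounds for the comass *)

Section ComassBounds.
Variable R : realType.
Notation mu := (@lebesgue_measure R).
Implicit Types (u v w : R -> R).

Lemma linf_norm_le u M : 0 <= M -> ae0pi (fun x => `|u x| <= M) -> linf_norm u <= M.
Proof. by move=> M0 uM; apply: ge_inf; [exists 0 => ? []|split]. Qed.

Lemma rat_small (e : R) : 0 < e -> exists q : rat, 0 < ratr q :> R /\ ratr q < e.
Proof.
move=> e0; have [q] := rat_in_itvoo e0; rewrite in_itv/= => /andP[q0 qe].
by exists q.
Qed.

(** The infimum is attained: one null set for each positive rational excess over it, hence countably
    many. *)
Lemma ae_le_linf_norm u : Linf u -> ae0pi (fun x => `|u x| <= linf_norm u).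
Proof.
move=> [mu_ [M uM]].
have ne : [set M : R | 0 <= M /\ ae0pi (fun x => `|u x| <= M)] !=set0.
  exists `|M|; split => //; apply: ae0pi_imp uM => x /le_trans; apply; exact: ler_norm.
have := @ae0pi_forall R rat (fun q x => 0 < ratr q :> R -> `|u x| <= linf_norm u + ratr q).
have h (q : rat) : ae0pi (fun x => 0 < ratr q :> R -> `|u x| <= linf_norm u + ratr q).
  have [q0|q0] := ltP 0 (ratr q : R); last first.
    by apply: ae0pi_true => x.
  have [|N [N0 uN] lN] := @inf_lt R [set M : R | 0 <= M /\ ae0pi (fun x => `|u x| <= M)] (linf_norm u + ratr q) ne.
    by rewrite ltrDl.
  by apply: ae0pi_imp uN => x h _; apply: le_trans h (ltW lN).
move=> /(_ h); apply: ae0pi_imp => x hx; apply/ler_addgt0Pr => e e0.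
have [q [q0 qe]] := rat_small e0.
by apply: (le_trans (hx q q0)); rewrite lerD2l ltW.
Qed.

Lemma Linf_lin (a b : R) v w : Linf v -> Linf w -> Linf (fun x => a * v x + b * w x).
Proof.
move=> [mv [M vM]] [mw [N wN]]; split.
  by apply: measurable_funD; apply: measurable_funM => //; exact: measurable_cst.
exists (`|a| * M + `|b| * N); apply: ae0pi_imp (ae0pi_and vM wN) => x [h1 h2].
by apply: norm_le_add; apply: norm_le_mul.
Qed.

Lemma continuous_le0_rat (phi : R -> R) : continuous phi ->
  (forall q : rat, phi (ratr q) <= 0) -> forall x, phi x <= 0.
Proof.
move=> cphi h x; rewrite leNgt; apply/negP => px.
have op : open (phi @^-1` `]0, +oo[).
  by apply: open_comp => [? _|]; [exact: cphi|exact: interval_open].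
have [|y [/= + [q _ qy]]] := @dense_rat R (phi @^-1` `]0, +oo[) _ op.
  by exists x => /=; rewrite in_itv/= px.
by rewrite -qy in_itv/= andbT ltNge h.
Qed.

(* A pair is in the unit disc as soon as its scalar products with the rational directions
   are bounded by their lengths. *)
Lemma disc_rat (p q : R) :
  (forall i j : rat, (ratr i * p + ratr j * q) ^+ 2 <= ratr i ^+ 2 + ratr j ^+ 2) ->
  p ^+ 2 + q ^+ 2 <= 1.
Proof.
move=> h.
have cpoly (k l m : R) : continuous (fun x : R => k + x * (l + x * m)).
  apply: (@has_deriv_continuous _ _ (fun x => x * (0 + (x * 0 + m * 1)) + (l + x * m) * 1)) => x.
  have did : has_deriv x (fun z : R => z) 1 by exact: is_derive_id.
  apply: deriv_funDl; apply: (deriv_funM did).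
  apply: deriv_funD; first exact: is_derive_cst.
  by apply: (deriv_funM did); exact: is_derive_cst.
have h1 (i : rat) (b : R) : (ratr i * p + b * q) ^+ 2 <= ratr i ^+ 2 + b ^+ 2.
  rewrite -subr_le0.
  have := @continuous_le0_rat (fun b => (ratr i * p) ^+ 2 - ratr i ^+ 2 + b * (2 * (ratr i * p) * q + b * (q ^+ 2 - 1))).
  have e b' : (ratr i * p + b' * q) ^+ 2 - (ratr i ^+ 2 + b' ^+ 2) =
    (ratr i * p) ^+ 2 - ratr i ^+ 2 + b' * (2 * (ratr i * p) * q + b' * (q ^+ 2 - 1)) by ring.
  rewrite e; apply; first exact: cpoly.
  by move=> j; rewrite -e subr_le0.
have h2 (a b : R) : (a * p + b * q) ^+ 2 <= a ^+ 2 + b ^+ 2.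
  rewrite -subr_le0.
  have := @continuous_le0_rat (fun a => (b * q) ^+ 2 - b ^+ 2 + a * (2 * (b * q) * p + a * (p ^+ 2 - 1))).
  have e a' : (a' * p + b * q) ^+ 2 - (a' ^+ 2 + b ^+ 2) =
    (b * q) ^+ 2 - b ^+ 2 + a' * (2 * (b * q) * p + a' * (p ^+ 2 - 1)) by ring.
  rewrite e; apply; first exact: cpoly.
  by move=> j; rewrite -e subr_le0.
have := h2 p q; rewrite -!expr2; set S := p ^+ 2 + q ^+ 2 => SS.
rewrite leNgt; apply/negP => S1; have : S < S ^+ 2 by rewrite expr2 ltr_pMl// (lt_trans ltr01).
by rewrite ltNge SS.
Qed.

(** Each direction in the disc brings its own null set, so only countably many can be used at once;
    the rational directions suffice by [disc_rat]. *)
Lemma ellipse_disc v w a11 a12 a21 a22 c1 c2 : Linf v -> Linf w ->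
  ellipse_in_ball v w a11 a12 a21 a22 c1 c2 ->
  ae0pi (fun x => (a11 * v x + a21 * w x) ^+ 2 + (a12 * v x + a22 * w x) ^+ 2 <= 1).
Proof.
move=> Lv Lw [_ hb].
have hx (x1 x2 : R) : x1 ^+ 2 + x2 ^+ 2 <= 1 ->
    ae0pi (fun y => `|x1 * (a11 * v y + a21 * w y) + x2 * (a12 * v y + a22 * w y)| <= 1).
  move=> x12.
  (* Averaging the bounds at opposite points of the disc removes the centre (c1, c2). *)
  have x12' : (- x1) ^+ 2 + (- x2) ^+ 2 <= 1 by rewrite !sqrrN.
  have bnd k l : linf_norm (fun y => k * v y + l * w y) <= 1 -> ae0pi (fun y => `|k * v y + l * w y| <= 1).
    by move=> le1; apply: ae0pi_imp (ae_le_linf_norm (Linf_lin k l Lv Lw)) => y /le_trans; apply.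
  apply: ae0pi_imp (ae0pi_and (bnd _ _ (hb _ _ x12)) (bnd _ _ (hb _ _ x12'))) => y.
  rewrite !ler_norml => -[/andP[p1 p2] /andP[p3 p4]].
  by apply/andP; split; lra.
have := @ae0pi_forall R (rat * rat)%type (fun ij y =>
  (ratr ij.1 * (a11 * v y + a21 * w y) + ratr ij.2 * (a12 * v y + a22 * w y)) ^+ 2
    <= ratr ij.1 ^+ 2 + ratr ij.2 ^+ 2).
have h (ij : rat * rat) : ae0pi (fun y =>
  (ratr ij.1 * (a11 * v y + a21 * w y) + ratr ij.2 * (a12 * v y + a22 * w y)) ^+ 2
    <= ratr ij.1 ^+ 2 + ratr ij.2 ^+ 2).
  case: ij => i j /=; set i' : R := ratr i; set j' : R := ratr j.
  set N := i' ^+ 2 + j' ^+ 2; have N0 : 0 <= N by apply: addr_ge0; exact: sqr_ge0.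
  have [Np|Nn] := ltP 0 N; last first.
    have /eqP : N = 0 by apply/eqP; rewrite eq_le Nn.
    rewrite paddr_eq0 ?sqr_ge0// !sqrf_eq0 => /andP[/eqP -> /eqP ->].
    by apply: ae0pi_true => y; rewrite !mul0r addr0 expr0n.
  (* A rational direction is scaled to the unit circle by its possibly irrational length. *)
  pose r := Num.sqrt N; have r0 : 0 < r by rewrite sqrtr_gt0.
  have r2 : r ^+ 2 = N by rewrite sqr_sqrtr.
  have := hx (i' / r) (j' / r).
  have -> : (i' / r) ^+ 2 + (j' / r) ^+ 2 = 1.
    transitivity (N / N); last by rewrite divff// gt_eqF.
    by rewrite -{2}r2 /N; field; exact: lt0r_neq0.
  move=> /(_ (lexx _)); apply: ae0pi_imp => y.
  have -> : i' / r * (a11 * v y + a21 * w y) + j' / r * (a12 * v y + a22 * w y) =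
    (i' * (a11 * v y + a21 * w y) + j' * (a12 * v y + a22 * w y)) / r by ring.
  rewrite normrM normfV (gtr0_norm r0) ler_pdivrMr// mul1r => le.
  rewrite -r2 -[X in X <= _]real_normK ?num_real// ler_pXn2r// nnegrE; exact: ltW.
move=> /(_ h); apply: ae0pi_imp => y hy.
by apply: disc_rat => i j; exact: (hy (i, j)).
Qed.

Variable f : R -> R.
Hypothesis cf : continuous f.
Hypothesis bK : bmeas2 (fun z => p_ab f z.1 z.2).

Let omega v w : R := pi^-1 * int2 (fun z => p_ab f z.1 z.2 * wedge v w z).

Let omegaZ k v w : bmeas1 v -> bmeas1 w -> omega (fun x => k * v x) w = k * omega v w.
Proof.
move=> bv bw; rewrite /omega [RHS]mulrCA -(int2Z k); last by apply: bmeas2M => //; exact: bmeas2_wedge.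
by congr (_ * _); apply: eq_int2 => z _; rewrite /wedge; ring.
Qed.

Let omega_wedge a11 a12 a21 a22 v w : bmeas1 v -> bmeas1 w ->
  omega (fun x => a11 * v x + a21 * w x) (fun x => a12 * v x + a22 * w x) =
  (a11 * a22 - a12 * a21) * omega v w.
Proof.
move=> bv bw; rewrite /omega [RHS]mulrCA -(int2Z (a11 * a22 - a12 * a21)); last by apply: bmeas2M => //; exact: bmeas2_wedge.
by congr (_ * _); apply: eq_int2 => z _; rewrite /wedge; ring.
Qed.

Let omega_ae v w v' w' : bmeas1 v -> bmeas1 w -> bmeas1 v' -> bmeas1 w' ->
  ae0pi (fun x => v x = v' x) -> ae0pi (fun x => w x = w' x) -> omega v w = omega v' w'.
Proof.
move=> bv bw bv' bw' vv ww.
have mS u : bmeas1 u -> measurable_fun `[0, pi[ u by move=> [mu_ _]; exact: measurable_funS mu_.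
rewrite /omega -(omega_t_int2 cf bK (mS _ bv) (mS _ bw) bv' bw' vv ww).
by rewrite (omega_t_int2 cf bK (mS _ bv) (mS _ bw) bv bw)//; exact: ae0pi_true.
Qed.

(** The linear part of an admissible ellipse carries (v, w) to a pair with values in the disc almost
    everywhere and multiplies the form by its determinant; the supremum over ellipses then gives the
    factor [mu_ir]. A one-sided hypothesis is enough because exchanging v and w changes the sign. *)
Lemma comass_bounds_upper (B : R) : 0 <= B ->
  (forall v w, bmeas1 v -> bmeas1 w -> (forall t, v t ^+ 2 + w t ^+ 2 <= 1) ->
    int2 (fun z => p_ab f z.1 z.2 * wedge v w z) <= pi * B) ->
  comass_bounds f B.
Proof.
move=> B0 hB; have pi0 := @pi_gt0 R; split => // v w Lv Lw.
have ub v1 w1 : bmeas1 v1 -> bmeas1 w1 -> ae0pi (fun x => v1 x ^+ 2 + w1 x ^+ 2 <= 1) ->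
    `|omega v1 w1| <= B.
  move=> b1 b2 /(disc_representative b1 b2)[v2 [w2 [b3 b4 vw /[dup] ae1 ae2]]].
  rewrite (omega_ae b1 b2 b3 b4); [|by apply: ae0pi_imp ae1 => x []|by apply: ae0pi_imp ae2 => x []].
  have le1 := hB _ _ b3 b4 vw.
  have wv t : w2 t ^+ 2 + v2 t ^+ 2 <= 1 by rewrite addrC.
  have le2 := hB _ _ b4 b3 wv.
  have swp : int2 (fun z => p_ab f z.1 z.2 * wedge w2 v2 z) = - int2 (fun z => p_ab f z.1 z.2 * wedge v2 w2 z).
    rewrite -int2N; last by apply: bmeas2M => //; exact: bmeas2_wedge.
    by apply: eq_int2 => z _; rewrite /wedge; ring.
  rewrite /omega normrM gtr0_norm ?invr_gt0// ler_pdivrMl// ler_norml le1 andbT.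
  by rewrite lerNl -swp.
have [v' [bv vv]] := Linf_representative Lv.
have [w' [bw ww]] := Linf_representative Lw.
have -> : omega_t f v w = omega v' w' by apply: omega_t_int2 => //; [case: Lv|case: Lw].
rewrite /mu_ir; case: ifPn => [/asboolP|_].
  (* For a dependent pair [mu_ir] is 0, so the form itself has to vanish. *)
  move=> [s [t [st0 n0]]]; rewrite mulr0.
  have : ae0pi (fun x => s * v' x + t * w' x = 0).
    have := ae_le_linf_norm (Linf_lin s t Lv Lw); rewrite n0 => h0.
    apply: ae0pi_imp (ae0pi_and h0 (ae0pi_and vv ww)) => x [h [<- <-]].
    by apply/eqP; rewrite -normr_le0.
  move=> dep; suff -> : omega v' w' = 0 by rewrite normr0.
  have w0 u : bmeas1 u -> omega u u = 0.
    move=> bu; rewrite /omega (@eq_int2 _ _ (fun=> 0 * 0)); last first.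
      by move=> z _; rewrite /wedge mulrC [u z.2 * _]mulrC subrr mul0r mulr0.
    by rewrite int2Z ?mul0r ?mulr0//; exact: bmeas2_cst.
  case: st0 => [s0|t0].
    rewrite (omega_ae (v' := fun x => - (t / s) * w' x) (w' := w')) ?omegaZ ?w0 ?mulr0//.
    - by bmeas.
    - apply: ae0pi_imp dep => x /eqP; rewrite addr_eq0 => /eqP h.
      by apply: (mulfI s0); rewrite h; field.
    - exact: ae0pi_true.
  rewrite (omega_ae (v' := v') (w' := fun x => - (s / t) * v' x))//.
  - have -> : omega v' (fun x => - (s / t) * v' x) = (s / t) * omega v' v'.
      rewrite /omega [RHS]mulrCA -(int2Z (s / t)); last by apply: bmeas2M => //; exact: bmeas2_wedge.
      by congr (_ * _); apply: eq_int2 => z _; rewrite /wedge; ring.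
    by rewrite w0 ?mulr0.
  - by bmeas.
  - exact: ae0pi_true.
  - apply: ae0pi_imp dep => x /eqP; rewrite addrC addr_eq0 => /eqP h.
    by apply: (mulfI t0); rewrite h; field.
rewrite /max_ellipse_det; set S := [set r : R | _].
have Sb r : S r -> r * `|omega v' w'| <= B.
  move=> [a11 [a12 [a21 [a22 [c1 [c2 [ell ->]]]]]]].
  rewrite -normrM -omega_wedge//; apply: ub; [by bmeas|by bmeas|].
  have := ellipse_disc Lv Lw ell => h.
  by apply: ae0pi_imp (ae0pi_and h (ae0pi_and vv ww)) => x [+ [<- <-]].
have S0 r : S r -> 0 <= r by move=> [? [? [? [? [? [? [_ ->]]]]]]].
have sup0 : 0 <= sup S.
  have [hs|hs] := pselect (has_sup S); last by rewrite sup_out.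
  by have [[x Sx] ?] := hs; apply: le_trans (S0 _ Sx) (ub_le_sup hs.2 Sx).
(* A zero value satisfies the bound whatever [sup S] is; otherwise [Sb] bounds [S], and [sup S] is a
   true supremum. *)
have [->|om0] := eqVneq (omega v' w') 0.
  by rewrite normr0 mulr_ge0// invr_ge0.
have om : 0 < `|omega v' w'| by rewrite normr_gt0.
have Su : has_ubound S by exists (B / `|omega v' w'|) => x Sx; rewrite ler_pdivlMr//; exact: Sb.
(* A small disc is an admissible ellipse, so [sup S] is positive and its inverse is not the default
   value 0. *)
have [eta eta0 Seta] : exists2 eta, 0 < eta & S eta.
  have Nv := ae_le_linf_norm Lv; have Nw := ae_le_linf_norm Lw.
  set n := linf_norm v in Nv; set m := linf_norm w in Nw.
  pose eta := (1 + `|n| + `|m|)^-1.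
  have d0 : 0 < 1 + `|n| + `|m| by rewrite -addrA ltr_wpDr// addr_ge0.
  have eta0 : 0 < eta by rewrite invr_gt0.
  exists (eta ^+ 2); first exact: exprn_gt0.
  exists eta, 0, 0, eta, 0, 0; split; last first.
    by rewrite mulr0 subr0 -expr2 ger0_norm// sqr_ge0.
  split; first by rewrite mulr0 subr0 mulf_neq0// gt_eqF.
  move=> x1 x2 x12; apply: linf_norm_le => //.
  have x11 : `|x1| <= 1 by have := sqr_ge0 x2 => ?; rewrite ler_norml; apply/andP; split; nra.
  have x21 : `|x2| <= 1 by have := sqr_ge0 x1 => ?; rewrite ler_norml; apply/andP; split; nra.
  apply: ae0pi_imp (ae0pi_and Nv Nw) => y [h1 h2].
  rewrite !mul0r !addr0 add0r.
  have -> : eta * x1 * v y + eta * x2 * w y = eta * (x1 * v y + x2 * w y) by ring.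
  rewrite normrM (gtr0_norm eta0) /eta ler_pdivrMl// mulr1.
  have := norm_le_add (norm_le_mul x11 (le_trans h1 (ler_norm _))) (norm_le_mul x21 (le_trans h2 (ler_norm _))).
  by move/le_trans; apply; rewrite !mul1r -addrA lerDr.
have Sp : 0 < sup S by apply: lt_le_trans eta0 (ub_le_sup Su Seta).
rewrite ler_pdivlMr// mulrC -ler_pdivlMr//; apply: ge_sup; first by exists eta.
by move=> x Sx; rewrite ler_pdivlMr//; exact: Sb.
Qed.

(* No boundedness of the set of ellipses is needed: if it is unbounded its sup is the junk
   value 0, and then mu_ir is 0 as well. *)
Lemma comass_bounds_lower (B N : R) (c s : R -> R) : bmeas1 c -> bmeas1 s ->
  (forall t, c t ^+ 2 + s t ^+ 2 = 1) ->
  pi * B <= int2 (fun z => p_ab f z.1 z.2 * wedge c s z) ->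
  comass_bounds f N -> B <= N.
Proof.
move=> bc bs cs1 hB [N0 hN]; have pi0 := @pi_gt0 R.
have c1 t : `|c t| <= 1.
  by have := cs1 t; have := sqr_ge0 (s t) => ? ?; rewrite ler_norml; apply/andP; split; nra.
have s1 t : `|s t| <= 1.
  by have := cs1 t; have := sqr_ge0 (c t) => ? ?; rewrite ler_norml; apply/andP; split; nra.
have mS u : bmeas1 u -> measurable_fun `[0, pi[ u by move=> [mu_ _]; exact: measurable_funS mu_.
have LL u : bmeas1 u -> (forall t, `|u t| <= 1) -> Linf u.
  by move=> bu u1; split; [exact: mS|exists 1; exact: ae0pi_true].
have := hN _ _ (LL _ bc c1) (LL _ bs s1).
rewrite (omega_t_int2 cf bK (mS _ bc) (mS _ bs) bc bs); [|exact: ae0pi_true..].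
have mu1 : mu_ir c s <= 1.
  rewrite /mu_ir; case: ifPn => [//|_].
  rewrite /max_ellipse_det; set S := [set r : R | _].
  (* By Cauchy-Schwarz the unit disc itself is admissible for (c, s). *)
  have S1 : S 1.
    exists 1, 0, 0, 1, 0, 0; rewrite mulr1 mulr0 subr0 normr1; split => //.
    split; first by rewrite mulr1 mulr0 subr0 oner_neq0.
    move=> x1 x2 x12; apply: linf_norm_le => //; apply: ae0pi_true => y.
    rewrite !mul1r !mul0r !addr0 add0r.
    have : (x1 * c y + x2 * s y) ^+ 2 <= 1.
      have := cs1 y; have := sqr_ge0 (x1 * s y - x2 * c y).
      move: (c y) (s y) => p q h1 h2.
      have : (x1 * p + x2 * q) ^+ 2 + (x1 * q - x2 * p) ^+ 2 = (x1 ^+ 2 + x2 ^+ 2) * (p ^+ 2 + q ^+ 2) by ring.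
      by rewrite h2 mulr1; lra.
    by move: (x1 * c y + x2 * s y) => p h; rewrite ler_norml; apply/andP; split; nra.
  have [hs|hs] := pselect (has_sup S); last by rewrite sup_out// invr0.
  have := ub_le_sup hs.2 S1 => s_ge1.
  by rewrite invf_le1// (lt_le_trans ltr01).
move=> h; have h2 : N * mu_ir c s <= N by rewrite -[X in _ <= X]mulr1; exact: ler_wpM2l.
apply: le_trans (le_trans h h2); apply: le_trans (ler_norm _).
by rewrite ler_pdivlMl.
Qed.

Lemma comass_near_one (B : R) (c s : R -> R) : 0 <= B -> bmeas1 c -> bmeas1 s ->
  (forall t, c t ^+ 2 + s t ^+ 2 = 1) ->
  pi * (1 - B) <= int2 (fun z => p_ab f z.1 z.2 * wedge c s z) ->
  (forall v w, bmeas1 v -> bmeas1 w -> (forall t, v t ^+ 2 + w t ^+ 2 <= 1) ->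
    int2 (fun z => p_ab f z.1 z.2 * wedge v w z) <= pi * (1 + B)) ->
  (`|comass_ir f - 1%E| <= B%:E)%E.
Proof.
move=> B0 bc bs cs1 hl hu.
have up : (comass_ir f <= (1 + B)%:E)%E.
  by apply: ereal_inf_lbound; exists (1 + B) => //; apply: comass_bounds_upper => //; rewrite addr_ge0.
have lo : ((1 - B)%:E <= comass_ir f)%E.
  apply: le_ereal_inf_tmp => _ [N hN <-]; rewrite lee_fin.
  exact: (comass_bounds_lower bc bs cs1 hl hN).
case: (comass_ir f) up lo => [r| |] //=.
rewrite !lee_fin => h1 h2.
by rewrite ler_norml; apply/andP; split; lra.
Qed.

End ComassBounds.

(** * The comass estimate with an explicit constant *)

Section MainEstimate.
Variable R : realType.

(** [C] bounds the kernel perturbation and [k] is the constant of [psi_mass_le]. The first summand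
    is the first-mode remainder: 16 is the bound 8 for the determinant times the 2 in eps <= 2
    eps^(xi/2). The second comes from the cross terms absorbed by the spectral gap. *)
Definition error_constant (M xi : R) : R :=
  let C := 220 * M ^+ 4 in let k := 16 / (1 - xi / 2) in
  16 * M * C * k + 32 * C ^+ 2 * M / (2 - pi / 2) * k ^+ 2.

Lemma error_constant_gt0 (M xi : R) : 1 <= M -> 1 < xi < 2 -> 0 < error_constant M xi.
Proof.
move=> M1 /andP[xi1 xi2]; rewrite /error_constant.
have M0 : 0 < M by lra.
have C0 : 0 < 220 * M ^+ 4 by rewrite mulr_gt0// exprn_gt0.
have k0 : 0 < 16 / (1 - xi / 2) by rewrite divr_gt0//; lra.
apply: ltr_wpDr; last first.
  by apply: mulr_gt0 => //; apply: mulr_gt0 => //; exact: mulr_gt0.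
apply: mulr_ge0; last exact: sqr_ge0.
apply: divr_ge0; last by rewrite subr_ge0 ltW// pihalf_lt2.
by apply: mulr_ge0; [apply: mulr_ge0 => //; exact: sqr_ge0|exact: ltW].
Qed.

Lemma error_bound (M eps xi : R) : 1 <= M -> 0 < eps <= 2 -> 1 < xi < 2 ->
  8 * M * (220 * M ^+ 4) * (eps * psi_mass eps) +
    32 * (220 * M ^+ 4) ^+ 2 * M / (2 - pi / 2) * psi_mass eps ^+ 2 <=
  error_constant M xi * eps `^ xi.
Proof.
move=> M1 e02 xi12; set C := 220 * M ^+ 4; set L := psi_mass eps; have /andP[e0 e2] := e02; have /andP[xi1 xi2] := xi12.
have pi2 := @pihalf_lt2 R.
have M0 : 0 < M by lra.
have C0 : 0 < C by rewrite mulr_gt0// exprn_gt0.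
have L0 : 0 < L by exact: psi_mass_gt0.
have := psi_mass_le e02 xi12; rewrite -/L.
rewrite /error_constant -/C; set k := 16 / _ => Lk.
have k0 : 0 < k by rewrite divr_gt0//; lra.
set q := eps `^ (xi / 2) in Lk.
have q0 : 0 < q by exact: powR_gt0.
have qq : eps `^ xi = q * q.
  by rewrite /q -powRD; [congr (_ `^ _); field|rewrite (gt_eqF e0) implybT].
have eq_ : eps <= 2 * q.
  have ee : eps `^ (1 - xi / 2) * q = eps.
    rewrite /q -powRD; last by rewrite (gt_eqF e0) implybT.
    by rewrite subrK (powRr1 (ltW e0)).
  rewrite -[X in X <= _]ee.
  apply: ler_wpM2r; first exact: ltW.
  apply: (@le_trans _ _ (2 `^ (1 - xi / 2))).
    by apply: ge0_ler_powR; rewrite ?nnegrE; lra.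
  rewrite -[X in _ <= X](@powRr1 _ 2)//; apply: ler_powR; lra.
have eL : eps * L <= 2 * q * (k * q) by apply: ler_pM => //; exact: ltW.
have LL : L ^+ 2 <= (k * q) ^+ 2 by rewrite !expr2; apply: ler_pM => //; exact: ltW.
have a0 : 0 <= 8 * M * C.
  by apply: mulr_ge0; [apply: mulr_ge0 => //|]; exact: ltW.
have b0 : 0 <= 32 * C ^+ 2 * M / (2 - pi / 2).
  apply: divr_ge0; last by rewrite subr_ge0 ltW.
  by apply: mulr_ge0; [apply: mulr_ge0 => //; exact: sqr_ge0|exact: ltW].
apply: (le_trans (lerD (ler_wpM2l a0 eL) (ler_wpM2l b0 LL))).
by rewrite qq le_eqVlt; apply/orP; left; apply/eqP; ring.
Qed.

(** Closeness is assumed for the cosines, in which the Gram determinant is polynomial. *)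
Lemma comass_estimate (f : R -> R) (tau d M eps xi : R) : ES1 f -> 0 < sin d ->
  1 <= M -> (sin d ^+ 2)^-1 <= M -> (forall x, 1 <= M * (1 - cos (f x) ^+ 2)) ->
  0 < eps <= 2 -> 1 < xi < 2 ->
  (forall x, `|cos (f x) - cos d * cos (x - tau)| <= eps) ->
  (`|comass_ir f - 1%E| <= (error_constant M xi * eps `^ xi)%:E)%E.
Proof.
move=> ff d0 M1 MD fM e02 xi12 fe; have pi0 := @pi_gt0 R; have pi2 := @pihalf_lt2 R.
have /andP[e0 e2] := e02; have M0 : 0 < M by exact: lt_le_trans M1.
have [be ep ew] := kernel_perturbation ff d0 M1 MD fM e02 fe.
have bK := bmeas2_p_ab ff d0 M1 MD fM e02 fe.
have C0 : 0 < 220 * M ^+ 4 by rewrite mulr_gt0// exprn_gt0.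
have bnd := error_bound M1 e02 xi12.
set C := 220 * M ^+ 4 in C0 ep ew bnd; set L := psi_mass eps in ew bnd.
set T := error_constant M xi * eps `^ xi in bnd *.
have L0 : 0 < L by exact: psi_mass_gt0.
have rhoM x : 1 <= M * rho tau d x.
  have h1 : 1 <= M * sin d ^+ 2.
    by rewrite -ler_pdivrMr ?exprn_gt0// mul1r.
  apply: (le_trans h1); apply: ler_wpM2l; first exact: ltW.
  apply: (le_trans _ (rho_ge tau d0 x)); rewrite expr2 ler_piMr ?sin_le1//; exact: ltW.
have rho0 x : 0 <= rho tau d x by apply: ltW; exact: rho_gt0.
have bc : bmeas1 (cos_th tau d) by apply: continuous_bmeas1; exact: continuous_cos_th.
have bs : bmeas1 (sin_th tau d) by apply: continuous_bmeas1; exact: continuous_sin_th.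
have brho : bmeas1 (rho tau d) by apply: continuous_bmeas1; exact: continuous_rho.
have MCeL : 0 <= M * C * (eps * L) by apply: mulr_ge0; apply: mulr_ge0; exact: ltW.
have t1 : 0 <= 8 * M * C * (eps * L) 
  by rewrite (_ : 8 * M * C * (eps * L) = 8 * (M * C * (eps * L))); [exact: mulr_ge0|ring].
have t2 : 0 <= 32 * C ^+ 2 * M / (2 - pi / 2) * L ^+ 2.
  apply: mulr_ge0; last exact: sqr_ge0.
  apply: divr_ge0; last by rewrite subr_ge0 ltW.
  by apply: mulr_ge0; [apply: mulr_ge0 => //; exact: sqr_ge0|exact: ltW].
have T0 : 0 <= T by apply: le_trans bnd; exact: addr_ge0.
apply: (comass_near_one (ES1_continuous ff) bK T0 bc bs (cos_sin_th tau d0)).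
- rewrite (@eq_int2 _ _ (fun z => rho tau d z.1 * rho tau d z.2 * wedge (cos_th tau d) (sin_th tau d) z +
    (p_ab f z.1 z.2 - rho tau d z.1 * rho tau d z.2) * wedge (cos_th tau d) (sin_th tau d) z)); last first.
    by move=> z _; ring.
  have bw : bmeas2 (wedge (cos_th tau d) (sin_th tau d)) by exact: bmeas2_wedge.
  rewrite int2D; [|by bmeas|by apply: bmeas2M].
  have := area_form_cos_sin (@continuous_rho _ tau d d0) (deriv_cos_th tau d0) (deriv_sin_th tau d0)
    (deriv_theta tau d0) (cos_sin_th tau d0) (cos_th_pi tau d) (sin_th_pi tau d) (theta_pi tau d).
  rewrite /area_form => ->.
  move: ew; rewrite ler_norml => /andP[+ _]; move: (int2 _) => I.
  have h : M * C * eps * (L * pi) <= pi * T.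
    have -> : M * C * eps * (L * pi) = pi * (M * C * (eps * L)) by ring.
    apply: ler_wpM2l; first exact: ltW.
    apply: le_trans bnd.
    have -> : 8 * M * C * (eps * L) = 8 * (M * C * (eps * L)) by ring.
    move: t2 MCeL; move: (M * C * (eps * L)) (32 * C ^+ 2 * M / (2 - pi / 2) * L ^+ 2) => p q; clear; lra.
  by move: h; rewrite mulrBr mulr1; move: (M * C * eps * (L * pi)) (pi * T) (pi : R) => p q r; clear; lra.
- move=> v w bv bw vw.
  rewrite (@eq_int2 _ _ (fun z => (rho tau d z.1 * rho tau d z.2 +
     (p_ab f z.1 z.2 - rho tau d z.1 * rho tau d z.2)) * wedge v w z)); last first.
    by move=> z _; ring.
  have := area_upper (@continuous_rho _ tau d d0) rho0 (deriv_cos_th tau d0) (deriv_sin_th tau d0)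
    (deriv_theta tau d0) (cos_sin_th tau d0) (cos_th_pi tau d) (sin_th_pi tau d) (theta_pi tau d)
    be e0 C0 M0 rhoM ep ew bv bw vw.
  move/le_trans; apply; rewrite [pi * (1 + T)]mulrDr (mulr1 pi) -addrA lerD2l.
  apply: (le_trans _ (ler_wpM2l (ltW pi0) bnd)).
  by rewrite le_eqVlt; apply/orP; left; apply/eqP; rewrite /L; ring.
Qed.

End MainEstimate.

(** * From estimates at a hemisphere point to distances *)

Section Assembly.
Variable R : realType.
Implicit Types (f : R -> R) (r tau d eps : R).

Lemma sin_le_mono (x y : R) : 0 <= x -> x <= y -> y <= pi / 2 -> sin x <= sin y.
Proof.
have pi0 := @pi_gt0 R; move=> x0; rewrite le_eqVlt => /predU1P[->//|xy] ypi; apply: ltW.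
by rewrite ltr_sin// in_itv/=; apply/andP; split; lra.
Qed.

(** The values of f lie in [r, pi - r]. The constant uses r / 2 because it also serves the
    hemisphere point, whose d is only known to be at least r / 2. *)
Lemma ES1_sin_ge f r : ES1 f -> 0 < r -> r <= dist_sup f (@S1 R) -> r <= pi / 2 ->
  forall x, 1 <= (sin (r / 2) ^+ 2)^-1 * (1 - cos (f x) ^+ 2).
Proof.
move=> ff r0 rd rpi x; have pi0 := @pi_gt0 R.
have /andP[h1 h2] := dist_S1_le ff x.
have s0 : 0 < sin (r / 2) by apply: sin_gt0_pi; apply/andP; split; lra.
rewrite ler_pdivlMl ?exprn_gt0// mulr1 sin2cos2 lerD2l lerN2.
have c0 : 0 <= cos (r / 2) by apply: cos_ge0_pihalf; apply/andP; split; lra.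
have c1 : cos (f x) <= cos (r / 2) by apply: le_cos; lra.
have c2 : - cos (r / 2) <= cos (f x).
  have -> : - cos (r / 2) = cos (pi - r / 2) by rewrite cosB cospi sinpi; ring.
  by apply: le_cos; lra.
rewrite -[X in X <= _]real_normK ?num_real// ler_pXn2r ?nnegrE//.
by rewrite ler_norml c1 c2.
Qed.

Let hemisphere_range tau d x : -1 <= cos d * cos (x - tau) <= 1.
Proof. by rewrite -ler_norml -(mulr1 1); apply: norm_le_mul; exact: cos_max. Qed.

Lemma comass_at_hemisphere_point f r tau d eps xi : ES1 f -> 0 < r ->
  r <= dist_sup f (@S1 R) -> r <= pi / 2 -> r / 2 <= d <= pi / 2 ->
  0 < eps <= 2 -> 1 < xi < 2 ->
  (forall x, `|f x - acos (cos d * cos (x - tau))| <= eps) ->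
  (`|comass_ir f - 1%E| <= (error_constant (sin (r / 2) ^+ 2)^-1 xi * eps `^ xi)%:E)%E.
Proof.
move=> ff r0 rd rpi /andP[d1 d2] e02 xi12 fe; have pi0 := @pi_gt0 R.
have s0 : 0 < sin (r / 2) by apply: sin_gt0_pi; apply/andP; split; lra.
have sd : sin (r / 2) <= sin d by apply: sin_le_mono; lra.
have sd0 : 0 < sin d by exact: lt_le_trans s0 sd.
apply: (comass_estimate (tau := tau) (d := d)) => //.
- by rewrite invf_ge1 ?exprn_gt0// sin2cos2 lerBlDr lerDl sqr_ge0.
- rewrite lef_pV2 ?posrE ?exprn_gt0//.
  by rewrite ler_pXn2r ?nnegrE //; exact: ltW.
- exact: ES1_sin_ge.
- move=> x; rewrite -[cos d * cos (x - tau)](acosK (x := _)).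
    exact: le_trans (cos_lipschitz _ _) (fe x).
  by rewrite in_itv/=; exact: hemisphere_range.
Qed.

Lemma supnorm_S2plus f tau d : ES1 f -> forall x,
  `|f x - acos (cos d * cos (x - tau))| <= supnorm (fun a => f a - acos (cos d * cos (a - tau))).
Proof.
move=> ff; apply: (@supnorm_ge _ _ pi) => x.
have /andP[f0 fpi] := ES1_range ff x.
have a0 := acos_ge0 (hemisphere_range tau d x).
have api := acos_lepi (hemisphere_range tau d x).
by rewrite ler_norml; apply/andP; split; lra.
Qed.

Lemma comass_near_hemisphere f r eps xi : ES1 f -> 0 < r ->
  r <= dist_sup f (@S1 R) -> r <= pi / 2 -> 0 < eps <= r / 2 -> 1 < xi < 2 ->
  dist_sup f (@S2plus R) < eps ->
  (`|comass_ir f - 1%E| <= (error_constant (sin (r / 2) ^+ 2)^-1 xi * eps `^ xi)%:E)%E.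
Proof.
move=> ff r0 rd rpi /andP[e0 er] xi12; have pi0 := @pi_gt0 R; have pi2 := @pihalf_lt2 R.
have ne : @S2plus R !=set0.
  exists (fun a => acos (cos 0 * cos (a - 0))), 0, 0; split => //.
  by rewrite lexx divr_ge0// ltW.
move=> /(dist_sup_lt ne)[_ [tau [d [/andP[d0 dpi] ->]]] ge].
have fe x : `|f x - acos (cos d * cos (x - tau))| <= eps.
  exact: le_trans (supnorm_S2plus tau d ff x) (ltW ge).
apply: (comass_at_hemisphere_point (tau := tau) (d := d)) => //; last by apply/andP; split; lra.
rewrite dpi andbT.
(* At tau the hemisphere function equals d, so d >= f tau - eps >= r - r / 2. *)
have := fe tau; rewrite subrr cos0 mulr1 cosK; last first.
  by rewrite in_itv/=; apply/andP; split; lra.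
have /andP[h _] := dist_S1_le ff tau.
by rewrite ler_norml => /andP[h1 h2]; lra.
Qed.

(** The comparison point is the pole d = pi / 2, from which every f has distance at most pi / 2 <
    2. *)
Lemma comass_bounded f r xi : ES1 f -> 0 < r ->
  r <= dist_sup f (@S1 R) -> r <= pi / 2 -> 1 < xi < 2 ->
  (`|comass_ir f - 1%E| <= (error_constant (sin (r / 2) ^+ 2)^-1 xi * 2 `^ xi)%:E)%E.
Proof.
move=> ff r0 rd rpi xi12; have pi0 := @pi_gt0 R; have pi2 := @pihalf_lt2 R.
apply: (comass_at_hemisphere_point (tau := 0) (d := pi / 2)) => //.
- by apply/andP; split; lra.
- by rewrite ltr0n lexx.
- move=> x; rewrite cos_pihalf mul0r acos0.
  have /andP[f0 fpi] := ES1_range ff x.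
  by rewrite ler_norml; apply/andP; split; lra.
Qed.

End Assembly.

Theorem theorem1p2 (R : realType) (r xi : R) :
  0 < r -> 1 < xi < 2 ->
  exists C : R, 0 < C /\
    forall f : R -> R, ES1 f -> r <= dist_sup f (@S1 R) ->
      (`|comass_ir f - 1%E| <= (C * (dist_sup f (@S2plus R)) `^ xi)%:E)%E.
Proof.
move=> r0 xi12; have pi0 := @pi_gt0 R; have pi2 := @pihalf_lt2 R.
(* For r > pi / 2 no f qualifies, as its values would lie between r and pi - r. *)
have [rpi|rpi] := leP r (pi / 2); last first.
  exists 1; split => // f ff rd.
  by have /andP[h1 h2] := dist_S1_le ff 0; exfalso; lra.
have s0 : 0 < sin (r / 2) by apply: sin_gt0_pi; apply/andP; split; lra.
set K := error_constant (sin (r / 2) ^+ 2)^-1 xi.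
have K0 : 0 < K.
  apply: error_constant_gt0 => //.
  by rewrite invf_ge1 ?exprn_gt0// sin2cos2 lerBlDr lerDl sqr_ge0.
have /andP[xi1 xi2] := xi12.
have p8 : 0 < (8 / r) `^ xi by rewrite powR_gt0// divr_gt0.
(* The power of 8 / r serves distances del >= r / 4, where 2 <= (8 / r) del; the 4 bounds 2^xi and
   serves smaller distances, where eps = 2 del. *)
exists (K * ((8 / r) `^ xi + 4)); split; first by rewrite mulr_gt0// addr_gt0.
move=> f ff rd; set del := dist_sup f (@S2plus R).
have del0 : 0 <= del.
  apply: dist_sup_ge0; exists (fun a => acos (cos 0 * cos (a - 0))), 0, 0; split => //.
  by rewrite lexx divr_ge0// ltW.
have two4 : 2 `^ xi <= 4 :> R.
  have -> : 4 = 2 `^ 2 :> R by rewrite powR_mulrn//; ring.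
  by apply: ler_powR; lra.
have [dr|dr] := leP (r / 4) del.
  apply: (le_trans (comass_bounded ff r0 rd rpi xi12)); rewrite -/K lee_fin -mulrA.
  apply: ler_wpM2l; first exact: ltW.
  apply: (@le_trans _ _ ((8 / r) `^ xi * del `^ xi)); last first.
    by apply: ler_wpM2r; [exact: powR_ge0|rewrite lerDl].
  rewrite -powRM//; last by rewrite divr_ge0// ltW.
  apply: ge0_ler_powR; rewrite ?nnegrE//; first lra.
    by apply: mulr_ge0 => //; rewrite divr_ge0// ltW.
  rewrite mulrAC ler_pdivlMr//; lra.
have near eps : 0 < eps <= r / 2 -> del < eps -> (`|comass_ir f - 1%E| <= (K * eps `^ xi)%:E)%E.
  by move=> er de; exact: comass_near_hemisphere.
(* At distance zero no nearest point is chosen: every small eps > 0 is admissible, and eps^xi <= eps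
   makes the bound smaller than any e. *)
move: del0; rewrite le_eqVlt => /predU1P[del_eq|del0].
  rewrite -del_eq powR0 ?mulr0; last by apply: lt0r_neq0; lra.
  apply/lee_addgt0Pr => e e0; rewrite add0e.
  pose eps := Num.min (r / 2) (e / K).
  have eK : 0 < e / K by rewrite divr_gt0.
  have eps0 : 0 < eps by rewrite lt_min eK andbT; lra.
  have epsr : eps <= r / 2 by rewrite ge_min lexx.
  have epse : eps <= e / K by rewrite ge_min lexx orbT.
  apply: (le_trans (near eps _ _)); rewrite ?eps0 ?epsr -?del_eq//.
  rewrite lee_fin mulrC -ler_pdivlMr//; apply: le_trans epse.
  by apply: ge1r_powR; lra.
apply: (le_trans (near (2 * del) _ _)); [by apply/andP; split; lra|lra|].
rewrite lee_fin -mulrA; apply: ler_wpM2l; first exact: ltW.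
rewrite powRM//; last exact: ltW.
apply: ler_wpM2r; first exact: powR_ge0.
by apply: (le_trans two4); rewrite lerDr ltW.
Qed.
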